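(* Let $(R,\mathfrak m)$ be a Noetherian local ring, $E$ an ideal module having rank $e\ge2$ and $U$ a reduction of $E$. Then the following are equivalent: (a) $\operatorname{proj\,dim}E=1$. (b) Any good generic Bourbaki ideal of $E$ with respect to $U$ is perfect of grade $2$. (c) There exists a generic Bourbaki ideal of $E$ with respect to $U$ which is perfect of grade $2$.
   Context: A finitely generated module $E$ over a Noetherian ring $R$ with total ring of fractions $Q$ has rank $e$ if $E\otimes_RQ\simeq Q^e$. A finitely generated torsionfree module $E\subseteq G\simeq R^e$ is an ideal module if $\operatorname{grade}G/E\ge2$, where the grade of a finitely generated module is the grade of its annihilator (this implies that $E$ has rank $e$). $\tau_R(M)$ is the torsion submodule (elements killed by a non-zero-divisor of $R$). The Rees algebra is $\mathcal R(E)=\mathcal S(E)/\tau_R(\mathcal S(E))$, with $\mathcal S(E)$ the symmetric algebra; a submodule $U\subseteq E$ is a reduction of $E$ if $\mathcal R(E)_{s+1}=(U/\tau_R(U))\cdot\mathcal R(E)_s$ for some $s\ge0$. An ideal $I$ of a ring $S$ is perfect of grade $2$ if $\operatorname{grade}I=\operatorname{proj\,dim}S/I=2$. Generic Bourbaki ideal: write $U=\sum_{i=1}^rRa_i$, let $\mathbf Z=\{z_{ij}\mid1\le i\le r,\ 1\le j\le e-1\}$ be indeterminates over $R$, $R'=R[\mathbf Z]$, $R''=R'_{\mathfrak mR'}$ (a Nagata extension of $R$), $E''=E\otimes_RR''$, $x_j=\sum_{i=1}^rz_{ij}a_i\in E''$, $F=\sum_{j=1}^{e-1}R''x_j$ (a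 free $R''$-module of rank $e-1$). An ideal $I\subseteq R''$ isomorphic to $E''/F$ is called a generic Bourbaki ideal of $E$ with respect to $U$; it is called good if $\operatorname{grade}I\ge2$. *)

(* Defs.v *)
From HB Require Import structures.
From mathcomp Require Import all_boot all_algebra ring_quotient.
From mathcomp Require Import ring boolp.
From mathcomp Require Import monalg mpoly.

Set Implicit Arguments.
Unset Strict Implicit.
Unset Printing Implicit Defensive.

Import GRing.Theory.
Local Open Scope ring_scope.
Local Open Scope quotient_scope.

(* Submodules and ideals are Prop-valued predicates.  Commutative rings are   *)
(* taken in comPzRingType (no requirement 1 != 0) wherever a construction     *)
(* such as a quotient or a localization could a priori be the zero ring.      *)

Inductive submod_gen (R : pzRingType) (V : lmodType R) (A : V -> Prop) :
  V -> Prop :=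
| submod_gen0 : submod_gen A 0
| submod_genP a x y : A x -> submod_gen A y -> submod_gen A (a *: x + y).

Lemma submod_genS (R : pzRingType) (V : lmodType R) (A : V -> Prop) x :
  A x -> submod_gen A x.
Proof.
by move=> Ax; have := submod_genP 1 Ax (submod_gen0 A); rewrite scale1r addr0.
Qed.

Lemma submod_genD (R : pzRingType) (V : lmodType R) (A : V -> Prop) x y :
  submod_gen A x -> submod_gen A y -> submod_gen A (x + y).
Proof.
move=> Ax Ay; elim: Ax => [|a u v Au _ IH]; first by rewrite add0r.
by rewrite -addrA; apply: submod_genP.
Qed.

Lemma submod_genZ (R : pzRingType) (V : lmodType R) (A : V -> Prop) a x :
  submod_gen A x -> submod_gen A (a *: x).
Proof.
elim=> [|b u v Au _ IH]; first by rewrite scaler0; apply: submod_gen0.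
by rewrite scalerDr scalerA; apply: submod_genP.
Qed.

Definition submod_gen_pred (R : pzRingType) (V : lmodType R) (A : V -> Prop) :
  {pred V} := fun x => `[< submod_gen A x >].

Lemma submod_gen_zmod_closed (R : pzRingType) (V : lmodType R) (A : V -> Prop) :
  zmod_closed (submod_gen_pred A).
Proof.
split=> [|x y]; rewrite !unfold_in; first exact/asboolP/submod_gen0.
move=> /asboolP Ax /asboolP Ay; apply/asboolP/submod_genD => //.
by rewrite -scaleN1r; apply: submod_genZ.
Qed.

HB.instance Definition _ (R : pzRingType) (V : lmodType R) (A : V -> Prop) :=
  GRing.isZmodClosed.Build V (submod_gen_pred A) (submod_gen_zmod_closed A).

Definition quotm (R : pzRingType) (V : lmodType R) (A : V -> Prop) :=
  Quotient.quot (submod_gen_pred A).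

Section QuotientModule.
Variables (R : pzRingType) (V : lmodType R) (A : V -> Prop).
Local Notation Q := (quotm A).

HB.instance Definition _ := GRing.Zmodule.on Q.

Definition quotm_pi (x : V) : Q := \pi_(Quotient.quot (submod_gen_pred A)) x.

Lemma quotm_eq x y : quotm_pi x = quotm_pi y <-> submod_gen A (x - y).
Proof.
split=> [/eqP|h]; last (apply/eqP; move: h).
  by rewrite -Quotient.idealrBE unfold_in => /asboolP.
by move=> /asboolP h; rewrite -Quotient.idealrBE unfold_in.
Qed.

Lemma quotm_surj (q : Q) : exists x, q = quotm_pi x.
Proof. by exists (repr q); rewrite /quotm_pi reprK. Qed.

Lemma quotm_pi_is_zmod_morphism : zmod_morphism quotm_pi.
Proof.
by move=> x y; apply: (raddfB \pi_(Quotient.quot (submod_gen_pred A))).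
Qed.

HB.instance Definition _ :=
  GRing.isZmodMorphism.Build V Q quotm_pi quotm_pi_is_zmod_morphism.

Definition quotm_scale (a : R) (q : Q) : Q := quotm_pi (a *: repr q).

Lemma quotm_scaleE a x : quotm_scale a (quotm_pi x) = quotm_pi (a *: x).
Proof.
apply/quotm_eq; rewrite -scalerBr; apply/submod_genZ/quotm_eq.
by rewrite /quotm_pi reprK.
Qed.

Lemma quotm_scaleA a b q :
  quotm_scale a (quotm_scale b q) = quotm_scale (a * b) q.
Proof. by have [x ->] := quotm_surj q; rewrite !quotm_scaleE scalerA. Qed.

Lemma quotm_scale1 : left_id 1 quotm_scale.
Proof.
by move=> q; have [x ->] := quotm_surj q; rewrite quotm_scaleE scale1r.
Qed.

Lemma quotm_scaleDr : right_distributive quotm_scale +%R.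
Proof.
move=> a p q; have [x ->] := quotm_surj p; have [y ->] := quotm_surj q.
by rewrite -raddfD !quotm_scaleE -raddfD scalerDr.
Qed.

Lemma quotm_scaleDl q : {morph quotm_scale^~ q : a b / a + b}.
Proof.
move=> a b; have [x ->] := quotm_surj q.
by rewrite !quotm_scaleE -raddfD scalerDl.
Qed.

HB.instance Definition _ := GRing.Zmodule_isLmodule.Build R Q
  quotm_scaleA quotm_scale1 quotm_scaleDr quotm_scaleDl.

Lemma quotm_pi_is_scalable : scalable quotm_pi.
Proof. by move=> a x; rewrite -quotm_scaleE. Qed.

HB.instance Definition _ :=
  GRing.isScalable.Build R V Q *:%R quotm_pi quotm_pi_is_scalable.

End QuotientModule.

Definition ideal_gen (R : comPzRingType) (A : R -> Prop) : R -> Prop :=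
  @submod_gen R R^o A.

Definition quotr (B : comPzRingType) (A : B -> Prop) := @quotm B B^o A.

Section QuotientRing.
Variables (B : comPzRingType) (A : B -> Prop).
Local Notation Q := (quotr A).

HB.instance Definition _ := GRing.Zmodule.on Q.

Definition quotr_pi (x : B) : Q := @quotm_pi B B^o A x.

Lemma quotr_eq x y : quotr_pi x = quotr_pi y <-> ideal_gen A (x - y).
Proof. exact: quotm_eq. Qed.

Lemma quotr_surj (q : Q) : exists x, q = quotr_pi x.
Proof. exact: (@quotm_surj B B^o A). Qed.

Lemma quotr_pi_is_zmod_morphism : zmod_morphism quotr_pi.
Proof. exact: (@quotm_pi_is_zmod_morphism B B^o A). Qed.

HB.instance Definition _ :=
  GRing.isZmodMorphism.Build B Q quotr_pi quotr_pi_is_zmod_morphism.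

Definition quotr_mul (p q : Q) : Q := quotr_pi ((repr p : B) * (repr q : B)).

Lemma quotr_mulE x y : quotr_mul (quotr_pi x) (quotr_pi y) = quotr_pi (x * y).
Proof.
have rep z : exists2 z', (repr (quotr_pi z) : B) = z' & ideal_gen A (z' - z).
  by exists (repr (quotr_pi z)) => //; apply/quotr_eq;
     rewrite /quotr_pi /quotm_pi reprK.
rewrite /quotr_mul; have [x' -> hx] := rep x; have [y' -> hy] := rep y.
apply/quotr_eq.
suff: ideal_gen A (y' * (x' - x) + x * (y' - y)).
  by congr (ideal_gen A _); ring.
by apply: (@submod_genD B B^o); apply: (@submod_genZ B B^o).
Qed.

Lemma quotr_mulA : associative quotr_mul.
Proof.
move=> p q r; have [x ->] := quotr_surj p; have [y ->] := quotr_surj q.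
by have [z ->] := quotr_surj r; rewrite !quotr_mulE mulrA.
Qed.

Lemma quotr_mulC : commutative quotr_mul.
Proof.
move=> p q; have [x ->] := quotr_surj p; have [y ->] := quotr_surj q.
by rewrite !quotr_mulE mulrC.
Qed.

Lemma quotr_mul1 : left_id (quotr_pi 1) quotr_mul.
Proof. by move=> p; have [x ->] := quotr_surj p; rewrite quotr_mulE mul1r. Qed.

Lemma quotr_mulDl : left_distributive quotr_mul +%R.
Proof.
move=> p q r; have [x ->] := quotr_surj p; have [y ->] := quotr_surj q.
by have [z ->] := quotr_surj r; rewrite -raddfD !quotr_mulE -raddfD mulrDl.
Qed.

HB.instance Definition _ := GRing.Zmodule_isComPzRing.Build Q
  quotr_mulA quotr_mulC quotr_mul1 quotr_mulDl.

Lemma quotr_pi_is_monoid_morphism : monoid_morphism quotr_pi.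
Proof. by split=> [|x y] //; rewrite -quotr_mulE. Qed.

HB.instance Definition _ :=
  GRing.isMonoidMorphism.Build B Q quotr_pi quotr_pi_is_monoid_morphism.

End QuotientRing.

Inductive mul_closure (A : comPzRingType) (S : A -> Prop) : A -> Prop :=
| mul_closure1 : mul_closure S 1
| mul_closureP s t : S s -> mul_closure S t -> mul_closure S (s * t).

Lemma mul_closureS (A : comPzRingType) (S : A -> Prop) s :
  S s -> mul_closure S s.
Proof.
by move=> Ss; have := mul_closureP Ss (mul_closure1 S); rewrite mulr1.
Qed.

Lemma mul_closureM (A : comPzRingType) (S : A -> Prop) s t :
  mul_closure S s -> mul_closure S t -> mul_closure S (s * t).
Proof.
move=> Ss St; elim: Ss => [|u v Su _ IH]; first by rewrite mul1r.
by rewrite -mulrA; apply: mul_closureP.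
Qed.

Lemma mul_closureE (A : comPzRingType) (S : A -> Prop) :
  S 1 -> (forall s t, S s -> S t -> S (s * t)) ->
  forall s, mul_closure S s <-> S s.
Proof.
move=> S1 SM s; split; last exact: mul_closureS.
by elim=> // u v Su _; apply: SM.
Qed.

Section Localization.
Variables (A : comPzRingType) (S : A -> Prop).

Definition frac : Type := {p : A * A | `[< mul_closure S p.2 >]}.
HB.instance Definition _ := Choice.on frac.

Definition frac_num (p : frac) : A := (val p).1.
Definition frac_den (p : frac) : A := (val p).2.

Definition mkfrac (a s : A) (hs : mul_closure S s) : frac :=
  exist _ (a, s) (asboolT hs).

Lemma frac_den_closure (p : frac) : mul_closure S (frac_den p).
Proof. exact/asboolP/(valP p). Qed.

Definition frac_eq (p q : frac) : Prop :=
  exists2 t, mul_closure S t &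
    t * (frac_num p * frac_den q) = t * (frac_num q * frac_den p).

Definition frac_eqb (p q : frac) : bool := `[< frac_eq p q >].

Lemma frac_eqb_is_equiv : equiv_class_of frac_eqb.
Proof.
split=> [p|p q|q p r].
- by apply/asboolP; exists 1 => //; apply: mul_closure1.
- by apply: asbool_equiv_eq; split=> -[t ht e]; exists t.
move=> /asboolP[t ht e] /asboolP[u hu f]; apply/asboolP.
exists (t * u * frac_den q).
  exact: mul_closureM (mul_closureM ht hu) (frac_den_closure q).
transitivity (u * frac_den r * (t * (frac_num p * frac_den q))); first by ring.
rewrite e; transitivity (t * frac_den p * (u * (frac_num q * frac_den r))).
  by ring.
by rewrite f; ring.
Qed.

Canonical frac_equiv := EquivRelPack frac_eqb_is_equiv.
Canonical frac_encModRel := defaultEncModRel frac_eqb.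

(* S^{-1} A: fractions a / s with s in the multiplicative monoid generated by *)
(* S.  By mul_closureE this monoid is S itself when S is multiplicative, e.g. *)
(* the complement of a prime ideal or the set of non-zero-divisors.           *)
Definition localization := {eq_quot frac_eqb}.
Local Notation L := localization.

HB.instance Definition _ := Choice.on L.

Definition loc_pi (p : frac) : L := \pi_{eq_quot frac_eqb} p.

Definition loc_frac (a s : A) (hs : mul_closure S s) : L := loc_pi (mkfrac a hs).

Lemma loc_pi_eq p q : loc_pi p = loc_pi q <-> frac_eq p q.
Proof.
split=> [/eqP|h]; last (apply/eqP; move: h).
  by rewrite -[_ == _]/(\pi_{eq_quot frac_eqb} p == \pi_{eq_quot frac_eqb} q)
             eqmodE => /asboolP.
move=> /asboolP h.
by rewrite -[_ == _]/(\pi_{eq_quot frac_eqb} p == \pi_{eq_quot frac_eqb} q) eqmodE.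
Qed.

Lemma loc_frac_eq a s b t (hs : mul_closure S s) (ht : mul_closure S t) :
  loc_frac a hs = loc_frac b ht <->
  exists2 u, mul_closure S u & u * (a * t) = u * (b * s).
Proof. exact: loc_pi_eq. Qed.

Lemma loc_surj (x : L) : exists a s (hs : mul_closure S s), x = loc_frac a hs.
Proof.
exists (frac_num (repr x)), (frac_den (repr x)), (frac_den_closure (repr x)).
rewrite -{1}[x]reprK; apply/loc_pi_eq; exists 1; first exact: mul_closure1.
by [].
Qed.

Lemma loc_repr a s (hs : mul_closure S s) : exists2 u, mul_closure S u &
  u * (frac_num (repr (loc_frac a hs)) * s) =
  u * (a * frac_den (repr (loc_frac a hs))).
Proof.
have [u hu e] : frac_eq (repr (loc_frac a hs)) (mkfrac a hs).
  by apply/loc_pi_eq; rewrite /loc_pi reprK.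
by exists u.
Qed.

Definition loc_opp (x : L) : L :=
  loc_frac (- frac_num (repr x)) (frac_den_closure (repr x)).

Definition loc_add (x y : L) : L :=
  loc_frac (frac_num (repr x) * frac_den (repr y) +
            frac_num (repr y) * frac_den (repr x))
    (mul_closureM (frac_den_closure (repr x)) (frac_den_closure (repr y))).

Definition loc_mul (x y : L) : L :=
  loc_frac (frac_num (repr x) * frac_num (repr y))
    (mul_closureM (frac_den_closure (repr x)) (frac_den_closure (repr y))).

Lemma loc_oppE a s (hs : mul_closure S s) :
  loc_opp (loc_frac a hs) = loc_frac (- a) hs.
Proof.
apply/loc_frac_eq; have [u hu e] := loc_repr a hs; exists u => //.
by rewrite !mulNr !mulrN e.
Qed.

Lemma loc_addE a s (hs : mul_closure S s) b t (ht : mul_closure S t) :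
  loc_add (loc_frac a hs) (loc_frac b ht) =
  loc_frac (a * t + b * s) (mul_closureM hs ht).
Proof.
apply/loc_frac_eq; have [u hu e] := loc_repr a hs.
have [v hv f] := loc_repr b ht; exists (u * v); first exact: mul_closureM.
move: (frac_num _) (frac_den _) (frac_num _) (frac_den _) e f => b' t' a' s' e f.
transitivity (v * t * t' * (u * (a' * s)) + u * s * s' * (v * (b' * t))).
  by ring.
by rewrite e f; ring.
Qed.

Lemma loc_mulE a s (hs : mul_closure S s) b t (ht : mul_closure S t) :
  loc_mul (loc_frac a hs) (loc_frac b ht) =
  loc_frac (a * b) (mul_closureM hs ht).
Proof.
apply/loc_frac_eq; have [u hu e] := loc_repr a hs.
have [v hv f] := loc_repr b ht; exists (u * v); first exact: mul_closureM.
move: (frac_num _) (frac_den _) (frac_num _) (frac_den _) e f => b' t' a' s' e f.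
transitivity ((u * (a' * s)) * (v * (b' * t))); first by ring.
by rewrite e f; ring.
Qed.

Lemma loc_eq_frac a s b t (hs : mul_closure S s) (ht : mul_closure S t) :
  a * t = b * s -> loc_frac a hs = loc_frac b ht.
Proof.
by move=> e; apply/loc_frac_eq; exists 1; [exact: mul_closure1 | rewrite e].
Qed.

Lemma loc_addA : associative loc_add.
Proof.
move=> x y z; have [a [s [hs ->]]] := loc_surj x.
have [b [t [ht ->]]] := loc_surj y; have [c [u [hu ->]]] := loc_surj z.
by rewrite !loc_addE; apply: loc_eq_frac; ring.
Qed.

Lemma loc_addC : commutative loc_add.
Proof.
move=> x y; have [a [s [hs ->]]] := loc_surj x.
have [b [t [ht ->]]] := loc_surj y.
by rewrite !loc_addE; apply: loc_eq_frac; ring.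
Qed.

Lemma loc_add0 : left_id (loc_frac 0 (mul_closure1 S)) loc_add.
Proof.
move=> x; have [a [s [hs ->]]] := loc_surj x.
by rewrite !loc_addE; apply: loc_eq_frac; ring.
Qed.

Lemma loc_addN : left_inverse (loc_frac 0 (mul_closure1 S)) loc_opp loc_add.
Proof.
move=> x; have [a [s [hs ->]]] := loc_surj x.
by rewrite loc_oppE !loc_addE; apply: loc_eq_frac; ring.
Qed.

HB.instance Definition _ :=
  GRing.isZmodule.Build L loc_addA loc_addC loc_add0 loc_addN.

Lemma loc_mulA : associative loc_mul.
Proof.
move=> x y z; have [a [s [hs ->]]] := loc_surj x.
have [b [t [ht ->]]] := loc_surj y; have [c [u [hu ->]]] := loc_surj z.
by rewrite !loc_mulE; apply: loc_eq_frac; ring.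
Qed.

Lemma loc_mulC : commutative loc_mul.
Proof.
move=> x y; have [a [s [hs ->]]] := loc_surj x.
have [b [t [ht ->]]] := loc_surj y.
by rewrite !loc_mulE; apply: loc_eq_frac; ring.
Qed.

Lemma loc_mul1 : left_id (loc_frac 1 (mul_closure1 S)) loc_mul.
Proof.
move=> x; have [a [s [hs ->]]] := loc_surj x.
by rewrite !loc_mulE; apply: loc_eq_frac; ring.
Qed.

Lemma loc_mulDl : left_distributive loc_mul +%R.
Proof.
move=> x y z; have [a [s [hs ->]]] := loc_surj x.
have [b [t [ht ->]]] := loc_surj y; have [c [u [hu ->]]] := loc_surj z.
rewrite -[+%R]/loc_add loc_addE !loc_mulE loc_addE.
by apply: loc_eq_frac; ring.
Qed.

HB.instance Definition _ := GRing.Zmodule_isComPzRing.Build L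
  loc_mulA loc_mulC loc_mul1 loc_mulDl.

Definition loc_map (a : A) : L := loc_frac a (mul_closure1 S).

Lemma loc_map_is_zmod_morphism : zmod_morphism loc_map.
Proof.
move=> a b; rewrite -[RHS]/(loc_add _ (loc_opp _)) loc_oppE loc_addE.
by apply: loc_eq_frac; ring.
Qed.

Lemma loc_map_is_monoid_morphism : monoid_morphism loc_map.
Proof.
split=> [|a b] //; rewrite -[RHS]/(loc_mul _ _) loc_mulE.
by apply: loc_eq_frac; ring.
Qed.

HB.instance Definition _ :=
  GRing.isZmodMorphism.Build A L loc_map loc_map_is_zmod_morphism.
HB.instance Definition _ :=
  GRing.isMonoidMorphism.Build A L loc_map loc_map_is_monoid_morphism.

End Localization.

Section BaseChange.
Variables (R S : comPzRingType) (f : {rmorphism R -> S}) (E : lmodType R).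

(* [:: (c1, x1); ...; (cn, xn)] stands for x1 (x) c1 + ... + xn (x) cn *)
Definition tsum : Type := seq (S * E).
HB.instance Definition _ := Choice.on tsum.

Inductive tensor_eq : tsum -> tsum -> Prop :=
| teq_refl u : tensor_eq u u
| teq_sym u v : tensor_eq u v -> tensor_eq v u
| teq_trans u v w : tensor_eq u v -> tensor_eq v w -> tensor_eq u w
| teq_cat u u' v v' :
    tensor_eq u u' -> tensor_eq v v' -> tensor_eq (u ++ v) (u' ++ v')
| teq_comm u v : tensor_eq (u ++ v) (v ++ u)
| teq_zero x : tensor_eq [:: (0, x)] [::]
| teq_addl c d x : tensor_eq [:: (c + d, x)] [:: (c, x); (d, x)]
| teq_addr c x y : tensor_eq [:: (c, x + y)] [:: (c, x); (c, y)]
| teq_bal c a x : tensor_eq [:: (c, a *: x)] [:: (c * f a, x)].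

Definition tensor_eqb (u v : tsum) : bool := `[< tensor_eq u v >].

Lemma tensor_eqb_is_equiv : equiv_class_of tensor_eqb.
Proof.
split=> [u|u v|v u w]; first by apply/asboolP; exact: teq_refl.
  by apply: asbool_equiv_eq; split; exact: teq_sym.
by move=> /asboolP h /asboolP k; apply/asboolP; exact: teq_trans h k.
Qed.

Canonical tensor_equiv := EquivRelPack tensor_eqb_is_equiv.
Canonical tensor_encModRel := defaultEncModRel tensor_eqb.

Definition tensor := {eq_quot tensor_eqb}.
Local Notation T := tensor.

HB.instance Definition _ := Choice.on T.

Definition tensor_pi (u : tsum) : T := \pi_{eq_quot tensor_eqb} u.

Lemma tensor_pi_eq u v : tensor_pi u = tensor_pi v <-> tensor_eq u v.
Proof.
split=> [/eqP|h]; last (apply/eqP; move: h).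
  by rewrite -[_ == _]/(\pi_{eq_quot tensor_eqb} u == \pi_{eq_quot tensor_eqb} v)
             eqmodE => /asboolP.
move=> /asboolP h.
by rewrite -[_ == _]/(\pi_{eq_quot tensor_eqb} u == \pi_{eq_quot tensor_eqb} v)
           eqmodE.
Qed.

Lemma tensor_surj (x : T) : exists u, x = tensor_pi u.
Proof. by exists (repr x); rewrite /tensor_pi reprK. Qed.

Lemma tensor_repr u : tensor_eq (repr (tensor_pi u)) u.
Proof. by apply/tensor_pi_eq; rewrite /tensor_pi reprK. Qed.

Definition tsum_scale (c : S) (u : tsum) : tsum :=
  [seq (c * p.1, p.2) | p <- u].

Lemma tsum_scale_eq c u v :
  tensor_eq u v -> tensor_eq (tsum_scale c u) (tsum_scale c v).
Proof.
elim=> {u v} [u|u v _|u v w _ h _ k|u u' v v' _ h _ k|u v|x|d d' x|d x y|d a x].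
- exact: teq_refl.
- exact: teq_sym.
- exact: teq_trans h k.
- by rewrite /tsum_scale !map_cat; apply: teq_cat.
- by rewrite /tsum_scale !map_cat; apply: teq_comm.
- by rewrite /= mulr0; apply: teq_zero.
- by rewrite /= mulrDr; apply: teq_addl.
- exact: teq_addr.
- by rewrite /= mulrA; apply: teq_bal.
Qed.

Lemma tsum_scaleDl u c d :
  tensor_eq (tsum_scale (c + d) u) (tsum_scale c u ++ tsum_scale d u).
Proof.
elim: u => [|[a x] u IH] /=; first exact: teq_refl.
rewrite -cat1s mulrDl.
apply: teq_trans (teq_cat (teq_addl _ _ _) IH) _.
set A := tsum_scale c u; set B := tsum_scale d u.
change (tensor_eq ([:: (c * a, x)] ++ [:: (d * a, x)] ++ A ++ B)
          ([:: (c * a, x)] ++ A ++ [:: (d * a, x)] ++ B)).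
apply: teq_cat; first exact: teq_refl.
rewrite !catA; apply: teq_cat; [exact: teq_comm | exact: teq_refl].
Qed.

Definition tensor_add (x y : T) : T := tensor_pi (repr x ++ repr y).
Definition tensor_scale (c : S) (x : T) : T := tensor_pi (tsum_scale c (repr x)).

Lemma tensor_addE u v :
  tensor_add (tensor_pi u) (tensor_pi v) = tensor_pi (u ++ v).
Proof. by apply/tensor_pi_eq/teq_cat; apply: tensor_repr. Qed.

Lemma tensor_scaleE c u :
  tensor_scale c (tensor_pi u) = tensor_pi (tsum_scale c u).
Proof. by apply/tensor_pi_eq/tsum_scale_eq/tensor_repr. Qed.

Lemma tensor_addA : associative tensor_add.
Proof.
move=> x y z; have [u ->] := tensor_surj x; have [v ->] := tensor_surj y.
by have [w ->] := tensor_surj z; rewrite !tensor_addE catA.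
Qed.

Lemma tensor_addC : commutative tensor_add.
Proof.
move=> x y; have [u ->] := tensor_surj x; have [v ->] := tensor_surj y.
by rewrite !tensor_addE; apply/tensor_pi_eq/teq_comm.
Qed.

Lemma tensor_add0 : left_id (tensor_pi [::]) tensor_add.
Proof. by move=> x; have [u ->] := tensor_surj x; rewrite tensor_addE. Qed.

Lemma tensor_addN :
  left_inverse (tensor_pi [::]) (tensor_scale (- 1)) tensor_add.
Proof.
move=> x; have [u ->] := tensor_surj x; rewrite tensor_scaleE tensor_addE.
have u1 : u = tsum_scale 1 u.
  by rewrite -{1}[u]map_id; apply: eq_map => -[c y] /=; rewrite mul1r.
apply/tensor_pi_eq; rewrite {2}u1.
apply: teq_trans (teq_sym (tsum_scaleDl _ _ _)) _; rewrite addNr.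
elim: u {u1} => [|[c y] u IH] /=; first exact: teq_refl.
by rewrite mul0r -cat1s; apply: (teq_cat (teq_zero y) IH).
Qed.

HB.instance Definition _ :=
  GRing.isZmodule.Build T tensor_addA tensor_addC tensor_add0 tensor_addN.

Lemma tensor_scaleA c d x :
  tensor_scale c (tensor_scale d x) = tensor_scale (c * d) x.
Proof.
have [u ->] := tensor_surj x; rewrite !tensor_scaleE /tsum_scale -map_comp.
by congr (tensor_pi _); apply: eq_map => -[a y] /=; rewrite mulrA.
Qed.

Lemma tensor_scale1 : left_id 1 tensor_scale.
Proof.
move=> x; have [u ->] := tensor_surj x; rewrite tensor_scaleE.
congr (tensor_pi _); rewrite -[RHS]map_id.
by apply: eq_map => -[a y] /=; rewrite mul1r.
Qed.

Lemma tensor_scaleDr : right_distributive tensor_scale +%R.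
Proof.
move=> c x y; have [u ->] := tensor_surj x; have [v ->] := tensor_surj y.
by rewrite -[+%R]/tensor_add tensor_addE !tensor_scaleE tensor_addE
           /tsum_scale map_cat.
Qed.

Lemma tensor_scaleDl x : {morph tensor_scale^~ x : c d / c + d}.
Proof.
move=> c d /=; have [u ->] := tensor_surj x.
rewrite -[RHS]/(tensor_add _ _) !tensor_scaleE tensor_addE.
exact/tensor_pi_eq/tsum_scaleDl.
Qed.

HB.instance Definition _ := GRing.Zmodule_isLmodule.Build S T
  tensor_scaleA tensor_scale1 tensor_scaleDr tensor_scaleDl.

Definition tensor1 (x : E) : T := tensor_pi [:: (1, x)].

End BaseChange.

Definition nonzerodivisor (R : comPzRingType) (a : R) : Prop :=
  forall b, a * b = 0 -> b = 0.

Definition torsion (R : comPzRingType) (M : lmodType R) (x : M) : Prop :=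
  exists2 a : R, nonzerodivisor a & a *: x = 0.

Section SymmetricAlgebra.
Variables (R : comNzRingType) (E : lmodType R).

(* the polynomial ring over R with one variable for each element of E *)
Local Notation P := {malg R[{cmonom E}]}.

Definition sym_var (x : E) : P := << ucm x >>.

Definition sym_rel (p : P) : Prop := exists (a : R) (x y : E),
  p = sym_var (a *: x + y) - (a *: sym_var x + sym_var y).

Definition Sym : Type := quotr sym_rel.
HB.instance Definition _ := GRing.ComPzRing.on Sym.

Definition sym_const (a : R) : Sym := quotr_pi sym_rel (a *: 1).
Definition sym_in (x : E) : Sym := quotr_pi sym_rel (sym_var x).

Lemma sym_const_is_zmod_morphism : zmod_morphism sym_const.
Proof. by move=> a b; rewrite /sym_const scalerBl raddfB. Qed.

Lemma sym_const_is_monoid_morphism : monoid_morphism sym_const.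
Proof.
split=> [|a b]; rewrite /sym_const; first by rewrite scale1r rmorph1.
by rewrite -rmorphM -scalerAl mul1r scalerA.
Qed.

HB.instance Definition _ :=
  GRing.isZmodMorphism.Build R Sym sym_const sym_const_is_zmod_morphism.
HB.instance Definition _ :=
  GRing.isMonoidMorphism.Build R Sym sym_const sym_const_is_monoid_morphism.

Definition sym_scale (a : R) (x : Sym) : Sym := sym_const a * x.

Lemma sym_scaleA a b x : sym_scale a (sym_scale b x) = sym_scale (a * b) x.
Proof. by rewrite /sym_scale rmorphM mulrA. Qed.

Lemma sym_scale1 : left_id 1 sym_scale.
Proof. by move=> x; rewrite /sym_scale rmorph1 mul1r. Qed.

Lemma sym_scaleDr : right_distributive sym_scale +%R.
Proof. by move=> a x y; rewrite /sym_scale mulrDr. Qed.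

Lemma sym_scaleDl x : {morph sym_scale^~ x : a b / a + b}.
Proof. by move=> a b; rewrite /sym_scale rmorphD mulrDl. Qed.

HB.instance Definition _ := GRing.Zmodule_isLmodule.Build R Sym
  sym_scaleA sym_scale1 sym_scaleDr sym_scaleDl.

(* the R-torsion of Sym is an ideal, so quotr divides by the torsion itself *)
Definition Rees : Type := quotr (@torsion R Sym).
HB.instance Definition _ := GRing.ComPzRing.on Rees.

Definition rees_pi : {rmorphism Sym -> Rees} := quotr_pi (@torsion R Sym).

Definition rees_in (x : E) : Rees := rees_pi (sym_in x).

Definition rees_scale (a : R) (x : Rees) : Rees := rees_pi (sym_const a) * x.

Lemma rees_scaleA a b x : rees_scale a (rees_scale b x) = rees_scale (a * b) x.
Proof. by rewrite /rees_scale !rmorphM mulrA. Qed.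

Lemma rees_scale1 : left_id 1 rees_scale.
Proof. by move=> x; rewrite /rees_scale !rmorph1 mul1r. Qed.

Lemma rees_scaleDr : right_distributive rees_scale +%R.
Proof. by move=> c x y; rewrite /rees_scale mulrDr. Qed.

Lemma rees_scaleDl x : {morph rees_scale^~ x : a b / a + b}.
Proof. by move=> a b; rewrite /rees_scale !rmorphD mulrDl. Qed.

HB.instance Definition _ := GRing.Zmodule_isLmodule.Build R Rees
  rees_scaleA rees_scale1 rees_scaleDr rees_scaleDl.

Definition rees_comp (s : nat) : Rees -> Prop :=
  submod_gen (fun z => exists x : 'I_s -> E, z = \prod_(i < s) rees_in (x i)).

(* The image of a submodule U of E in Rees, which lies in degree 1, is        *)
(* U / torsion(U).                                                            *)
Definition reduction (U : E -> Prop) : Prop :=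
  exists s, forall z : Rees, rees_comp s.+1 z <->
    submod_gen
      (fun w => exists u y, [/\ U u, rees_comp s y & w = rees_in u * y]) z.

End SymmetricAlgebra.

Section Ideals.
Variable R : comPzRingType.
Implicit Types I J m : R -> Prop.

Definition ideal I : Prop :=
  [/\ I 0, forall x y, I x -> I y -> I (x + y) & forall a x, I x -> I (a * x)].

Definition noetherian : Prop :=
  forall I, ideal I ->
  exists s : seq R, forall x, I x <-> ideal_gen (fun y => y \in s) x.

Definition maximal_ideal m : Prop :=
  [/\ ideal m, ~ m 1 &
      forall J, ideal J -> (forall x, m x -> J x) ->
        J 1 \/ forall x, J x -> m x].

Definition local_ring m : Prop :=
  maximal_ideal m /\
  forall n, maximal_ideal n -> forall x, n x <-> m x.

Definition regular_seq (s : seq R) : Prop :=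
  (forall i, (i < size s)%N -> forall a,
     ideal_gen (fun y => y \in take i s) (s`_i * a) ->
     ideal_gen (fun y => y \in take i s) a) /\
  ~ ideal_gen (fun y => y \in s) 1.

(* grade I >= n; the unit ideal has infinite grade *)
Definition grade_ge I (n : nat) : Prop :=
  I 1 \/ exists s : seq R,
    [/\ size s = n, forall x, x \in s -> I x & regular_seq s].

Definition grade_eq I (n : nat) : Prop := grade_ge I n /\ ~ grade_ge I n.+1.

Definition annihilator (M : lmodType R) (a : R) : Prop :=
  forall x : M, a *: x = 0.

End Ideals.

Definition surjective (A B : Type) (f : A -> B) : Prop :=
  forall y, exists x, f x = y.

Section Modules.
Variable R : comPzRingType.
Implicit Types M N P : lmodType R.

Definition lmod_iso M N : Prop := exists f : {linear M -> N}, bijective f.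

Definition finitely_generated M : Prop :=
  exists (n : nat) (g : 'I_n -> M),
    forall x, submod_gen (fun y => exists i, y = g i) x.

Definition torsionfree M : Prop := forall x : M, torsion x -> x = 0.

Definition module_grade_ge M (n : nat) : Prop :=
  grade_ge (@annihilator R M) n.

Definition projective P : Prop :=
  forall (M N : lmodType R) (g : {linear M -> N}) (f : {linear P -> N}),
    surjective g -> exists h : {linear P -> M}, forall x, g (h x) = f x.

(* M has a projective resolution ... -> P 1 -> P 0 -> M -> 0 with P i = 0 for *)
(* i > n                                                                      *)
Definition proj_dim_le M (n : nat) : Prop :=
  exists (P : nat -> lmodType R) (d : forall i, {linear P i.+1 -> P i})
         (eps : {linear P 0%N -> M}),
    [/\ forall i, projective (P i),
        surjective eps,
        forall x, eps x = 0 <-> exists y, d 0%N y = x,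
        forall i x, d i x = 0 <-> exists y, d i.+1 y = x &
        forall i, (n < i)%N -> forall x : P i, x = 0].

Definition proj_dim M (n : nat) : Prop :=
  proj_dim_le M n /\ forall k, (k < n)%N -> ~ proj_dim_le M k.

Definition perfect_of_grade (I : R -> Prop) (n : nat) : Prop :=
  grade_eq I n /\ proj_dim (@quotm R R^o I) n.

Definition total_frac : Type := localization (@nonzerodivisor R).
HB.instance Definition _ := GRing.ComPzRing.on total_frac.

Definition total_frac_map : {rmorphism R -> total_frac} :=
  loc_map (@nonzerodivisor R).

End Modules.

Definition has_rank (R : comPzRingType) (E : lmodType R) (e : nat) : Prop :=
  lmod_iso (tensor (total_frac_map R) E) 'rV[total_frac R]_e.

Definition ideal_module (R : comPzRingType) (E : lmodType R) : Prop :=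
  [/\ finitely_generated E, torsionfree E &
      exists (n : nat) (j : {linear E -> 'rV[R]_n}), injective j /\
        module_grade_ge (quotm (fun y => exists x, y = j x)) 2].

Section GenericBourbaki.
Variables (R : comNzRingType) (m : R -> Prop) (E : lmodType R).
Variables (e r : nat) (a : 'I_r -> E).

(* R' = R[Z]; the variable z_ij is numbered by mxvec_index i j *)
Local Notation R' := (mpoly (r * e.-1) R).

Definition generic_var (i : 'I_r) (j : 'I_e.-1) : R' :=
  'X_(mxvec_index i j).

Definition extended_ideal : R' -> Prop :=
  @ideal_gen R' (fun p => exists2 c, m c & p = mpolyC (r * e.-1) c).

Definition nagata : Type := localization (fun p : R' => ~ extended_ideal p).
HB.instance Definition _ := GRing.ComPzRing.on nagata.

Definition nagata_loc : {rmorphism R' -> nagata} :=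
  loc_map (fun p => ~ extended_ideal p).

Definition nagata_map (c : R) : nagata :=
  nagata_loc (mpolyC (r * e.-1) c).

Lemma nagata_map_is_zmod_morphism : zmod_morphism nagata_map.
Proof. by move=> b c; rewrite /nagata_map !raddfB. Qed.

Lemma nagata_map_is_monoid_morphism : monoid_morphism nagata_map.
Proof. by split=> [|b c]; rewrite /nagata_map ?rmorph1 ?rmorphM. Qed.

HB.instance Definition _ :=
  GRing.isZmodMorphism.Build R nagata nagata_map nagata_map_is_zmod_morphism.
HB.instance Definition _ :=
  GRing.isMonoidMorphism.Build R nagata nagata_map
    nagata_map_is_monoid_morphism.

Definition nagata_module := tensor nagata_map E.
HB.instance Definition _ := GRing.Lmodule.on nagata_module.

Definition generic_elt (j : 'I_e.-1) : nagata_module :=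
  \sum_(i < r) nagata_loc (generic_var i j) *: tensor1 nagata_map (a i).

(* I is the image of an injective R''-linear map E''/F -> R'' *)
Definition generic_Bourbaki_ideal (I : nagata -> Prop) : Prop :=
  exists f : {linear quotm (fun y => exists j, y = generic_elt j) -> nagata^o},
    injective f /\ forall c, I c <-> exists y, f y = c.

Definition good (I : nagata -> Prop) : Prop := grade_ge I 2.

End GenericBourbaki.

(* Main.v *)
Require Import Defs.
From HB Require Import structures.
From mathcomp Require Import all_boot all_algebra.
From mathcomp Require Import ring boolp finmap monalg mpoly.

(* Write S for the Nagata extension, E'' for the extended module and F for the *)
(* span of the generic elements x_1, ..., x_n, n = e - 1.  An ideal module      *)
(* sits in G = R^e with (E : G) containing a regular pair c1, c2, and E'' in     *)
(* S^e, where the x_j are the rows of a matrix X.                              *)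
(*                                                                             *)
(* Existence of a good Bourbaki ideal: v |-> det (v; x_1; ...; x_n) has kernel F  *)
(* and an image of grade at least 2, because the two extreme maximal minors of  *)
(* X form a regular pair.  To see this, fix a maximal minor D of the coefficient *)
(* matrix A of U; translating the variables turns X into X + D N with N a        *)
(* two-parameter bidiagonal matrix, so the minors get the coprime leading forms  *)
(* D^n t^n and D^n u^n, and divisibility holds up to a power of D.  As U is a     *)
(* reduction, (E : G) lies in every radical ideal containing all the D: a        *)
(* functional on G extends to a ring map from the Rees algebra, and its values   *)
(* on E are nilpotent modulo its values on U; applying this to cofactor vectors  *)
(* descends from minors of size e to the empty minor.                           *)
(*                                                                             *)
(* Homological part: given I = E''/F with nonzerodivisors, the x_j are           *)
(* independent by a determinant argument, so syzygies of I are those of E''      *)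
(* plus F.  Minimal generators of a module of syzygies over R that becomes       *)
(* projective over S are independent, hence proj dim E <= 1 iff                 *)
(* proj dim S/I <= 2.  If grade I >= 2, then I is projective only if 1 is in I;   *)
(* I = S forces E to be free, and E free forces E''/F to be free.               *)

Set Implicit Arguments.
Unset Strict Implicit.
Unset Printing Implicit Defensive.

Import GRing.Theory.
Local Open Scope ring_scope.

(** * Ideals, determinants and Nakayama's lemma *)

(** All generic Bourbaki ideals are images of the single module W = E''/F; only the embedding into S
    varies. The proof runs through W in the cycle A -> B -> C -> A.

    The link with E is 0 -> F -> E'' -> W -> 0, where F is free. A minimal presentation of E over R
    extends flatly to S ([nagata_module_embed]); adding n syzygies that lift the generic elements
    presents W ([bourbaki_resolution]). If proj dim E = 1, the minimal syzygies are independent, so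
    S/I has a free resolution of length 2. A grade of at least 3 or a smaller projective dimension
    would make I projective, hence the unit ideal, and then E projective ([good_bourbaki_perfect],
    [unit_ideal_projective]).

    B -> C needs one good ideal. It comes from [bourbaki_embedding]; its grade comes from
    [scaled_generic_minors_regular], which rests on [reduction_minors], [leading_form_ideal] and
    [coprime_leading_forms].

    For C -> A, [perfect_bourbaki_proj_dim_le1] brings the independence of the syzygies down from S
    to R by a Nakayama argument. Projective dimension 0 is excluded because E projective would make
    W projective ([projective_bourbaki_projective]), which no proper ideal of grade at least 2
    is. *)

Section IdealTheory.
Variables (R : comPzRingType) (I : R -> Prop).
Hypothesis idI : ideal I.

Lemma ideal0 : I 0. Proof. by case: idI. Qed.
Lemma idealD x y : I x -> I y -> I (x + y).
Proof. by case: idI => _ h _; apply: h. Qed.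
Lemma idealMl a x : I x -> I (a * x).
Proof. by case: idI => _ _; apply. Qed.
Lemma idealMr a x : I x -> I (x * a).
Proof. by rewrite mulrC; apply: idealMl. Qed.
Lemma idealN x : I x -> I (- x).
Proof. by rewrite -mulN1r; apply: idealMl. Qed.
Lemma idealB x y : I x -> I y -> I (x - y).
Proof. by move=> Ix Iy; apply: idealD => //; apply: idealN. Qed.
Lemma ideal_sum (J : Type) (r : seq J) (P : pred J) (F : J -> R) :
  (forall i, P i -> I (F i)) -> I (\sum_(i <- r | P i) F i).
Proof. by move=> h; elim/big_ind: _ => //; [exact: ideal0 | exact: idealD]. Qed.

Lemma ideal_prodB n (f g : 'I_n -> R) :
  (forall i, I (f i - g i)) -> I (\prod_i f i - \prod_i g i).
Proof.
move=> h; elim/big_rec2: _ => [|i x y _ IH]; first by rewrite subrr; apply: ideal0.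
have -> : f i * y - g i * x = (f i - g i) * y + g i * (y - x) by ring.
by apply: idealD; [apply: idealMr | apply: idealMl].
Qed.

Lemma ideal_detB n (A B : 'M[R]_n) :
  (forall i j, I (A i j - B i j)) -> I (\det A - \det B).
Proof.
move=> h; rewrite /determinant -sumrB; apply: ideal_sum => s _.
by rewrite -mulrBr; apply/idealMl/ideal_prodB => i.
Qed.

Hypothesis unitI : forall x, I x -> exists y, (1 + x) * y = 1.

(** The determinant is 1 modulo [I], hence a unit, and the adjugate provides the inverse. [unitI]
    says that [I] lies in the Jacobson radical. *)
Lemma near1_invertible n (T : 'M[R]_n) :
  (forall i j, I ((1%:M - T) i j)) -> exists T', T *m T' = 1%:M.
Proof.
move=> h; have : I (\det T - 1).
  rewrite -(det1 R n); apply: ideal_detB => i j.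
  by have := idealN (h i j); rewrite !mxE opprB.
move=> /unitI[y hy]; exists (y *: \adj T).
by rewrite -scalemxAr mul_mx_adj scale_scalar_mx mulrC -{1}[\det T](subrKC 1) hy.
Qed.

Lemma nakayama_row n (v : 'rV[R]_n) (T : 'M[R]_n) :
  (forall i j, I (T i j)) -> v = v *m T -> v = 0.
Proof.
move=> h e; have [|T' hT'] := @near1_invertible n (1%:M - T).
  by move=> i j; rewrite opprB addrC subrK.
by rewrite -[v]mulmx1 -hT' mulmxA mulmxBr mulmx1 -e subrr mul0mx.
Qed.

(* The rows of [1 - T] are relations, so [T] is invertible modulo [I]. *)
Lemma split_relations_free k N (G : 'M[R]_(k, N)) (T : 'M[R]_k) :
  T *m G = G -> (forall v : 'rV_k, v *m G = 0 -> v *m T = 0) ->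
  (forall v : 'rV_k, v *m G = 0 -> forall i, I (v 0 i)) ->
  forall v : 'rV_k, v *m G = 0 -> v = 0.
Proof.
move=> TG relT relI v vG.
have [|T' hT'] := @near1_invertible k T.
  move=> i j; have := relI (row i (1%:M - T)) _ j; rewrite mxE; apply.
  by rewrite -row_mul mulmxBl mul1mx TG subrr row0.
by rewrite -[v]mulmx1 -hT' mulmxA relT // mul0mx.
Qed.

End IdealTheory.

Lemma nzd_det_free (R : comPzRingType) n (A : 'M[R]_n) (v : 'rV[R]_n) :
  nonzerodivisor (\det A) -> v *m A = 0 -> v = 0.
Proof.
move=> nz vA; apply/rowP=> i; rewrite mxE; apply: nz.
have := congr1 (mulmx^~ (\adj A)) vA.
by rewrite mul0mx -mulmxA mul_mx_adj mul_mx_scalar => /rowP/(_ i); rewrite !mxE.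
Qed.

Lemma nzdM (R : comPzRingType) (a b : R) :
  nonzerodivisor a -> nonzerodivisor b -> nonzerodivisor (a * b).
Proof. by move=> ha hb x; rewrite -mulrA => /ha/hb. Qed.

Lemma nzdX (R : comPzRingType) (a : R) n :
  nonzerodivisor a -> nonzerodivisor (a ^+ n).
Proof.
move=> ha; elim: n => [|n IH]; first by move=> x; rewrite expr0 mul1r.
by rewrite exprS; apply: nzdM.
Qed.

Lemma nzdMr (R : comPzRingType) (a b : R) :
  nonzerodivisor (a * b) -> nonzerodivisor b.
Proof. by move=> h x bx; apply: h; rewrite -mulrA bx mulr0. Qed.

Lemma nzdI (R : comPzRingType) (a x y : R) :
  nonzerodivisor a -> a * x = a * y -> x = y.
Proof. by move=> h e; apply/subr0_eq/h; rewrite mulrBr e subrr. Qed.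

(** * Noetherian local rings *)

Lemma ideal_gen_seqP (R : comPzRingType) (s : seq R) x :
  ideal_gen (fun y => y \in s) x <->
  exists c : 'I_(size s) -> R, x = \sum_i c i * s`_i.
Proof.
split=> [|[c ->]].
  elim=> [|a y z ys _ [c ->]]; first by exists (fun=> 0); rewrite big1 // => i; rewrite mul0r.
  have hi : (index y s < size s)%N by rewrite index_mem.
  exists (fun i => a *+ (i == Ordinal hi) + c i).
  rewrite [RHS](eq_bigr _ (fun i _ => mulrDl _ _ _)) big_split /=; congr (_ + _).
  rewrite (bigD1 (Ordinal hi)) //= eqxx mulr1n nth_index // big1 ?addr0 //.
  by move=> i /negbTE ->; rewrite mulr0n mul0r.
rewrite /ideal_gen; elim/big_ind: _ => [|u v|i _].
- exact: submod_gen0.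
- exact: (@submod_genD R R^o).
apply: (@submod_genZ R R^o); apply: submod_genS; exact: mem_nth.
Qed.

Lemma ideal_gen_ideal (R : comPzRingType) (A : R -> Prop) : ideal (ideal_gen A).
Proof.
by split; [exact: submod_gen0 | exact: (@submod_genD R R^o) | exact: (@submod_genZ R R^o)].
Qed.

Definition row_submod (R : comPzRingType) N (P : 'rV[R]_N -> Prop) : Prop :=
  P 0 /\ forall a x y, P x -> P y -> P (a *: x + y).

Lemma row_submod_mul (R : comPzRingType) N (P : 'rV[R]_N -> Prop) k (c : 'rV[R]_k) G :
  row_submod P -> (forall i, P (row i G)) -> P (c *m G).
Proof.
move=> [P0 PD] hG; rewrite mulmx_sum_row.
elim/big_rec: _ => // i x _; exact: PD.
Qed.

Section NoetherianLocal.
Variables (R : comNzRingType) (noethR : noetherian R).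

(** Otherwise every proper ideal above [J] has a strictly larger one. Iterating a choice of these
    gives a chain whose union is finitely generated, so the chain stops growing. *)
Lemma noetherian_maximal_above (J : R -> Prop) :
  ideal J -> ~ J 1 -> exists2 M, maximal_ideal M & forall x, J x -> M x.
Proof.
move=> idJ J1; apply: contrapT => noM.
pose T := {M : R -> Prop | [/\ ideal M, ~ M 1 & forall x, J x -> M x]}.
have /choice[nxt hnxt] : forall M : T, exists M' : T,
    (forall x, sval M x -> sval M' x) /\ exists x, sval M' x /\ ~ sval M x.
  move=> [M [idM M1 JM]]; apply: contrapT => no; apply: noM; exists M => //.
  split=> // K idK MK; apply: contrapT => /not_orP[K1 KM]; apply: no.
  have hK : [/\ ideal K, ~ K 1 & forall x, J x -> K x].
    by split=> // x /JM /MK.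
  exists (exist _ K hK); split=> //=; apply: contrapT => no; apply: KM => x Kx.
  by apply: contrapT => Mx; apply: no; exists x.
pose u := fun n => iter n nxt (exist _ J (And3 idJ J1 (fun x h => h)) : T).
have mono n k x : sval (u n) x -> sval (u (n + k)%N) x.
  move=> h; elim: k => [|k IH]; first by rewrite addn0.
  by rewrite addnS; apply: (hnxt _).1.
have le n p x : (n <= p)%N -> sval (u n) x -> sval (u p) x.
  by move=> /subnKC <-; apply: mono.
have idu n : ideal (sval (u n)) by case: (svalP (u n)).
pose U x := exists n, sval (u n) x.
have idU : ideal U.
  split=> [|x y [n hx] [p hy]|a x [n hx]].
  - by exists 0%N; apply: ideal0.
  - exists (maxn n p); apply: idealD => //; apply: le; [|exact: hx| |exact: hy].
      exact: leq_maxl.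
    exact: leq_maxr.
  - by exists n; apply: idealMl.
have [s hs] := noethR idU.
have [n hn] : exists n, forall y, y \in s -> sval (u n) y.
  have : forall y, y \in s -> U y by move=> y ys; apply/hs/submod_genS.
  elim: s {hs} => [|y s IH] h; first by exists 0%N.
  have [|n hn] := IH; first by move=> z zs; apply: h; rewrite inE zs orbT.
  have [p hp] := h y (mem_head _ _).
  exists (maxn n p) => z; rewrite inE => /predU1P[->|/hn hz].
    exact: le (leq_maxr _ _) hp.
  exact: le (leq_maxl _ _) hz.
have [_ [x [h1 h2]]] := hnxt (u n); apply: h2.
have /hs/ideal_gen_seqP[c ->] : U x by exists n.+1.
by apply: ideal_sum => // i _; apply: idealMl => //; apply/hn/mem_nth.
Qed.

Variables (m : R -> Prop) (localR : local_ring m).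

Lemma local_ideal : ideal m. Proof. by case: localR => -[]. Qed.
Lemma local_proper : ~ m 1. Proof. by case: localR => -[]. Qed.

Lemma local_near1 x : m x -> exists y, (1 + x) * y = 1.
Proof.
move=> mx; apply: contrapT => no.
have idJ : ideal (fun z => exists y, z = (1 + x) * y).
  split=> [|_ _ [y ->] [z ->]|a _ [y ->]].
  - by exists 0; rewrite mulr0.
  - by exists (y + z); rewrite mulrDr.
  - by exists (a * y); rewrite mulrCA.
have [|M maxM JM] := noetherian_maximal_above idJ.
  by move=> [y e]; apply: no; exists y.
apply: local_proper; have /(localR.2 _ maxM) h : M (1 + x).
  by apply: JM; exists 1; rewrite mulr1.
by rewrite -(addrK x 1); apply: (idealB local_ideal).
Qed.

Lemma local_unit x : ~ m x -> exists y, x * y = 1.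
Proof.
move=> mx; have [idm m1 maxm] := localR.1.
have idJ : ideal (fun z => exists a y, m a /\ z = a + x * y).
  split=> [|_ _ [a [y [ma ->]]] [b [z [mb ->]]]|c _ [a [y [ma ->]]]].
  - by exists 0, 0; split; [exact: ideal0 | rewrite mulr0 addr0].
  - by exists (a + b), (y + z); split; [exact: idealD | ring].
  - by exists (c * a), (c * y); split; [exact: idealMl | ring].
have [z mz|[a [y [ma e]]]|h] := maxm _ idJ.
- by exists z, 0; rewrite mulr0 addr0.
- have [|z hz] := @local_near1 (- a); first exact: idealN.
  by exists (y * z); rewrite mulrA -hz e; ring.
- by case: mx; apply: h; exists 0, 1; split; [exact: ideal0 | rewrite mulr1 add0r].
Qed.

Lemma local_prime x y : m (x * y) -> m x \/ m y.
Proof.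
move=> mxy; have [mx|/local_unit[z hz]] := pselect (m x); first by left.
right; rewrite -[y]mul1r -hz -mulrA (mulrC z) mulrA.
by apply: idealMr => //; exact: local_ideal.
Qed.

Definition row_fg N := forall P : 'rV[R]_N -> Prop, row_submod P ->
  exists k (G : 'M[R]_(k, N)), forall v, P v <-> exists c, v = c *m G.

(** The first coordinates of [P] form an ideal [I]. Rows lifting generators of [I], together with
    generators of the part of [P] with first coordinate 0, generate [P]. *)
Lemma noetherian_row_step N : row_fg N -> row_fg (1 + N).
Proof.
move=> IH P subP.
pose I x := exists v : 'rV_N, P (row_mx (x%:M : 'M_1) v).
have [P0 PD] := subP.
have idI : ideal I.
  have comb a x y : I x -> I y -> I (a * x + y).
    move=> [v Pv] [w Pw]; exists (a *: v + w).
    suff -> : row_mx (a * x + y)%:M (a *: v + w) =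
      a *: row_mx (x%:M : 'M_1) v + row_mx y%:M w by exact: PD.
    by rewrite scale_row_mx add_row_mx scale_scalar_mx -raddfD.
  have I0 : I 0 by exists 0; rewrite raddf0 row_mx0.
  split=> // [x y Ix Iy|a x Ix]; first by rewrite -[x]mul1r; apply: comb.
  by rewrite -[a * x]addr0; apply: comb.
have [s hs] := noethR idI.
have /choice[w hw] : forall i : 'I_(size s), exists w : 'rV_N, P (row_mx (s`_i)%:M w).
  by move=> i; apply/hs/submod_genS/mem_nth.
pose L : 'M_(size s, 1 + N) := \matrix_i row_mx (s`_i)%:M (w i).
have PL i : P (row i L) by rewrite rowK.
have [|k [G hG]] := IH (fun v => P (row_mx (0 : 'M_1) v)).
  split=> [|a x y Px Py]; first by rewrite row_mx0.
  suff -> : row_mx 0 (a *: x + y) = a *: row_mx (0 : 'M_1) x + row_mx 0 y.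
    exact: PD.
  by rewrite scale_row_mx add_row_mx scaler0 addr0.
exists (size s + k)%N, (col_mx L (row_mx 0 G)) => v; split=> [Pv|[c ->]]; last first.
  rewrite -[c]hsubmxK mul_row_col -[lsubmx c *m L]scale1r; apply: PD.
    exact: row_submod_mul.
  rewrite mul_mx_row mulmx0; apply/hG; by exists (rsubmx c).
have /hs/ideal_gen_seqP[c hc] : I (lsubmx v 0 0).
  by exists (rsubmx v); rewrite -mx11_scalar hsubmxK.
pose c' : 'rV_(size s) := \row_i c i.
pose u : 'rV_(1 + N) := - c' *m L + v.
have Pu : P u.
  rewrite /u mulNmx -scaleN1r; apply: PD => //; exact: row_submod_mul.
have lu : lsubmx u = 0.
  apply/rowP=> i; rewrite ord1 !mxE; 
  have -> : v 0 (lshift N 0) = lsubmx v 0 0 by rewrite mxE.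
  rewrite hc -big_split big1 //= => j _.
  by rewrite !mxE; case: splitP => // l _; rewrite ord1 !mxE eqxx mulr1n mulNr addNr.
have [d hd] : exists d, rsubmx u = d *m G by apply/hG; rewrite -lu hsubmxK.
exists (row_mx c' d); rewrite mul_row_col mul_mx_row mulmx0 -hd -lu hsubmxK.
by rewrite /u mulNmx addNKr.
Qed.

Lemma noetherian_row N : row_fg N.
Proof.
elim: N => [P subP|N /noetherian_row_step//].
exists 0%N, 0 => v; split=> _; first by exists 0; rewrite [v]thinmx0 [RHS]thinmx0.
by rewrite [v]thinmx0; exact: subP.1.
Qed.

(* With [k] least, a relation with a unit coefficient would let one drop a row. *)
Lemma minimal_row_generators N (P : 'rV[R]_N -> Prop) : row_submod P ->
  exists k (G : 'M[R]_(k, N)), (forall v, P v <-> exists c, v = c *m G) /\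
    forall v : 'rV_k, v *m G = 0 -> forall i, m (v 0 i).
Proof.
move=> subP; pose Q k := `[< exists G : 'M[R]_(k, N), forall v, P v <-> exists c, v = c *m G >].
have exQ : exists k, Q k.
  by have [k [G hG]] := noetherian_row subP; exists k; apply/asboolP; exists G.
case: (ex_minnP exQ) => k /asboolP[G hG] mink; exists k, G; split=> // v vG i.
apply: contrapT => /local_unit[y hy].
case: k G hG mink v vG i y hy => [|k] G hG mink v vG i y hy; first by case: i {hy}.
suff : (k.+1 <= k)%N by rewrite ltnn.
apply: mink; apply/asboolP; exists (row' i G) => w; rewrite hG.
have e (d : 'rV_k.+1) : d *m G = d 0 i *: row i G + col' i d *m row' i G.
  rewrite !mulmx_sum_row (bigD1_ord i) //=; congr (_ + _).
  by apply: eq_bigr => j _; rewrite mxE; congr (_ *: _); apply/rowP=> l; rewrite !mxE.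
split=> [[d ->]|[d ->]].
  exists (col' i d - (d 0 i * y) *: col' i v).
  have : (d 0 i * y) *: (v *m G) = 0 by rewrite vG scaler0.
  rewrite !e scalerDr scalerA -mulrA (mulrC y) hy mulr1 => /eqP.
  rewrite addr_eq0 => /eqP ->; rewrite mulmxBl -scalemxAl addrC //.
exists (\row_j if unlift i j is Some l then d 0 l else 0).
rewrite e mxE unlift_none scale0r add0r; congr (_ *m _).
by apply/rowP=> l; rewrite !mxE liftK.
Qed.

End NoetherianLocal.

(** * Projective modules and resolutions *)

Section LinearMaps.
Variable R : comPzRingType.

Section Mk.
Variables (M N : lmodType R) (f : M -> N) (linf : linear f).
Definition mklin (_ : linear f) := f.
HB.instance Definition _ := GRing.isLinear.Build R M N *:%R (mklin linf) linf.
Lemma linear_ex : exists F : {linear M -> N}, forall x, F x = f x.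
Proof. by exists (mklin linf). Qed.
End Mk.

Lemma linear_lift (A B C : lmodType R) (d : {linear A -> B}) (g : {linear C -> B}) :
  injective d -> (forall c, exists a, d a = g c) ->
  exists h : {linear C -> A}, forall c, d (h c) = g c.
Proof.
move=> injd /choice[h hE].
have [|H HE] := @linear_ex C A h; last by exists H => c; rewrite HE hE.
by move=> a x y; apply: injd; rewrite linearP !hE linearP.
Qed.

Lemma row_linearE (M : lmodType R) n (f : {linear 'rV[R]_n -> M}) v :
  f v = \sum_i v 0 i *: f (delta_mx 0 i).
Proof. by rewrite {1}[v]row_sum_delta linear_sum; apply: eq_bigr => i _; rewrite linearZ. Qed.

Lemma row_linear_ex (M : lmodType R) n (g : 'I_n -> M) :
  exists F : {linear 'rV[R]_n -> M}, forall v, F v = \sum_i v 0 i *: g i.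
Proof.
apply: linear_ex => a u v; rewrite scaler_sumr -big_split /=.
by apply: eq_bigr => i _; rewrite !mxE scalerDl scalerA.
Qed.

Lemma projective_row n : projective 'rV[R]_n.
Proof.
move=> M N g f surg; have /choice[x hx] := fun i => surg (f (delta_mx 0 i)).
have [F hF] := row_linear_ex x; exists F => v.
by rewrite hF linear_sum row_linearE; apply: eq_bigr => i _; rewrite linearZ /= hx.
Qed.

Lemma projective_iso (P Q : lmodType R) (f : {linear P -> Q}) :
  injective f -> surjective f -> projective P -> projective Q.
Proof.
move=> injf surf proP M N g h surg.
have [k hk] := proP M N g (h \o f) surg.
have [u hu] : exists u : {linear Q -> P}, forall q, f (u q) = q.
  by apply: (@linear_lift _ _ _ f idfun injf); exact: surf.
by exists (k \o u) => q /=; rewrite hk /= hu.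
Qed.

Lemma projective_regular : projective R^o.
Proof.
have [f hf] := @row_linear_ex R^o 1 (fun=> 1).
have e v : f v = v 0 0 by rewrite hf big_ord1; exact: mulr1.
apply: (projective_iso (f := f) _ _ (@projective_row 1)).
- by move=> u v; rewrite !e => h; apply/rowP=> i; rewrite ord1.
- by move=> c; exists c%:M; rewrite e mxE eqxx.
Qed.

Lemma projective_prod (P Q : lmodType R) :
  projective P -> projective Q -> projective (P * Q)%type.
Proof.
move=> proP proQ M N g f surg.
have lin1 : linear (fun x : P => (x, 0 : Q)).
  by move=> a x y; congr pair; rewrite /= scaler0 addr0.
have lin2 : linear (fun y : Q => (0 : P, y)).
  by move=> a x y; congr pair; rewrite /= scaler0 addr0.
have [i1 h1] := linear_ex lin1; have [i2 h2] := linear_ex lin2.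
have [u hu] := proP M N g (f \o i1) surg.
have [v hv] := proQ M N g (f \o i2) surg.
have lin3 : linear (fun z : P * Q => u z.1 + v z.2).
  by move=> a x y; rewrite /= !linearP scalerDr addrACA.
have [w hw] := linear_ex lin3; exists w => -[x y].
rewrite hw linearD /= hu hv /= -linearD h1 h2; congr (f _).
by congr pair; rewrite /= ?addr0 ?add0r.
Qed.

Definition exact_at (A B C : lmodType R) (f : {linear A -> B}) (g : {linear B -> C}) :=
  forall x, g x = 0 <-> exists y, f y = x.

(** Only a retraction is needed from Schanuel's isomorphism. Let [al] and [be] lift [p] and [p']
    through each other; then [rho] has the section x |-> (k x, i x), because [i' (k x)] cancels
    [al (i x)]. *)
Lemma schanuel (P P' K K' M : lmodType R)
  (i : {linear K -> P}) (p : {linear P -> M})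
  (i' : {linear K' -> P'}) (p' : {linear P' -> M}) :
  injective i -> surjective p -> exact_at i p ->
  injective i' -> surjective p' -> exact_at i' p' ->
  projective P -> projective P' -> projective K' -> projective K.
Proof.
move=> inji surp ex inji' surp' ex' proP proP' proK' A B g f surg.
have [al hal] := proP _ _ p' p surp'.
have [be hbe] := proP' _ _ p p' surp.
(* K is a retract of K' * P *)
have [rho hrho] : exists rho : {linear (K' * P)%type -> K},
    forall z, i (rho z) = z.2 - be (al z.2 + i' z.1).
  have lin : linear (fun z : K' * P => z.2 - be (al z.2 + i' z.1)).
    move=> a [x1 x2] [y1 y2] /=.
    rewrite !linearP.
    by rewrite addrACA -scalerDr linearP opprD addrACA -scalerBr.
  have [F hF] := linear_ex lin.
  have [|h hh] := @linear_lift _ _ _ i F inji; last by exists h => z; rewrite hh hF.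
  move=> z; apply/ex; rewrite hF linearB /= hbe linearD /= hal.
  have -> : p' (i' z.1) = 0 by apply/ex'; exists z.1.
  by rewrite addr0 subrr.
have [k hk] : exists k : {linear K -> K'}, forall x, i' (k x) = - al (i x).
  apply: (@linear_lift _ _ _ i' (\- (al \o i)) inji') => x /=; apply/ex'.
  by rewrite linearN /= hal (_ : p (i x) = 0) ?oppr0 //; apply/ex; exists x.
have [h hh] := projective_prod proK' proP (f \o rho) surg.
have [F hF] : exists F : {linear K -> A}, forall x, F x = h (k x, i x).
  by apply: linear_ex => a x y; rewrite -linearP !linearP.
exists F => x; rewrite hF hh /=; congr (f _); apply: inji.
by rewrite hrho /= hk subrr linear0 subr0.
Qed.

Lemma proj_dim_le0 (M : lmodType R) : proj_dim_le M 0 -> projective M.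
Proof.
move=> [P [d [eps [proP surj ex0 _ zero]]]].
apply: (projective_iso (f := eps) _ surj (proP 0%N)).
move=> x y e; apply/subr0_eq; have /ex0[z <-] : eps (x - y) = 0 by rewrite linearB e subrr.
by rewrite (zero 1%N isT z) linear0.
Qed.

Lemma proj_dim_le1_kernel (M P K : lmodType R)
  (i : {linear K -> P}) (p : {linear P -> M}) :
  proj_dim_le M 1 -> injective i -> surjective p -> exact_at i p ->
  projective P -> projective K.
Proof.
move=> [Q [d [eps [proQ surj ex0 exS zero]]]] inji surp ex proP.
have injd : injective (d 0%N).
  move=> x y e; apply/subr0_eq.
  have /exS[z <-] : d 0%N (x - y) = 0 by rewrite linearB e subrr.
  by rewrite (zero 2%N isT z) linear0.
exact: schanuel inji surp ex injd surj ex0 proP (proQ _) (proQ _).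
Qed.

(* Both [K -> P * Q0 -> W * Q0] and [Q2 -> Q1 * R -> W * Q0] are short exact,  *)
(* where [Q] is the given resolution of [R / I] and [W] is [I].                *)
Lemma proj_dim_le2_kernel (I : R -> Prop) (W P K : lmodType R)
  (f : {linear W -> R^o}) (i : {linear K -> P}) (p : {linear P -> W}) :
  proj_dim_le (@quotm R R^o I) 2 ->
  injective f -> (forall c, I c <-> exists y, f y = c) ->
  injective i -> surjective p -> exact_at i p ->
  projective P -> projective K.
Proof.
move=> [Q [d [eps [proQ surj ex0 exS zero]]]] injf If inji surp ex proP.
have subI c : quotm_pi (I : R^o -> Prop) c = 0 <-> exists y, f y = c.
  rewrite -(linear0 (quotm_pi (I : R^o -> Prop))) quotm_eq subr0 -If.
  split; last exact: submod_genS.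
  elim=> [|a x y /If[u <-] _ /If[v <-]]; first by apply/If; exists 0; rewrite linear0.
  by apply/If; exists (a *: u + v); rewrite linearP.
have injd : injective (d 1%N).
  move=> x y e; apply/subr0_eq.
  have /exS[z <-] : d 1%N (x - y) = 0 by rewrite linearB e subrr.
  by rewrite (zero 3%N isT z) linear0.
have surpi : surjective (quotm_pi (I : R^o -> Prop)).
  by move=> q; have [x ->] := quotm_surj q; exists x.
have [be hbe] := proQ 0%N _ _ _ eps surpi.
have [al hal] := projective_regular (quotm_pi (I : R^o -> Prop)) surj.
pose dP := d 0%N.
(* Schanuel's map once more, now for the two presentations of R / I by [R^o] and [Q 0]. Its values
   lie in [I], so they lift to [W]; paired with the second component it becomes the surjection [q]
   with kernel [Q 2]. *)
have [w hw] : exists w : {linear (Q 1%N * R^o)%type -> W},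
    forall z, f (w z) = z.2 - be (al z.2 + dP z.1).
  have lin : linear (fun z : Q 1%N * R^o => z.2 - be (al z.2 + dP z.1)).
    move=> a [x1 x2] [y1 y2] /=.
    rewrite !linearP.
    by rewrite addrACA -scalerDr linearP opprD addrACA -scalerBr.
  have [F hF] := linear_ex lin.
  have [|h hh] := @linear_lift _ _ _ f F injf; last by exists h => z; rewrite hh hF.
  move=> z; apply/subI; rewrite hF linearB /= hbe linearD /= hal.
  have -> : eps (dP z.1) = 0 by apply/ex0; exists z.1.
  by rewrite addr0 subrr.
have [q hq] : exists q : {linear (Q 1%N * R^o)%type -> (W * Q 0%N)%type},
    forall z, q z = (w z, al z.2 + dP z.1).
  apply: linear_ex => a x y; congr pair; first by rewrite /= linearP.
  by rewrite /= !linearP scalerDr addrACA.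
have [j hj] : exists j : {linear Q 2%N -> (Q 1%N * R^o)%type}, forall x, j x = (d 1%N x, 0).
  apply: linear_ex => a x y; congr pair; first by rewrite /= linearP.
  by rewrite /= scaler0 addr0.
have [p2 hp2] : exists p2 : {linear (P * Q 0%N)%type -> (W * Q 0%N)%type},
    forall z, p2 z = (p z.1, z.2).
  by apply: linear_ex => a x y; congr pair; rewrite /= linearP.
have [i2 hi2] : exists i2 : {linear K -> (P * Q 0%N)%type}, forall x, i2 x = (i x, 0).
  apply: linear_ex => a x y; congr pair; first by rewrite /= linearP.
  by rewrite /= scaler0 addr0.
apply: (@schanuel _ _ K (Q 2%N) _ i2 p2 j q).
- by move=> x y; rewrite !hi2 => -[/inji].
- by move=> [x y]; have [z hz] := surp x; exists (z, y); rewrite hp2 hz.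
- move=> [x y]; rewrite hp2 /=; split.
    by case=> /ex[z <-] ->; exists z; rewrite hi2.
  case=> z; rewrite hi2 => -[<- <-]; congr pair; apply/ex; by exists z.
- by move=> x y; rewrite !hj => -[/injd].
- move=> [x y].
  have [u hu] : exists u, dP u = y - al (f x + be y).
    apply/ex0; rewrite linearB /= hal linearD /= hbe.
    by have /subI -> : exists z, f z = f x; [exists x | rewrite add0r subrr].
  exists (u, f x + be y); rewrite hq /=.
  have e : al (f x + be y) + dP u = y by rewrite hu addrC subrK.
  by congr pair => //; apply: injf; rewrite hw /= e addrK.
- move=> [x y]; rewrite hq /=; split.
    case=> w0 e0; have := hw (x, y); rewrite w0 /= e0 !linear0 addr0 => y0.
    move: e0; rewrite -y0 linear0 add0r => /exS[z hz].
    by exists z; rewrite hj hz.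
  case=> z; rewrite hj => -[<- <-].
  have dz : dP (d 1%N z) = 0 by apply/exS; exists z.
  rewrite linear0 add0r dz; congr pair; apply: injf.
  by rewrite hw /= linear0 add0r dz !linear0 addr0.
- exact: projective_prod.
- apply: projective_prod => //; exact: projective_regular.
- exact: proQ.
Qed.

(** Serves both lengths that occur: a resolution of length 2, and one of length 1 when [A] is
    zero. *)
Lemma resolution_proj_dim_le (A B C M : lmodType R) (a : {linear A -> B})
  (b : {linear B -> C}) (c : {linear C -> M}) n :
  projective A -> projective B -> projective C ->
  injective a -> exact_at a b -> exact_at b c -> surjective c ->
  (1 < n)%N \/ (n = 1%N /\ forall x : A, x = 0) -> proj_dim_le M n.
Proof.
move=> proA proB proC inja ab bc surc hn.
pose Z : lmodType R := 'rV[R]_0.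
have Z0 (x : Z) : x = 0 by rewrite [x]thinmx0 [RHS]thinmx0.
pose P (i : nat) : lmodType R :=
  match i with 0 => C | 1 => B | 2 => A | _ => Z end.
pose d i : {linear P i.+1 -> P i} :=
  match i return {linear P i.+1 -> P i} with 0 => b | 1 => a | _ => \0 end.
exists P, d, c; split => //.
- by move=> [|[|[|i]]] //; exact: projective_row.
- case=> [|[|i]] x /=; first exact: ab.
    split=> [|[y <-]]; last by rewrite linear0.
    by rewrite -(linear0 a) => /inja ->; exists 0.
  by split=> // _; exists 0; case: i x => [|i] x; rewrite ?[x]Z0 linear0.
- case: hn => [n2|[-> A0]] i lt.
    by have := leq_ltn_trans n2 lt; case: i {lt} => [|[|[|i]]] // _ x; exact: Z0.
  by case: i lt => [|[|[|i]]] // _ x; exact: Z0.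
Qed.

Lemma projective_proj_dim_le0 (M : lmodType R) : projective M -> proj_dim_le M 0.
Proof.
move=> proM; pose Z : lmodType R := 'rV[R]_0.
have Z0 (x : Z) : x = 0 by rewrite [x]thinmx0 [RHS]thinmx0.
pose P (i : nat) : lmodType R := match i with 0 => M | _ => Z end.
pose d i : {linear P i.+1 -> P i} := \0.
exists P, d, idfun; split => //.
- by move=> [|i] //; exact: projective_row.
- by move=> x; exists x.
- move=> x; split=> [/= ->|[y <-]] //; by exists 0.
- by move=> i x; split=> // _; exists 0; rewrite [x]Z0 linear0.
- by move=> [|i] // _ x; exact: Z0.
Qed.

(** [T] is the matrix of the idempotent [s \o p], with [s] a section of [p]. It turns projectivity
    into the matrix identities that [split_relations_free] consumes. *)
Lemma projective_split_row k (K : lmodType R) (p : {linear 'rV[R]_k -> K}) :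
  projective K -> surjective p ->
  exists T : 'M[R]_k, (forall v, p (v *m T) = p v) /\ (forall v, p v = 0 -> v *m T = 0).
Proof.
move=> proK surp; have [s hs] := proK _ _ p idfun surp.
exists (lin1_mx (s \o p)); split=> v; rewrite mul_rV_lin1 /=; first by rewrite hs.
by move->; rewrite linear0.
Qed.

Lemma split_row_kernel k (K : lmodType R) (p : {linear 'rV[R]_k -> K}) T :
  (forall v, p (v *m T) = p v) -> forall i, p (row i (1%:M - T)) = 0.
Proof. by move=> pT i; rewrite rowE mulmxBr mulmx1 linearB pT subrr. Qed.

End LinearMaps.

(** * Regular sequences and projectivity of ideals *)

Section RegularSequences.
Variable R : comPzRingType.

Lemma ideal_gen1P (x a : R) :
  ideal_gen (fun y => y \in [:: x]) a <-> exists b, a = x * b.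
Proof.
rewrite ideal_gen_seqP /=; split=> [[c ->]|[b ->]].
  by exists (c ord0); rewrite big_ord1 mulrC.
by exists (fun=> b); rewrite big_ord1 mulrC.
Qed.

Lemma ideal_gen2P (x y a : R) :
  ideal_gen (fun u => u \in [:: x; y]) a <-> exists b c, a = x * b + y * c.
Proof.
rewrite ideal_gen_seqP /=; split=> [[c ->]|[b [c ->]]].
  exists (c ord0), (c (lift ord0 ord0)).
  by rewrite big_ord_recl big_ord1 /= mulrC [X in _ + X]mulrC.
exists (fun i => if i == ord0 then b else c).
by rewrite big_ord_recl big_ord1 /= mulrC [X in _ + X]mulrC.
Qed.

Lemma ideal_gen_nil (a : R) : ideal_gen (fun y => y \in [::]) a <-> a = 0.
Proof.
split=> [|->]; last exact: submod_gen0.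
by elim=> // b u v; rewrite in_nil.
Qed.

(* [a, b] is a possibly improper regular sequence *)
Definition regular_pair (a b : R) : Prop :=
  nonzerodivisor a /\ forall w v, b * w = a * v -> exists u, w = a * u.

Lemma regular_seq_pair x y s : regular_seq [:: x, y & s] -> regular_pair x y.
Proof.
move=> [reg _]; split=> [a xa|w v e].
  by apply/ideal_gen_nil; apply: (reg 0%N isT); apply/ideal_gen_nil.
apply/ideal_gen1P; have := reg 1%N isT w; apply.
by apply/ideal_gen1P; exists v.
Qed.

Lemma grade_ge2_nzd (I : R -> Prop) :
  grade_ge I 2 -> exists2 s, I s & nonzerodivisor s.
Proof.
case=> [I1|[[|x [|y [|? ?]]] [] // _ Is reg]].
  by exists 1 => // z; rewrite mul1r.
by exists x; [apply: Is; rewrite mem_head | case: (regular_seq_pair reg)].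
Qed.

Lemma regular_pair_seq x y : regular_pair x y ->
  (exists b c, x * b + y * c = 1) \/ regular_seq [:: x; y].
Proof.
move=> [nzx xy]; have [h|h] := pselect (exists b c, x * b + y * c = 1); [by left|right].
split; last by case/ideal_gen2P=> b [c e]; apply: h; exists b, c.
case=> [|[|]] // _ a /=.
  by move=> /ideal_gen_nil/nzx ->; apply/ideal_gen_nil.
by move=> /ideal_gen1P[v /xy[u ->]]; apply/ideal_gen1P; exists u.
Qed.

(** If the pair is improper, [I] is the unit ideal, whose grade is infinite by convention. *)
Lemma regular_pair_grade (I : R -> Prop) x y :
  ideal I -> I x -> I y -> regular_pair x y -> grade_ge I 2.
Proof.
move=> idI Ix Iy /regular_pair_seq[[b [c e]]|reg]; [left | right].
  by rewrite -e; apply: (idealD idI); apply: (idealMr idI).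
by exists [:: x; y]; split=> // z; rewrite !inE => /orP[]/eqP ->.
Qed.

Lemma regular_pair_sym a b :
  regular_pair a b -> nonzerodivisor b -> regular_pair b a.
Proof.
move=> [nza ab] nzb; split=> // w v e.
have [u hu] := ab v w (esym e); exists u; apply: (nzdI nza).
by rewrite e hu mulrCA.
Qed.

Lemma regular_pairX a b k : regular_pair a b -> regular_pair (a ^+ k) b.
Proof.
move=> [nza ab]; split; first exact: nzdX.
elim: k => [|k IH] w v e; first by exists w; rewrite expr0 mul1r.
have [u hu] : exists u, w = a * u by apply: (ab w (a ^+ k * v)); rewrite e exprS mulrA.
have [|t ht] := IH u v; last by exists t; rewrite hu ht exprS mulrA.
by apply: (nzdI nza); rewrite mulrCA -hu e exprS mulrA.
Qed.

Lemma regular_pairXX a b k l :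
  regular_pair a b -> nonzerodivisor b -> regular_pair (a ^+ k) (b ^+ l).
Proof.
move=> ab nzb; apply: regular_pair_sym; last exact: nzdX ab.1.
apply: regular_pairX; apply: regular_pair_sym => //; exact: regular_pairX.
Qed.

(** * Modules embedded in the ring as ideals: projectivity, grade and perfection *)

Section IdealModule.
Variables (W : lmodType R) (f : {linear W -> R^o}) (injf : injective f).

Lemma image_ideal : ideal (fun s => exists w, f w = s).
Proof.
split=> [|_ _ [v <-] [w <-]|s _ [w <-]]; first by exists 0; rewrite linear0.
  by exists (v + w); rewrite linearD.
by exists (s *: w); rewrite linearZ.
Qed.

Lemma ideal_scale_comm w w' : f w *: w' = f w' *: w.
Proof. by apply: injf; rewrite !linearZ; apply: mulrC. Qed.

(* In grade 2 every functional on [W] is multiplication by a scalar, so a dual  *)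
(* basis of [W] exhibits 1 as an element of the ideal.                         *)
Lemma projective_ideal_unit N (p : {linear 'rV[R]_N -> W}) :
  projective W -> surjective p ->
  grade_ge (fun c => exists w, f w = c) 2 -> exists w, f w = 1.
Proof.
move=> proW surp [//|] [[|x [|y [|? ?]]]] [] // _ Is reg.
have [wx hx] : exists w, f w = x by apply: Is; rewrite mem_head.
have [wy hy] : exists w, f w = y by apply: Is; rewrite !inE eqxx orbT.
have [nzx xy] := regular_seq_pair reg.
have [s hs] := proW _ _ p idfun surp.
have cst i : exists c, forall w, s w 0 i = f w * c.
  have sc w w' : f w * s w' 0 i = f w' * s w 0 i.
    have := congr1 (fun u => s u 0 i) (ideal_scale_comm w w').
    by rewrite !linearZ !mxE.
  have [c hc] : exists c, s wx 0 i = x * c.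
    by apply: (xy (s wx 0 i) (s wy 0 i)); rewrite -hx -hy sc.
  exists c => w; apply: (nzdI nzx).
  by rewrite -{1}hx sc hc; ring.
have [c hc] := choice cst.
(* Since [s wx] is [x] times the row of the [c i], applying [f \o p] gives x = x * f (p c), and [x]
   cancels. *)
exists (p (\row_i c i)); apply: (nzdI nzx).
have e : p (s wx) = wx := hs wx.
rewrite mulr1 -[RHS]hx -[in RHS]e.
rewrite (_ : s wx = x *: \row_i c i); first by rewrite !linearZ.
by apply/rowP=> i; rewrite !mxE hc hx.
Qed.

Section Extension.
Variables (P K : lmodType R) (i : {linear K -> P}) (p : {linear P -> W}).
Hypotheses (inji : injective i) (ex : exact_at i p) (surp : surjective p).

Lemma retract_projective (r : {linear P -> K}) :
  (forall k, r (i k) = k) -> projective P -> projective W.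
Proof.
move=> ri proP M N g h surg.
have [k hk] := proP _ _ g (h \o p) surg.
have [q hq] := choice surp.
have q_ker u : p u = 0 -> u - i (r u) = 0 by move=> /ex[z <-]; rewrite ri subrr.
(* [q] is a bare choice of preimages, yet [s] is linear: u - i (r u) vanishes on the kernel of [p],
   so the preimage does not matter. *)
have [s hS] : exists s : {linear W -> P}, forall w, s w = q w - i (r (q w)).
  apply: linear_ex => a u v; rewrite scalerBr addrACA -opprD -!linearP.
  set c := a *: q u + q v.
  have /q_ker : p (q (a *: u + v) - c) = 0 by rewrite linearB linearP /= !hq subrr.
  rewrite (linearB r) (linearB i) => /eqP; rewrite subr_eq0 => /eqP e.
  by apply/eqP; rewrite subr_eq -addrA addrC -subr_eq e addrC.
exists (k \o s) => w /=; rewrite hk /= hS linearB /= hq.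
by rewrite (_ : p (i _) = 0) ?subr0 //; apply/ex; exists (r (q w)).
Qed.

(* The vanishing of Ext^1(W, R): [kx], [ky] and [kz] make [x phi], [y phi] and  *)
(* [z phi] extend to [P]; the third element of the sequence corrects [x phi]'s  *)
(* extension to a multiple of [x].                                             *)
Lemma grade3_extension x y z (phi : {linear K -> R^o}) :
  (exists w, f w = x) -> (exists w, f w = y) -> (exists w, f w = z) ->
  regular_seq [:: x; y; z] ->
  exists psi : {linear P -> R^o}, forall k, psi (i k) = phi k.
Proof.
move=> [wx hx] [wy hy] [wz hz] reg; have [nzx xy] := regular_seq_pair reg.
pose ep : P -> R := f \o p.
(* An element [c] of the ideal annihilates Ext^1(W, R), and [ka] is the explicit homotopy: c v - ep
   v u dies in [W], hence comes from [K]. *)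
have lift w (c : R) : f w = c -> exists u (ka : {linear P -> K}),
    ep u = c /\ forall v, i (ka v) = c *: v - ep v *: u.
  move=> hw; have [u hu] := surp w; exists u.
  have lin : linear (fun v => c *: v - ep v *: u).
    move=> a s t; rewrite /ep /= (linearP p) (linearP f) scalerDr scalerDl.
    by rewrite opprD addrACA scalerA mulrC -!scalerA -scalerBr.
  have [F hF] := linear_ex lin.
  have [|ka hka] := @linear_lift _ _ _ _ i F inji.
    move=> v; apply/ex; apply: injf; rewrite hF (linearB p) (linearB f).
    rewrite !(linearZZ p) !(linearZZ f) /=.
    by rewrite hu hw (linear0 f); apply/eqP; rewrite subr_eq0; apply/eqP; exact: mulrC.
  by exists ka; split=> [|v]; [rewrite /ep /= hu | rewrite hka hF].
have [px [kx [ex_ hkx]]] := lift _ _ hx; have [py [ky [ey_ hky]]] := lift _ _ hy.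
have [pz [kz [ez_ hkz]]] := lift _ _ hz.
have id1 v : y *: kx v = x *: ky v - ep v *: ky px.
  apply: inji; rewrite (linearB i) !(linearZZ i) /= hkx !hky ex_.
  rewrite !scalerBr !scalerA (mulrC y x) (mulrC y (ep v)) (mulrC x (ep v)).
  by rewrite opprB addrA subrK.
have id2 : z *: ky px + x *: kz py + y *: kx pz = 0.
  apply: inji; rewrite !(linearD i) !(linearZZ i) (linear0 i) /= hkx hky hkz ex_ ey_ ez_.
  rewrite !scalerBr !scalerA (mulrC z x) (mulrC z y) (mulrC y x).
  by rewrite !addrA !subrK subrr.
(* [id2] places z times this value in (x, y), and [z] is regular modulo (x, y). *)
have [al [be hab]] : exists al be, phi (ky px) = x * al + y * be.
  apply/ideal_gen2P; have [+ _] := reg => /(_ 2%N isT (phi (ky px)) _) /=; apply.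
  apply/ideal_gen2P; exists (- phi (kz py)), (- phi (kx pz)).
  have := congr1 phi id2; rewrite !(linearD phi) !(linearZZ phi) (linear0 phi) /= => h.
  by apply/subr0_eq; rewrite -h !mulrN -opprD opprK addrA.
have [d hd] : exists d : {linear R^o -> R^o}, forall a, d a = x * a.
  by apply: linear_ex => a s t; rewrite mulrDr [_ *: s]/(_ * _) mulrCA.
(* By [id1] and [hab], y * g v = x * (phi (ky v) - ep v * al). Hence x divides g v, and the quotient
   is the extension sought. *)
have [g hg] : exists g : {linear P -> R^o}, forall v, g v = phi (kx v) + ep v * be.
  apply: linear_ex => a s t; rewrite /ep /= (linearP kx) (linearP phi) (linearP p) (linearP f) /=.
  rewrite -[a *: phi _]/(a * _) -[a *: f _]/(a * _) -[a *: (_ + _)]/(a * _).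
  by ring.
have injd : injective d by move=> s t; rewrite !hd; apply: nzdI.
have [|psi hpsi] := @linear_lift _ _ _ _ d g injd.
  move=> v; have [|u hu] := xy (g v) (phi (ky v) - ep v * al); last by exists u; rewrite hd.
  have := congr1 phi (id1 v); rewrite (linearB phi) !(linearZZ phi) /= hab hg mulrDr.
  rewrite -[y *: _]/(y * _) -[x *: _]/(x * _) -[ep v *: _]/(ep v * _) => ->.
  by ring.
exists psi => k; apply: injd; rewrite hpsi hg hd.
have pik : p (i k) = 0 by apply/ex; exists k.
rewrite /ep /= pik linear0 mul0r addr0 (_ : kx (i k) = x *: k) ?linearZ //.
by apply: inji; rewrite hkx /ep /= pik !linear0 scale0r subr0 linearZ.
Qed.

End Extension.

(** Extending each coordinate functional of the free kernel to [P] gives a retraction, so the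
    presentation splits. *)
Lemma grade3_projective b (P : lmodType R) (i : {linear 'rV[R]_b -> P}) (p : {linear P -> W}) :
  injective i -> exact_at i p -> surjective p -> projective P ->
  grade_ge (fun c => exists w, f w = c) 3 -> (exists w, f w = 1) \/ projective W.
Proof.
move=> inji ex surp proP [?|]; first by left.
move=> [[|x [|y [|z [|? ?]]]]] [] // _ Is reg; right.
have [[wx wy] wz] : (exists w, f w = x) * (exists w, f w = y) * (exists w, f w = z).
  by do !split; apply: Is; rewrite !inE eqxx ?orbT.
have /choice[psi hpsi] : forall j, exists psi : {linear P -> R^o}, forall k, psi (i k) = k 0 j.
  move=> j; have [phi hphi] : exists phi : {linear 'rV[R]_b -> R^o}, forall v, phi v = v 0 j.
    by apply: linear_ex => a u v; rewrite !mxE.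
  have [psi hpsi] := grade3_extension inji ex surp phi wx wy wz reg.
  by exists psi => k; rewrite hpsi hphi.
have [r hr] : exists r : {linear P -> 'rV[R]_b}, forall v, r v = \row_j psi j v.
  by apply: linear_ex => a u v; apply/rowP=> j; rewrite !mxE linearP.
apply: (retract_projective ex surp (r := r)) => // k.
by rewrite hr; apply/rowP=> j; rewrite !mxE hpsi.
Qed.

Lemma unit_image_projective w1 : f w1 = 1 -> projective W.
Proof.
move=> hw1; have surf : surjective f.
  by move=> s; exists (s *: w1); rewrite linearZ /= hw1; apply: mulr1.
have [g hg] := linear_lift (g := idfun) injf surf.
apply: (projective_iso (f := g)); last exact: projective_regular.
  by move=> s s' /(congr1 f); rewrite !hg.
by move=> w; exists (f w); apply: injf; rewrite hg.
Qed.

Variables (I : R -> Prop) (imf : forall s, I s <-> exists w, f w = s).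

Lemma image_submod_gen : submod_gen (I : R^o -> Prop) = I.
Proof.
apply: funext => s; apply: propext; split; last exact: submod_genS.
elim=> [|b y z /imf[u <-] _ /imf[v <-]]; apply/imf; first by exists 0; rewrite linear0.
by exists (b *: u + v); rewrite linearP.
Qed.

Lemma image_quotient_exact : exact_at f (quotm_pi (I : R^o -> Prop)).
Proof.
by move=> s; rewrite -(linear0 (quotm_pi (I : R^o -> Prop))) quotm_eq subr0 image_submod_gen.
Qed.

Lemma image_grade k : grade_ge I k -> grade_ge (fun s => exists w, f w = s) k.
Proof.
case=> [/imf|[s [sz Is reg]]]; [by left | right].
by exists s; split=> // z /Is /imf.
Qed.

Lemma grade2_not_projective N (p : {linear 'rV[R]_N -> W}) :
  surjective p -> grade_ge I 2 -> ~ I 1 -> ~ projective W.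
Proof.
by move=> surp gr I1 proW; apply/I1/imf/(projective_ideal_unit proW surp)/image_grade.
Qed.

(** Splicing the presentation with [I] inside R bounds the projective dimension of R / I by 2. Grade
    3, or projective dimension at most 1, would make [W] projective, which a proper ideal of grade
    at least 2 is not. *)
Lemma perfect_of_free_presentation b N (i : {linear 'rV[R]_b -> 'rV[R]_N})
    (p : {linear 'rV[R]_N -> W}) :
  injective i -> exact_at i p -> surjective p ->
  grade_ge I 2 -> ~ I 1 -> perfect_of_grade I 2.
Proof.
move=> inji ex surp gr2 I1; have npro := grade2_not_projective surp gr2 I1.
have proN := @projective_row R N.
pose q : {linear R^o -> @quotm R R^o I} := quotm_pi (I : R^o -> Prop).
have surq : surjective q by move=> z; have [s ->] := quotm_surj z; exists s.
have pd1 : ~ proj_dim_le (@quotm R R^o I) 1.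
  move=> pd; apply: npro.
  exact: (proj_dim_le1_kernel pd injf surq image_quotient_exact (@projective_regular R)).
split; [split=> // /image_grade gr3 | split=> [|[|[|//]] _ pd]].
- by case: (grade3_projective inji ex surp proN gr3) => [/imf|].
- pose g : {linear 'rV[R]_N -> R^o} := f \o p.
  have exg : exact_at i g.
    move=> v; rewrite -ex /=; split=> [|->]; last by rewrite linear0.
    by rewrite -(linear0 f) => /injf.
  have exq : exact_at g q.
    move=> s; rewrite image_quotient_exact; split=> [[w <-]|[v <-]]; last by exists (p v).
    by have [v <-] := surp w; exists v.
  apply: (resolution_proj_dim_le _ proN (@projective_regular R) inji exg exq surq).
    exact: projective_row.
  by left.
- apply: pd1; case: pd => [P [d [eps [h1 h2 h3 h4 h5]]]].
  by exists P, d, eps; split=> // l lt; apply: h5 (ltnW lt).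
- exact: pd1.
Qed.

End IdealModule.
End RegularSequences.

(** * Reductions and ideals of minors *)

Lemma minors_descent (R : comPzRingType) (r e : nat) (A : 'M[R]_(r, e))
    (H : R -> Prop) (c : R) :
  ideal H -> (forall x k, H (x ^+ k) -> H x) ->
  (forall t : 'cV_e, (forall i, H ((A *m t) i 0)) -> forall i, H (c * t i 0)) ->
  (forall rho : 'I_e -> 'I_r, H (\det (rowsub rho A))) -> H c.
Proof.
move=> idH radH stepH minH.
suff minor d h (rho : 'I_h -> 'I_r) (ka : 'I_h -> 'I_e) :
    (d + h)%N = e -> H (c * \det (mxsub rho ka A)).
  have := minor e 0%N (fun i => match i with Ordinal _ p => False_rect _ (notF p) end)
    (fun i => match i with Ordinal _ p => False_rect _ (notF p) end) (addn0 e).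
  by rewrite det_mx00 mulr1.
elim: d h rho ka => [|d IH] h rho ka hd.
  rewrite add0n in hd; case: _ / hd ka rho => ka rho in A H idH radH stepH minH *.
  apply: (idealMl idH).
  have -> : mxsub rho ka A = rowsub rho A *m colsub ka 1%:M.
    by rewrite mulmx_colsub mulmx1; apply/matrixP=> i j; rewrite !mxE.
  by rewrite det_mulmx; apply: (idealMr idH).
have [k hk] : exists k, k \notin codom ka.
  apply/existsP; apply: contrapT => /negP; rewrite negb_exists => /forallP full.
  have : (#|'I_e| <= #|codom ka|)%N.
    by apply/subset_leq_card/subsetP=> k _; have := full k; rewrite negbK.
  rewrite card_ord => le; have := leq_trans le (leq_trans (card_size _) _).
  move=> /(_ h); rewrite size_codom card_ord leqnn => /(_ isT).
  by rewrite -hd addSn ltnNge leq_addl.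
pose ka' (l : 'I_h.+1) := if unlift ord0 l is Some l' then ka l' else k.
pose B i : 'M_h.+1 :=
  mxsub (fun l => if unlift ord0 l is Some l' then rho l' else i) ka' A.
pose cof (l : 'I_h.+1) := (-1) ^+ l * \det (mxsub rho (ka' \o lift l) A).
have detB i : \det (B i) = \sum_l A i (ka' l) * cof l.
  rewrite (expand_det_row _ ord0); apply: eq_bigr => l _.
  rewrite mxE unlift_none /cofactor add0n; congr (_ * (_ * \det _)).
  by apply/matrixP=> s t; rewrite !mxE liftK.
(* The entries of [A *m t] are minors one size larger, and [t k] is the given minor. *)
pose t : 'cV_e := \col_j \sum_(l | ka' l == j) cof l.
have At i : (A *m t) i 0 = \det (B i).
  rewrite detB mxE (partition_big ka' predT) //=; apply: eq_bigr => j _.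
  by rewrite mxE big_distrr /=; apply: eq_bigr => l /eqP ->.
have tk : t k 0 = \det (mxsub rho ka A).
  rewrite mxE (bigD1 ord0) /=; last by rewrite /ka' unlift_none.
  rewrite big1 ?addr0 => [|l /andP[]]; last first.
    rewrite /ka'; case: unliftP => [l' _ /eqP ek|-> _ /eqP //].
    by case/negP: hk; rewrite -ek codom_f.
  rewrite /cof expr0 mul1r; congr (\det _).
  by apply/matrixP=> i j; rewrite !mxE /ka' /= liftK.
(* The induction hypothesis only controls c times the larger minors, so [stepH] is applied to
   [c *: t]. This costs a second factor [c], which radicality absorbs. *)
have := stepH (c *: t) _ k; rewrite mxE tk => hH.
apply: (radH _ 2); set D := \det _ in hH *.
have -> : (c * D) ^+ 2 = D * (c * (c * D)) by ring.
apply/(idealMl idH)/hH => i; rewrite -scalemxAr mxE At.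
by apply: IH; rewrite addnS -addSn.
Qed.

Lemma rmorphism_ex (A B : pzRingType) (f : A -> B) :
  zmod_morphism f -> monoid_morphism f ->
  exists F : {rmorphism A -> B}, forall x, F x = f x.
Proof.
move=> fD fM; pose F1 := GRing.isZmodMorphism.Build A B f fD.
pose F2 := GRing.isMonoidMorphism.Build A B f fM.
pose F : {rmorphism A -> B} := HB.pack f F1 F2.
by exists F.
Qed.

Lemma quotr_lift (B C : comPzRingType) (A : B -> Prop) (f : {rmorphism B -> C}) :
  (forall x, A x -> f x = 0) ->
  exists g : {rmorphism quotr A -> C}, forall x, g (quotr_pi A x) = f x.
Proof.
move=> killA.
have kill x : ideal_gen A x -> f x = 0.
  elim=> [|a y z Ay _ IH]; first exact: rmorph0.
  by rewrite rmorphD rmorphM (killA y Ay) mulr0 add0r.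
have /choice[h hh] : forall q : quotr A, exists c, forall x, q = quotr_pi A x -> f x = c.
  move=> q; have [x ->] := quotr_surj q; exists (f x) => y /esym/quotr_eq/kill.
  by rewrite rmorphB => /eqP; rewrite subr_eq0 => /eqP.
have hE x : h (quotr_pi A x) = f x by rewrite -(hh _ x).
have [||g hg] := @rmorphism_ex (quotr A) C h; last by exists g => x; rewrite hg hE.
  move=> p q; have [x ->] := quotr_surj p; have [y ->] := quotr_surj q.
  by rewrite -rmorphB !hE rmorphB.
split=> [|p q]; first by rewrite -[1]/(quotr_pi A 1) hE rmorph1.
have [x ->] := quotr_surj p; have [y ->] := quotr_surj q.
by rewrite -rmorphM !hE rmorphM.
Qed.

(** * Evaluating the Rees algebra along a functional *)

Section ReesEvaluation.
Variables (R : comNzRingType) (E : lmodType R) (la : {linear E -> R^o}).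

Lemma cmonom_prod_mmorphism :
  mmorphism (fun k : {cmonom E} => \prod_(x <- finsupp k) (la x : R) ^+ k x).
Proof.
split=> [k l|]; last by rewrite mdom1 big_seq_fset0.
have widen (k' : {cmonom E}) (D : {fset E}) : (finsupp k' `<=` D)%fset ->
    \prod_(x <- finsupp k') (la x : R) ^+ k' x = \prod_(x <- D) (la x : R) ^+ k' x.
  by move=> sub; apply: big_fset_incl => // x _; rewrite memNfinsupp => /eqP ->.
pose D := (finsupp k `|` finsupp l)%fset.
rewrite (widen k D) ?fsubsetUl // (widen l D) ?fsubsetUr // (widen _ D).
  by rewrite -big_split; apply: eq_bigr => x _; rewrite cmM exprD.
by rewrite mdomD.
Qed.

Lemma sym_poly_eval : exists f : {rmorphism {malg R[{cmonom E}]} -> R},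
  (forall x, f (sym_var x) = la x) /\ forall c, f (malgC c) = c.
Proof.
pose mm := monalg.isMultiplicative.Build _ _ _ cmonom_prod_mmorphism.
pose h : {mmorphism _ -> _} :=
  HB.pack (fun k : {cmonom E} => \prod_(x <- finsupp k) (la x : R) ^+ k x) mm.
exists (monalg.mmap idfun h); split=> [x|c]; last exact: (@monalg.mmapC _ _ _ idfun h c).
by rewrite /= monalg.mmapU /= mul1r mdomU big_seq_fset1 cmUU expr1.
Qed.

(** The extension of [la] to the symmetric algebra is R-linear, so it sends torsion to elements of R
    killed by a nonzerodivisor, that is, to 0. *)
Lemma rees_eval : exists g : {rmorphism Rees E -> R}, forall x, g (rees_in x) = la x.
Proof.
have [f [fX fC]] := sym_poly_eval.
have fZ c p : f (c *: p) = c * f p by rewrite -mul_malgC rmorphM fC.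
have [|g1 hg1] := @quotr_lift _ _ (@sym_rel R E) f.
  move=> _ [a [x [y ->]]]; rewrite (rmorphB f) (rmorphD f) fZ.
  transitivity (la (a *: x + y) - (a * la x + la y)); last by rewrite (linearP la); exact: subrr.
  exact (f_equal2 (fun u v => u - v) (fX _) (f_equal2 (fun u v => a * u + v) (fX x) (fX y))).
have gc a : g1 (sym_const E a) = a.
  by rewrite hg1 fZ rmorph1 mulr1.
have [|g2 hg2] := @quotr_lift _ _ (@torsion R (Sym E)) g1.
  move=> x [a nza] /(congr1 g1); rewrite rmorph0 -[a *: x]/(sym_const E a * x) rmorphM gc.
  exact: nza.
exists g2 => x; rewrite /rees_in hg2 hg1; exact: fX.
Qed.

End ReesEvaluation.

(* A functional [v |-> v *m t] on the ambient free module extends to the Rees  *)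
(* algebra, where the reduction relation says that its values on [E] are       *)
(* nilpotent modulo its values on [U].                                         *)
Lemma reduction_minors (R : comNzRingType) (E : lmodType R) (U : E -> Prop)
    (r n : nat) (a : 'I_r -> E) (j : {linear E -> 'rV[R]_n}) (H : R -> Prop) c :
  reduction U -> (forall x, U x <-> submod_gen (fun y => exists i, y = a i) x) ->
  ideal H -> (forall x k, H (x ^+ k) -> H x) ->
  (forall v, exists x, j x = c *: v) ->
  (forall rho : 'I_n -> 'I_r, H (\det (rowsub rho (\matrix_i j (a i))))) -> H c.
Proof.
move=> [s redU] genU idH radH hc; apply: minors_descent => // t At i.
have [la hla] : exists la : {linear E -> R^o}, forall x, la x = (j x *m t) 0 0.
  by apply: linear_ex => k x y; rewrite linearP mulmxDl -scalemxAl !mxE.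
have [g hg] := rees_eval la.
have HU u : U u -> H (la u).
  move/genU; elim=> [|k y z [l ->] _ IH]; first by rewrite linear0; apply: ideal0.
  rewrite linearP; apply: (idealD idH) => //; apply: (idealMl idH).
  have := At l; rewrite hla; congr H; rewrite !mxE; apply: eq_bigr => q _.
  by rewrite mxE.
have [y hy] := hc (delta_mx 0 i).
have lay : la y = c * t i 0.
  by rewrite hla hy -scalemxAl mxE -rowE mxE.
apply: (radH _ s.+1); rewrite -lay.
have /redU : @rees_comp R E s.+1 (\prod_(k < s.+1) rees_in y).
  by apply: submod_genS; exists (fun=> y).
have -> : la y ^+ s.+1 = g (\prod_(k < s.+1) rees_in y).
  by rewrite prodr_const card_ord rmorphXn hg.
elim=> [|k w z [u [v [Uu _ ->]]] _ IH]; first by rewrite rmorph0; apply: ideal0.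
rewrite -[k *: _]/(rees_pi E (sym_const E k) * _) rmorphD !rmorphM hg.
apply: (idealD idH) => //; apply: (idealMl idH); apply: (idealMr idH); exact: HU.
Qed.

(** * Leading forms in two variables *)

Section TotalDegree.
Variable T : comNzRingType.
Implicit Types (p q : {poly {poly T}}) (D : T).

(** Total degree in t = ['X] (outer) and u = ['X%:P] (inner). The strict bound makes [d = 0] mean p
    = 0. *)
Definition tdeg_lt d p := forall a b, (d <= a + b)%N -> p`_a`_b = 0.

Lemma tdeg_ltW d d' p : (d <= d')%N -> tdeg_lt d p -> tdeg_lt d' p.
Proof. by move=> le h a b /(leq_trans le); apply: h. Qed.

Lemma tdeg_lt0 d : tdeg_lt d 0.
Proof. by move=> a b _; rewrite !coef0. Qed.

Lemma tdeg_ltD d p q : tdeg_lt d p -> tdeg_lt d q -> tdeg_lt d (p + q).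
Proof. by move=> hp hq a b le; rewrite !coefD hp ?hq ?addr0. Qed.

Lemma tdeg_lt_sum d (I : finType) (P : pred I) (F : I -> {poly {poly T}}) :
  (forall i, P i -> tdeg_lt d (F i)) -> tdeg_lt d (\sum_(i | P i) F i).
Proof.
by move=> h; elim/big_ind: _ => //; [exact: tdeg_lt0 | exact: tdeg_ltD].
Qed.

(** The asymmetric successor is the sharp bound for strict degrees, stated without truncated
    subtraction. *)
Lemma tdeg_ltM d d' p q :
  tdeg_lt d p -> tdeg_lt d'.+1 q -> tdeg_lt (d + d') (p * q).
Proof.
move=> hp hq a b le; rewrite coefM coef_sum big1 // => i _.
rewrite coefM big1 // => k _; have [lt|ge] := ltnP (i + k) d; last by rewrite hp ?mul0r.
rewrite [X in _ * X]hq ?mulr0 //.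
have ia : (i <= a)%N by rewrite -ltnS.
have kb : (k <= b)%N by rewrite -ltnS.
rewrite -(leq_add2l (i + k)) addnACA !subnKC //.
by rewrite addnS; apply: leq_trans le; rewrite ltn_add2r.
Qed.

Lemma tdeg_ltC (c : T) : tdeg_lt 1 c%:P%:P.
Proof.
by case=> [|a] [|b] // _; rewrite coefC /= ?coefC ?coef0.
Qed.

Lemma tdeg_ltX : tdeg_lt 2 'X.
Proof. by case=> [|[|a]] [|b] // _; rewrite coefX ?coef0 ?coef1. Qed.

Lemma tdeg_ltXC : tdeg_lt 2 'X%:P.
Proof. by case=> [|a] [|[|b]] // _; rewrite coefC ?coef0 ?coefX. Qed.

Lemma tdeg_lt_prod n (f : 'I_n -> {poly {poly T}}) :
  (forall i, tdeg_lt 2 (f i)) -> tdeg_lt n.+1 (\prod_i f i).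
Proof.
elim: n f => [|n IH] f h; first by rewrite big_ord0; apply: tdeg_ltC.
by rewrite big_ord_recl; have := tdeg_ltM (h ord0) (IH _ (fun i => h (lift ord0 i))).
Qed.

Lemma tdeg_lt_prod_perturb n (x y : 'I_n -> {poly {poly T}}) :
  (forall i, tdeg_lt 1 (x i)) -> (forall i, tdeg_lt 2 (y i)) ->
  tdeg_lt n (\prod_i (x i + y i) - \prod_i y i).
Proof.
elim: n x y => [|n IH] x y hx hy.
  by rewrite !big_ord0 subrr; apply: tdeg_lt0.
rewrite !big_ord_recl; set P := \prod_(i < n) _; set P' := \prod_(i < n) _.
have -> : (x ord0 + y ord0) * P - y ord0 * P' =
    (P - P') * (x ord0 + y ord0) + x ord0 * P' by ring.
apply: tdeg_ltD.
  rewrite -addn1; apply: tdeg_ltM; first exact: IH.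
  by apply: tdeg_ltD => //; apply: tdeg_ltW (hx _).
by rewrite -add1n; apply: tdeg_ltM => //; apply: tdeg_lt_prod.
Qed.

Lemma tdeg_lt_det_perturb n (X Y : 'M[{poly {poly T}}]_n) :
  (forall i j, tdeg_lt 1 (X i j)) -> (forall i j, tdeg_lt 2 (Y i j)) ->
  tdeg_lt n (\det (X + Y) - \det Y).
Proof.
move=> hX hY; rewrite /determinant -sumrB; apply: tdeg_lt_sum => s _.
rewrite -mulrBr mulrC; apply: (@tdeg_ltW (n + 0)); first by rewrite addn0.
apply: tdeg_ltM.
  under eq_bigr do rewrite mxE.
  exact: tdeg_lt_prod_perturb.
by rewrite -(rmorph_sign (polyC \o polyC)); apply: tdeg_ltC.
Qed.

Lemma tdeg_ltP p : exists d, tdeg_lt d p.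
Proof.
exists (size p + \max_(i < size p) size (p`_i)%R)%N => a b le.
have [lt|ge] := ltnP a (size p); last by rewrite (nth_default 0 ge) coef0.
apply: nth_default; pose F (i : 'I_(size p)) := size (p`_i).
apply: leq_trans (leq_bigmax (F := F) (Ordinal lt)) _.
by rewrite -(leq_add2l a); apply: leq_trans le; rewrite leq_add2r ltnW.
Qed.

Definition dpoly d (f : nat -> nat -> T) : {poly {poly T}} :=
  \poly_(a < d) \poly_(b < d) f a b.

Lemma coef_dpoly d f a b :
  (forall a b, (d <= a)%N || (d <= b)%N -> f a b = 0) -> (dpoly d f)`_a`_b = f a b.
Proof.
move=> h; rewrite coef_poly; case: ltnP => [lt|ge]; last by rewrite coef0 h ?ge.
by rewrite coef_poly; case: ltnP => // ge; rewrite h ?ge ?orbT.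
Qed.

Lemma coef_CCM D p a b : (D%:P%:P * p)`_a`_b = D * p`_a`_b.
Proof. by rewrite !coefCM. Qed.

Lemma coef_XuM u p a b :
  (('X%:P) ^+ u * p)`_a`_b = if (b < u)%N then 0 else p`_a`_(b - u).
Proof. by rewrite -polyC_exp coefCM coefXnM. Qed.

Lemma coef_XtM t p a b :
  ('X^t * p)`_a`_b = if (a < t)%N then 0 else p`_(a - t)`_b.
Proof. by rewrite coefXnM; case: ifP => // _; rewrite coef0. Qed.

(* The leading forms [D t^n] and [D u^n] of F and G are coprime up to [D]. *)
Lemma coprime_leading_forms D n F1 G1 W V :
  tdeg_lt n F1 -> tdeg_lt n G1 ->
  let F := D%:P%:P * 'X^n + F1 in let G := D%:P%:P * 'X%:P ^+ n + G1 in
  G * W = F * V -> exists k Q, (D ^+ k)%:P%:P * W = F * Q.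
Proof.
move=> hF1 hG1 F G.
have cF X a b : (F * X)`_a`_b =
    D * (if (a < n)%N then 0 else X`_(a - n)`_b) + (F1 * X)`_a`_b.
  by rewrite /F mulrDl -mulrA !coefD coef_CCM coef_XtM.
have cG X a b : (G * X)`_a`_b =
    D * (if (b < n)%N then 0 else X`_a`_(b - n)) + (G1 * X)`_a`_b.
  by rewrite /G mulrDl -mulrA !coefD coef_CCM coef_XuM.
have [d1 h1] := tdeg_ltP W; have [d2 h2] := tdeg_ltP V.
have := tdeg_ltW (leq_maxl d1 d2) h1; have := tdeg_ltW (leq_maxr d1 d2) h2.
elim: (maxn d1 d2) W V {h1 h2} => [|d IH] W V hV hW e.
  exists 0%N, 0; rewrite mulr0; apply/polyP=> a; rewrite coef0; apply/polyP=> b.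
  by rewrite coef_CCM hW ?coef0 ?mulr0.
have F1V := tdeg_ltM hF1 hV; have G1W := tdeg_ltM hG1 hW.
(* In total degree n + d and above, [F1] and [G1] contribute nothing, so the top forms satisfy D u^n
   W = D t^n V. *)
have key a b : (n + d <= a + b)%N ->
    D * (if (b < n)%N then 0 else W`_a`_(b - n)) =
    D * (if (a < n)%N then 0 else V`_(a - n)`_b).
  move=> le; have := congr1 (fun p => p`_a`_b) e.
  rewrite cF cG.
  by rewrite (F1V a b le) (G1W a b le) !addr0.
(* By [key], D times the top form of [W] is divisible by t^n; [q] lists the coefficients of the
   quotient. Subtracting F Q from D^2 W and G Q from D^2 V lowers both degrees and keeps the
   relation. *)
pose q a b := if (a + b + n == d)%N then D * W`_(a + n)`_b else 0.
have hq a b : (d.+1 <= a)%N || (d.+1 <= b)%N -> q a b = 0.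
  rewrite /q; case: eqP => // <-; rewrite -addnA ltnNge leq_addr /=.
  by rewrite addnCA ltnNge leq_addr.
pose Q := dpoly d.+1 q.
have cQ a b : Q`_a`_b = q a b by rewrite coef_dpoly.
have hQ X1 : tdeg_lt n X1 -> tdeg_lt d (X1 * Q).
  move=> hX1; have [le|lt] := leqP n d.
    rewrite -(subnKC le); apply: tdeg_ltM => // a b; rewrite cQ /q.
    by case: eqP => // <-; rewrite addnK ltnn.
  suff -> : Q = 0 by rewrite mulr0; apply: tdeg_lt0.
  apply/polyP=> a; rewrite coef0; apply/polyP=> b; rewrite cQ coef0 /q.
  by case: eqP => // h; move: lt; rewrite -h ltnNge leq_addl.
have hW1 : tdeg_lt d ((D * D)%:P%:P * W - F * Q).
  move=> a b le; rewrite !coefB coef_CCM cF.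
  rewrite (hQ _ hF1 a b le) addr0 cQ /q.
  move: le; rewrite leq_eqVlt => /predU1P[ab|lt]; last first.
    rewrite hW // mulr0; case: ltnP => lt2; first by rewrite mulr0 subrr.
    by rewrite addnAC subnK // gtn_eqF // mulr0 subrr.
  have := key a (b + n)%N; rewrite addnK ltnNge leq_addl /= addnC ab addnA addnC.
  move=> /(_ (leqnn _)) eW; case: ltnP => lt.
    by rewrite lt in eW; rewrite -mulrA eW !mulr0 subrr.
  by rewrite addnAC subnK // -ab eqxx mulrA subrr.
have hV1 : tdeg_lt d ((D * D)%:P%:P * V - G * Q).
  move=> a b le; rewrite !coefB coef_CCM cG.
  rewrite (hQ _ hG1 a b le) addr0 cQ /q.
  move: le; rewrite leq_eqVlt => /predU1P[ab|lt]; last first.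
    rewrite hV // mulr0; case: ltnP => lt2; first by rewrite mulr0 subrr.
    by rewrite -addnA subnK // gtn_eqF // mulr0 subrr.
  have := key (a + n)%N b; rewrite addnK [(a + n < n)%N]ltnNge leq_addl /= ab addnAC addnC.
  move=> /(_ (leqnn _)) eV; case: ltnP => lt.
    by rewrite lt in eV; rewrite -mulrA -eV !mulr0 subrr.
  rewrite -addnA subnK // -ab eqxx.
  by rewrite ltnNge lt /= in eV; rewrite eV mulrA subrr.
have [|k [Q' hQ']] := IH _ _ hV1 hW1.
  have -> : G * ((D * D)%:P%:P * W - F * Q) = (D * D)%:P%:P * (G * W) - F * G * Q by ring.
  by rewrite e; ring.
exists (k + 2)%N, (Q' + (D ^+ k)%:P%:P * Q).
rewrite mulrDr -hQ' exprD expr2 !polyCM; ring.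
Qed.

(** The leading form is [D] times a monomial, so [D] sends the top form of [W] into [I]. Removing
    that form from D W lowers the degree, at the price of one power of [D] per step. *)
Lemma leading_form_ideal (I : T -> Prop) D s t F1 W : ideal I ->
  tdeg_lt (s + t) F1 ->
  (forall a b, I ((D%:P%:P * ('X^s * 'X%:P ^+ t) + F1) * W)`_a`_b) ->
  exists k, forall a b, I (D ^+ k * W`_a`_b).
Proof.
move=> idI hF1; set F := _ + F1; have [d] := tdeg_ltP W.
elim: d W => [|d IH] W hW hI.
  by exists 0%N => a b; rewrite hW // mulr0; apply: ideal0.
have top a b : (a + b = d)%N -> I (D * W`_a`_b).
  move=> ab; have := hI (a + s)%N (b + t)%N; rewrite mulrDl -!mulrA !coefD coef_CCM.
  rewrite coef_XtM coef_XuM !addnK 2!ltnNge !leq_addl /=.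
  by rewrite (tdeg_ltM hF1 hW) ?addr0 // addnACA ab addnC.
pose q a b := if (a + b == d)%N then D * W`_a`_b else 0.
have hq a b : (d.+1 <= a)%N || (d.+1 <= b)%N -> q a b = 0.
  by rewrite /q; case: eqP => // <-; rewrite 2!ltnNge leq_addr leq_addl.
pose Q := dpoly d.+1 q.
have cQ a b : Q`_a`_b = q a b by rewrite coef_dpoly.
have Iq a b : I (q a b) by rewrite /q; case: eqP => [/top//|_]; apply: ideal0.
have [||k hk] := IH (D%:P%:P * W - Q).
- move=> a b le; rewrite !coefB coef_CCM cQ /q.
  move: le; rewrite leq_eqVlt => /predU1P[->|lt]; first by rewrite eqxx subrr.
  by rewrite gtn_eqF // hW // mulr0 subr0.
- move=> a b; rewrite mulrBr mulrCA !coefB coef_CCM; apply: (idealB idI).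
    exact: (idealMl idI).
  rewrite coefM coef_sum; apply: (ideal_sum idI) => i _.
  rewrite coefM; apply: (ideal_sum idI) => l _.
  by rewrite cQ; apply: (idealMl idI).
exists k.+1 => a b; have := hk a b; rewrite !coefB coef_CCM cQ mulrBr => h.
rewrite exprSr -mulrA -[X in I X](subrK (D ^+ k * q a b)).
by apply: (idealD idI) => //; apply: (idealMl idI).
Qed.

End TotalDegree.

(** * Maximal minors of the generic combinations *)

Lemma mpoly_coef_ideal (R : comNzRingType) N (I : R -> Prop) :
  ideal I -> ideal (fun p : mpoly N R => forall m, I (p@_m)).
Proof.
move=> idI; split=> [m|p q hp hq m|p q hq m].
- by rewrite mcoeff0; apply: ideal0.
- by rewrite mcoeffD; apply: idealD.
- by rewrite mcoeffM; apply: (ideal_sum idI) => i _; apply: (idealMl idI).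
Qed.

Section GenericMinors.
Variables (R : comNzRingType) (r n : nat) (A : 'M[R]_(r, n.+1)).
Local Notation T := (mpoly (r * n) R).
Local Notation P := {poly {poly T}}.

Definition generic_mx : 'M[T]_(n, r) := \matrix_(j, i) 'X_(mxvec_index i j).
Definition generic_rows : 'M[T]_(n, n.+1) :=
  generic_mx *m map_mx (@mpolyC (r * n) R) A.
Definition generic_minor (k : 'I_n.+1) : T := \det (col' k generic_rows).

Section Shift.
Variable rho : 'I_n.+1 -> 'I_r.

Let D := \det (rowsub rho A).
(** A left inverse of [A] up to the factor [D], by Cramer's rule on the rows chosen by [rho]. *)
Let C : 'M_(n.+1, r) := \adj (rowsub rho A) *m rowsub rho 1%:M.

Let CA : C *m A = D%:M.
Proof. by rewrite /C -mulmxA mul_rowsub_mx mul1mx mul_adj_mx. Qed.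

Let iota : {rmorphism R -> P} := polyC \o polyC \o @mpolyC (r * n) R.
Let cst : {rmorphism T -> P} := polyC \o polyC.

(* The substitution [Z |-> Z + N C] moves [Z A] to [Z A + D N], so that the     *)
(* two extreme minors get the leading forms [D^n t^n] and [D^n u^n].            *)
Let N : 'M[P]_(n, n.+1) :=
  \matrix_(j, l) ('X *+ (l == j :> nat) + 'X%:P *+ (l == j.+1 :> nat)).
Let pert : 'M[P]_(r, n) := (N *m map_mx iota C)^T.
Let image k : P := cst 'X_k + mxvec pert 0 k.
Let shift : {rmorphism T -> P} := mmap iota image.

Let shiftE p : shift p = \sum_(k <- msupp p) iota p@_k * mmap1 image k.
Proof. by []. Qed.

Let shift_rows : map_mx shift generic_rows = map_mx cst generic_rows + iota D *: N.
Proof.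
rewrite /generic_rows !map_mxM -!map_mx_comp /=.
have eA : map_mx (shift \o @mpolyC _ _) A = map_mx iota A.
  by apply/matrixP=> i j; rewrite !mxE /= mmapC.
have eA' : map_mx (cst \o @mpolyC _ _) A = map_mx iota A by [].
rewrite [in LHS]eA [in RHS]eA'.
have -> : map_mx shift generic_mx = map_mx cst generic_mx + N *m map_mx iota C.
  apply/matrixP=> j i; rewrite !mxE /= mmapX mmap1U /image mxvecE mxE.
  by rewrite mxE.
rewrite mulmxDl; congr (_ + _).
by rewrite -mulmxA -map_mxM CA map_scalar_mx mul_mx_scalar.
Qed.

(** Setting t = u = 0 undoes the substitution, so divisibility found after the shift specializes
    back. *)
Let shift0 p : (shift p)`_0`_0 = p.
Proof.
pose ev : {rmorphism P -> T} := coefp 0 \o coefp 0.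
have evE (q : P) : q`_0`_0 = ev q by [].
rewrite evE shiftE rmorph_sum [RHS]mpolyE; apply: eq_bigr => k _.
rewrite rmorphM -evE !coefC /= -mul_mpolyC; congr (_ * _).
rewrite mpolyXE_id evE /mmap1 rmorph_prod; apply: eq_bigr => i _.
rewrite rmorphXn; congr (_ ^+ _); rewrite /image rmorphD -!evE !coefC /=.
rewrite -[RHS]addr0; congr (_ + _).
case/mxvec_indexP: i => i j; rewrite mxvecE !mxE coef_sum coef_sum big1 // => l _.
rewrite evE rmorphM mxE rmorphD !rmorphMn -!evE.
have -> : ('X : P)`_0`_0 = 0 by rewrite coefX coef0.
have -> : ('X%:P : P)`_0`_0 = 0 by rewrite coefC coefX.
by rewrite !mul0rn addr0 mul0r.
Qed.

Let shift_ideal (I : R -> Prop) p : ideal I -> (forall m, I (p@_m)) ->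
  forall a b m, I (((shift p)`_a`_b)@_m).
Proof.
move=> idI hp a b; have idT := mpoly_coef_ideal (r * n) idI.
rewrite shiftE !coef_sum; apply: (ideal_sum idT) => k _.
rewrite /= !coefCM; apply: (idealMr idT) => m.
by rewrite mcoeffC; apply: (idealMr idI).
Qed.

Let dn : T := (D ^+ n)%:MP.

Let tdeg_lt_N k i j : tdeg_lt 2 (col' k (iota D *: N) i j).
Proof.
rewrite !mxE -(add1n 1); apply: tdeg_ltM; first exact: tdeg_ltC.
apply: tdeg_ltD; case: (_ == _); rewrite ?mulr0n ?mulr1n.
- exact: tdeg_ltX.
- exact: tdeg_lt0.
- exact: tdeg_ltXC.
- exact: tdeg_lt0.
Qed.

Let shift_minor_det k : exists2 F1, tdeg_lt n F1 &
  shift (generic_minor k) = dn%:P%:P * \det (col' k N) + F1.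
Proof.
have eD : dn%:P%:P = iota D ^+ n by rewrite -rmorphXn.
pose X := col' k (map_mx cst generic_rows); pose Y := col' k (iota D *: N).
exists (\det (X + Y) - \det Y).
  apply: tdeg_lt_det_perturb => i j; last exact: tdeg_lt_N.
  by rewrite !mxE; apply: tdeg_ltC.
have -> : \det Y = dn%:P%:P * \det (col' k N).
  by rewrite eD -detZ; congr (\det _); apply/matrixP=> i j; rewrite !mxE.
rewrite addrC subrK /generic_minor -det_map_mx; congr (\det _).
apply/matrixP=> i j; have := congr1 (fun M : 'M_(_, _) => M i (lift k j)) shift_rows.
by rewrite [in LHS]mxE => e; rewrite [LHS]mxE [col' k _ i j]mxE e !mxE.
Qed.

Let det_N_last : \det (col' ord_max N) = 'X ^+ n.
Proof.
have lo (j : 'I_n) : (lift ord_max j : nat) = j by exact: lift_max.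
rewrite -det_tr det_trig.
  rewrite (eq_bigr (fun=> 'X)) ?prodr_const ?card_ord // => i _.
  by rewrite !mxE lo eqxx ltn_eqF // addr0.
apply/is_trig_mxP=> i j lt; rewrite !mxE lo ltn_eqF // ltn_eqF ?addr0 //.
by rewrite ltnS ltnW.
Qed.

Let det_N_first : \det (col' ord0 N) = 'X%:P ^+ n.
Proof.
have lo (j : 'I_n) : (lift ord0 j : nat) = j.+1 by [].
rewrite det_trig.
  rewrite (eq_bigr (fun=> 'X%:P)) ?prodr_const ?card_ord // => i _.
  by rewrite !mxE lo eqxx gtn_eqF // add0r.
apply/is_trig_mxP=> i j lt; rewrite !mxE lo gtn_eqF ?ltnS 1?ltnW // eqSS gtn_eqF //.
by rewrite addr0.
Qed.

(** Deleting an extreme column leaves [N] triangular, so after the shift these two minors have a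
    monomial leading form with coefficient D^n; hence the exponent n * K. *)
Lemma generic_minor_ideal_local (I : R -> Prop) k w : ideal I ->
  k = ord0 \/ k = ord_max -> (forall m, I ((generic_minor k * w)@_m)) ->
  exists K, forall m, I (((D ^+ K)%:MP * w)@_m).
Proof.
move=> idI hk hw; have idT := mpoly_coef_ideal (r * n) idI.
have [F1 hF1 eF] := shift_minor_det k.
have [s [t [st ek]]] : exists s t, (s + t)%N = n /\ \det (col' k N) = 'X^s * 'X%:P ^+ t.
  case: hk => ->; [exists 0%N, n | exists n, 0%N].
    by rewrite expr0 mul1r det_N_first.
  by rewrite addn0 expr0 mulr1 det_N_last.
have hF1' : tdeg_lt (s + t) F1 by rewrite st.
rewrite ek in eF.
have [|K hK] := @leading_form_ideal _ _ dn s t F1 (shift w) idT hF1'.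
  by move=> a b; rewrite -eF -rmorphM; apply: shift_ideal.
by exists (n * K)%N; have := hK 0%N 0%N; rewrite shift0 /dn -rmorphXn exprM.
Qed.

Lemma generic_minor_coprime_local V W :
  generic_minor ord0 * W = generic_minor ord_max * V ->
  exists K Q, (D ^+ K)%:MP * W = generic_minor ord_max * Q.
Proof.
have [F1 hF1 eF] := shift_minor_det ord_max.
have [G1 hG1 eG] := shift_minor_det ord0.
rewrite det_N_last in eF; rewrite det_N_first in eG.
move=> /(congr1 shift); rewrite !rmorphM eF eG.
move=> /(coprime_leading_forms hF1 hG1)[K [Q hQ]].
exists (n * K)%N, (Q`_0`_0); have := congr1 (fun p : P => p`_0`_0) hQ.
by rewrite coef_CCM shift0 -eF coef0M coef0M shift0 /dn -rmorphXn -exprM.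
Qed.

End Shift.
End GenericMinors.

(** * From a single maximal minor to the radical of all of them *)

Section RadicalIdeal.
Variables (R T : comPzRingType) (phi : {rmorphism R -> T}) (I : T -> Prop) (w : T).
Hypothesis idI : ideal I.

(** This is the preimage of the radical of (I : w). Once it contains every maximal minor of [A], it
    contains each [c] satisfying [minors_radical]. *)
Lemma radical_colon_ideal : ideal (fun d => exists k, I (phi d ^+ k * w)).
Proof.
have up d k l : (k <= l)%N -> I (phi d ^+ k * w) -> I (phi d ^+ l * w).
  by move=> /subnK <- h; rewrite exprD -mulrA; apply: idealMl.
split=> [|x y [k hk] [l hl]|a x [k hk]].
- by exists 1%N; rewrite rmorph0 mul0r; apply: ideal0.
- exists (k + l)%N; rewrite rmorphD exprDn mulr_suml; apply: ideal_sum => // i _.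
  rewrite mulrnAl -mulr_natl; apply: (idealMl idI).
  have [le|lt] := leqP l i.
    by rewrite -mulrA; apply: (idealMl idI); apply: up le _.
  rewrite mulrAC; apply: (idealMr idI); apply: up hk.
  by rewrite leq_subRL ?(leq_trans (ltnW lt)) ?leq_addl // addnC leq_add2l ltnW.
- by exists k; rewrite rmorphM exprMn -mulrA; apply: idealMl.
Qed.

Lemma radical_colon_radical x n :
  (exists k, I (phi (x ^+ n) ^+ k * w)) -> exists k, I (phi x ^+ k * w).
Proof. by move=> [k hk]; exists (n * k)%N; rewrite exprM -rmorphXn. Qed.
End RadicalIdeal.

Section RegularMinors.
Variables (R : comNzRingType) (r n : nat) (A : 'M[R]_(r, n.+1)).
Local Notation T := (mpoly (r * n) R).
Local Notation C := (@mpolyC (r * n) R).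

(** Membership in the radical of the ideal of maximal minors, phrased as an elimination principle
    for direct use on radical colon ideals. *)
Definition minors_radical c := forall H : R -> Prop, ideal H ->
  (forall x k, H (x ^+ k) -> H x) ->
  (forall rho : 'I_n.+1 -> 'I_r, H (\det (rowsub rho A))) -> H c.

Lemma generic_minor_ideal (I : R -> Prop) c k (w : T) :
  minors_radical c -> ideal I -> k = ord0 \/ k = ord_max ->
  (forall m, I ((generic_minor A k * w)@_m)) ->
  exists K, forall m, I ((C c ^+ K * w)@_m).
Proof.
move=> radc idI hk hw; have idT := mpoly_coef_ideal (r * n) idI.
apply: (radc (fun d => exists K, forall m, I ((C d ^+ K * w)@_m))).
- exact: (radical_colon_ideal C w idT).
- exact: (radical_colon_radical (phi := C) (I := fun p => forall m, I p@_m)).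
move=> rho; have [K hK] := generic_minor_ideal_local rho idI hk hw.
by exists K; rewrite -rmorphXn.
Qed.

Lemma generic_minor_coprime c (V W : T) : minors_radical c ->
  generic_minor A ord0 * W = generic_minor A ord_max * V ->
  exists K Q, C c ^+ K * W = generic_minor A ord_max * Q.
Proof.
move=> radc e; pose I p := exists Q, p = generic_minor A ord_max * Q.
have idI : ideal I.
  split=> [|_ _ [p ->] [q ->]|a _ [p ->]].
  - by exists 0; rewrite mulr0.
  - by exists (p + q); rewrite mulrDr.
  - by exists (a * p); rewrite mulrCA.
apply: (radc (fun d => exists K, I (C d ^+ K * W))).
- exact: (radical_colon_ideal C W idI).
- exact: (radical_colon_radical (phi := C) (I := I)).
move=> rho; have [K hK] := generic_minor_coprime_local rho e.
by exists K; rewrite -rmorphXn.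
Qed.

Lemma mpolyC_dvd c (p : T) :
  (forall m, exists u, p@_m = c * u) -> exists q, p = C c * q.
Proof.
move=> /choice[u hu]; exists (\sum_(m <- msupp p) u m *: 'X_[m]).
rewrite {1}[p]mpolyE mulr_sumr; apply: eq_bigr => m _.
by rewrite hu -scalerA mul_mpolyC.
Qed.

Lemma nzd_mpolyC c : nonzerodivisor c -> nonzerodivisor (C c).
Proof.
move=> nz p h; apply/mpolyP=> m; rewrite mcoeff0; apply: nz.
by rewrite -mcoeffCM h mcoeff0.
Qed.

Lemma regular_pair_mpolyC c d : regular_pair c d -> regular_pair (C c) (C d).
Proof.
move=> [nzc cd]; split=> [|w v e]; first exact: nzd_mpolyC.
by apply: mpolyC_dvd => m; apply: (cd _ (v@_m)); rewrite -!mcoeffCM e.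
Qed.

Variables c1 c2 : R.
Hypotheses (rad1 : minors_radical c1) (rad2 : minors_radical c2).
Hypotheses (reg12 : regular_pair c1 c2) (nz2 : nonzerodivisor c2).
Local Notation Dmax := (generic_minor A ord_max).
Local Notation D0 := (generic_minor A ord0).

Lemma nzd_generic_minor k : k = ord0 \/ k = ord_max ->
  nonzerodivisor (generic_minor A k).
Proof.
move=> hk w e.
have id0 : ideal (fun x : R => x = 0).
  by split=> // [x y -> ->|a x ->]; rewrite ?addr0 ?mulr0.
have [|K hK] := generic_minor_ideal rad1 id0 hk (w := w).
  by move=> m; rewrite e mcoeff0.
apply: (nzdX (n := K) (nzd_mpolyC reg12.1)); apply/mpolyP=> m.
by rewrite hK mcoeff0.
Qed.

(** If [c] divides the minor times w, then it divides some d^K w; as c, d^K is a regular pair, [c]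
    divides w. *)
Lemma regular_pair_generic_minor k c d : k = ord0 \/ k = ord_max ->
  regular_pair c d -> nonzerodivisor d -> minors_radical d ->
  regular_pair (C c) (generic_minor A k).
Proof.
move=> hk cd nzd radd; split=> [|w v e]; first exact: nzd_mpolyC cd.1.
have idc : ideal (fun x => exists u, x = c * u).
  split=> [|_ _ [p ->] [q ->]|a _ [p ->]].
  - by exists 0; rewrite mulr0.
  - by exists (p + q); rewrite mulrDr.
  - by exists (a * p); rewrite mulrCA.
have [|K hK] := generic_minor_ideal radd idc hk (w := w).
  by move=> m; exists (v@_m); rewrite e mcoeffCM.
have [q hq] := mpolyC_dvd hK.
have [_ h] := regular_pairXX 1 K (regular_pair_mpolyC cd) (nzd_mpolyC nzd).
by have [u] := h _ _ hq; exists u.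
Qed.

(** Coprimality holds up to a power of c1 and up to a power of c2. Comparing c1^K W = Dmax Q with
    c2^L W = Dmax Q' shows that c1^K divides [Q], and c1^K cancels. *)
Lemma generic_minors_regular : regular_pair Dmax D0.
Proof.
have nzmax : nonzerodivisor Dmax by apply: nzd_generic_minor; right.
split=> // W V e.
have [K [Q hQ]] := generic_minor_coprime rad1 e.
have [L [Q' hQ']] := generic_minor_coprime rad2 e.
have [nzK h] := regular_pairXX K L (regular_pair_mpolyC reg12) (nzd_mpolyC nz2).
have [|U hU] := h Q Q'.
  by apply: (nzdI nzmax); rewrite mulrCA -hQ [RHS]mulrCA -hQ'; ring.
by exists U; apply: (nzdI nzK); rewrite hQ hU mulrCA.
Qed.

(** The factors are needed because the Bourbaki ideal is only known to contain minors multiplied by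
    elements of (E : G). *)
Lemma scaled_generic_minors_regular : regular_pair (C c1 * Dmax) (C c2 * D0).
Proof.
have nzmax : nonzerodivisor Dmax by apply: nzd_generic_minor; right.
have nz1 := nzd_mpolyC reg12.1.
split=> [|W V e]; first exact: nzdM.
have [W1 hW1] : exists W1, W = C c1 * W1.
  have [_ h] := regular_pair_mpolyC reg12.
  have [|W0 hW0] := h (D0 * W) (Dmax * V); first by rewrite !mulrA.
  have [|_ h'] := @regular_pair_generic_minor ord0 c1 c2 _ reg12 nz2 rad2; first by left.
  exact: h' hW0.
have [V1 hV1] : exists V1, V = C c2 * V1.
  have reg21 := regular_pair_sym reg12 nz2.
  have [|_ h'] := @regular_pair_generic_minor ord_max c2 c1 _ reg21 reg12.1 rad1.
    by right.
  apply: (h' V (D0 * W1)); apply: (nzdI nz1).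
  by rewrite mulrA -e hW1; ring.
have [U hU] : exists U, W1 = Dmax * U.
  apply: (generic_minors_regular.2 W1 V1); apply: (nzdI nz1).
  apply: (nzdI (nzd_mpolyC nz2)); move: e; rewrite hW1 hV1 => e.
  transitivity (C c2 * D0 * (C c1 * W1)); first by ring.
  by rewrite e; ring.
by exists U; rewrite hW1 hU mulrA.
Qed.

End RegularMinors.

(** * The Nagata extension *)

Section LocalizationMap.
Variables (T S : comPzRingType) (L : {rmorphism T -> S}) (den : T -> Prop).
Hypotheses (den1 : den 1) (denM : forall s t, den s -> den t -> den (s * t)).
Hypothesis den_unit : forall s, den s -> exists y, L s * y = 1.
Hypothesis den_frac : forall x, exists s p, den s /\ L s * x = L p.
Hypothesis den_ker : forall p, L p = 0 -> exists2 s, den s & s * p = 0.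

Lemma den_cancel s x y : den s -> L s * x = L s * y -> x = y.
Proof.
move=> /den_unit[z hz] e.
by rewrite -[x]mul1r -[y]mul1r -hz -!(mulrC z) -!mulrA e.
Qed.

Lemma den_frac2 x y : exists s p q, [/\ den s, L s * x = L p & L s * y = L q].
Proof.
have [s [p [ds e]]] := den_frac x; have [t [q [dt f]]] := den_frac y.
exists (s * t), (t * p), (s * q); split; first exact: denM.
  by rewrite !rmorphM -e; ring.
by rewrite !rmorphM -f; ring.
Qed.

Lemma den_frac_row N (v : 'rV[S]_N) :
  exists s (p : 'rV[T]_N), den s /\ L s *: v = map_mx L p.
Proof.
have /choice[s hs] := fun i => den_frac (v 0 i).
have /choice[p hp] := hs.
pose d := \prod_i s i; pose d' i := \prod_(j | j != i) s j.
exists d, (\row_i (d' i * p i)); split.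
  by rewrite /d; elim/big_ind: _ => // i _; have [] := hp i.
apply/rowP=> i; rewrite !mxE /d (bigD1 i) //= !rmorphM /=.
have [_ <-] := hp i; rewrite -/(d' i); ring.
Qed.

Lemma den_ker_row N (p : 'rV[T]_N) :
  map_mx L p = 0 -> exists2 s, den s & s *: p = 0.
Proof.
move=> h; have /choice[s hs] : forall i, exists s, den s /\ s * p 0 i = 0.
  move=> i; have [|s] := den_ker (p := p 0 i); last by exists s.
  by move/rowP/(_ i): h; rewrite !mxE.
exists (\prod_i s i).
  by elim/big_ind: _ => // i _; have [] := hs i.
apply/rowP=> i; rewrite !mxE (bigD1 i) //= mulrAC.
by have [_ ->] := hs i; rewrite mul0r.
Qed.

Lemma nzd_loc p : nonzerodivisor p -> nonzerodivisor (L p).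
Proof.
move=> nz x e; have [s [q [ds hq]]] := den_frac x.
have [|t dt ht] := den_ker (p := p * q).
  by rewrite rmorphM -hq mulrCA e mulr0.
apply: (den_cancel ds); apply: (den_cancel dt); rewrite !mulr0 hq -rmorphM.
by rewrite (nz (t * q)) ?rmorph0 // mulrCA.
Qed.

Lemma regular_pair_loc p q : regular_pair p q -> regular_pair (L p) (L q).
Proof.
move=> [nz pq]; split=> [|w v e]; first exact: nzd_loc.
have [s [w' [v' [ds hw hv]]]] := den_frac2 w v.
have [|t dt ht] := den_ker (p := q * w' - p * v').
  by rewrite rmorphB !rmorphM -hw -hv mulrCA e mulrCA subrr.
have [|u hu] := pq (t * w') (t * v').
  by apply/subr0_eq; rewrite -ht mulrBr; ring.
have [y hy] := den_unit (denM ds dt).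
exists (y * L u); apply: (den_cancel (denM ds dt)).
transitivity (L (p * u)); first by rewrite -hu !rmorphM -hw; ring.
by rewrite rmorphM -[LHS]mulr1 -hy; ring.
Qed.

End LocalizationMap.

Section Nagata.
Variables (R : comNzRingType) (noethR : noetherian R) (m : R -> Prop).
Hypothesis localR : local_ring m.
Variables (n r : nat).
Local Notation T := (mpoly (r * n) R).
Local Notation S := (nagata m n.+1 r).
Local Notation L := (@nagata_loc R m n.+1 r).
Local Notation phi := (@nagata_map R m n.+1 r).
Local Notation ext := (@extended_ideal R m n.+1 r).

Let idm : ideal m := local_ideal localR.

Lemma extended_idealP (p : T) : ext p <-> forall k, m (p@_k).
Proof.
split=> [|h].
  elim=> [|a _ y [c mc ->] _ IH]; first by move=> k; rewrite mcoeff0; apply: ideal0.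
  move=> k; rewrite mcoeffD; apply: (idealD idm) => //.
  by rewrite [_ *: _]mulrC mcoeffCM; apply: (idealMr idm).
rewrite [p]mpolyE; have idE := ideal_gen_ideal (fun q : T => exists2 c, m c & q = c%:MP).
apply: (ideal_sum idE) => k _; rewrite -mul_mpolyC; apply: (idealMr idE).
by apply: submod_genS; exists p@_k.
Qed.

Lemma extended_proper (p : T) : ~ ext p -> exists k, ~ m (p@_k).
Proof.
move=> h; apply: contrapT => no; apply/h/extended_idealP => k.
by apply: contrapT => mk; apply: no; exists k.
Qed.

(** Dropping the coefficients in [m] ensures that the leading coefficient, if nonzero, lies outside
    [m]. Primality of the extended ideal then follows by multiplying leading coefficients. *)
Lemma unit_part (p : T) : exists q : T, (forall k, m ((p - q)@_k)) /\
  forall k, m (q@_k) -> q@_k = 0.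
Proof.
pose c k : R := if `[< m p@_k >] then 0 else p@_k.
exists (\sum_(k <- msupp p) c k *: 'X_[k]).
have cE k : (\sum_(k <- msupp p) c k *: 'X_[k])@_k = c k.
  rewrite raddf_sum /=; have [kp|kp] := boolP (k \in msupp p).
    rewrite (bigD1_seq k) ?msupp_uniq //= mcoeffZ mcoeffX eqxx mulr1.
    by rewrite big1 ?addr0 // => l /negbTE lk; rewrite mcoeffZ mcoeffX lk mulr0.
  have -> : c k = 0 by rewrite /c memN_msupp_eq0 //; case: ifP.
  rewrite big_seq big1 // => l lp; rewrite mcoeffZ mcoeffX.
  by case: eqP => [lk|_]; [rewrite lk (negbTE kp) in lp | rewrite mulr0].
split=> k; first rewrite mcoeffB; rewrite cE /c; case: asboolP => //.
  by rewrite subr0.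
by move=> _; rewrite subrr; apply: ideal0.
Qed.

Lemma extended_prime (p q : T) : ~ ext p -> ~ ext q -> ~ ext (p * q).
Proof.
move=> hp hq /extended_idealP hpq; have idT := mpoly_coef_ideal (r * n) idm.
have [p' [pp' p'0]] := unit_part p; have [q' [qq' q'0]] := unit_part q.
have nz (s s' : T) : ~ ext s -> (forall k, m ((s - s')@_k)) ->
    (forall k, m (s'@_k) -> s'@_k = 0) -> ~ m (mleadc s').
  move=> hs ss' s'0 /s'0 /eqP; rewrite mleadc_eq0 => /eqP z; apply: hs.
  by apply/extended_idealP => k; have := ss' k; rewrite z subr0.
have : m ((p' * q')@_(mlead p' + mlead q')).
  have -> : p' * q' = p * q - ((p - p') * q + p' * (q - q')) by ring.
  apply: (idealB idT) => //; apply: (idealD idT).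
    exact: (idealMr idT).
  exact: (idealMl idT).
by rewrite mleadcM => /(local_prime noethR localR)[]; [apply: (nz p) | apply: (nz q)].
Qed.

Lemma extended_den (s : T) : mul_closure (fun p => ~ ext p) s -> ~ ext s.
Proof.
elim=> [|p q hp _ hq]; last exact: extended_prime.
by move/extended_idealP/(_ 0%MM); rewrite mcoeff1 eqxx; apply: (local_proper localR).
Qed.

Definition nagata_den (s : T) := ~ ext s.

Lemma nagata_den1 : nagata_den 1.
Proof. exact/extended_den/mul_closure1. Qed.

Lemma nagata_denM (s t : T) : nagata_den s -> nagata_den t -> nagata_den (s * t).
Proof. exact: extended_prime. Qed.

Lemma nagata_den_unit s : nagata_den s -> exists y, L s * y = 1.
Proof.
move=> hs; exists (loc_frac 1 (mul_closureS hs : mul_closure (fun p => ~ ext p) s)).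
rewrite -[_ * _]/(loc_mul _ _) loc_mulE -[RHS]/(loc_frac 1 (mul_closure1 _)).
by apply: loc_eq_frac; ring.
Qed.

Lemma nagata_den_frac x : exists s p, nagata_den s /\ L s * x = L p.
Proof.
have [p [s [hs ->]]] := loc_surj x; exists s, p; split; first exact: extended_den.
rewrite -[LHS]/(loc_mul _ _) loc_mulE; apply: loc_eq_frac; ring.
Qed.

Lemma nagata_den_ker p : L p = 0 -> exists2 s, nagata_den s & s * p = 0.
Proof.
move=> h; pose c1 := mul_closure1 (fun p => ~ ext p).
have /loc_frac_eq[s hs e] : loc_frac p c1 = loc_frac 0 c1 := h.
by exists s; [exact: extended_den | rewrite mulr1 mul0r mulr0 in e].
Qed.

Definition nagata_frac_row := den_frac_row nagata_den1 nagata_denM nagata_den_frac.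
Definition nagata_ker_row := den_ker_row nagata_den1 nagata_denM nagata_den_ker.

(** A denominator has a coefficient outside [m], hence a unit; reading the relation at that monomial
    gives x = y. *)
Lemma nagata_map_inj : injective phi.
Proof.
move=> x y /eqP; rewrite -subr_eq0 -rmorphB => /eqP /nagata_den_ker[s hs e].
have [k /(local_unit noethR localR)[z hz]] := extended_proper hs.
have := congr1 (mcoeff k) e; rewrite mulrC mcoeffCM mcoeff0 => e'.
by apply/subr0_eq; rewrite -[_ - _]mul1r -hz mulrAC (mulrC _ (x - y)) e' mul0r.
Qed.

Lemma nzd_nagata_map c : nonzerodivisor c -> nonzerodivisor (phi c).
Proof.
move=> /(@nzd_mpolyC _ r n) nz.
exact: (nzd_loc nagata_den_unit nagata_den_frac nagata_den_ker nz).
Qed.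

Lemma regular_pair_nagata (p q : T) : regular_pair p q -> regular_pair (L p) (L q).
Proof.
exact: (regular_pair_loc nagata_denM nagata_den_unit nagata_den_frac nagata_den_ker).
Qed.

Definition nagata_max (x : S) : Prop :=
  exists s p, [/\ nagata_den s, ext p & L s * x = L p].

Lemma nagata_max_ideal : ideal nagata_max.
Proof.
have idE := ideal_gen_ideal (fun q : T => exists2 c, m c & q = c%:MP).
split=> [|x y [s [p [ds ep e]]] [t [q [dt eq f]]]|a x [s [p [ds ep e]]]].
- by exists 1, 0; split; [exact: nagata_den1 | exact: ideal0 | rewrite mulr0 rmorph0].
- exists (s * t), (t * p + s * q); split; first exact: nagata_denM.
    by apply: (idealD idE); apply: (idealMl idE).
  by rewrite rmorphD !rmorphM -e -f; ring.
- have [t [q [dt f]]] := nagata_den_frac a.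
  exists (t * s), (q * p); split; [exact: nagata_denM | exact: (idealMl idE) |].
  by rewrite !rmorphM -e -f; ring.
Qed.

Lemma nagata_max_near1 x : nagata_max x -> exists y, (1 + x) * y = 1.
Proof.
have idE := ideal_gen_ideal (fun q : T => exists2 c, m c & q = c%:MP).
move=> [s [p [ds ep e]]]; have [|z hz] := @nagata_den_unit (s + p).
  by move=> h; apply: ds; rewrite -[s](addrK p); apply: (idealB idE).
by exists (L s * z); rewrite mulrA mulrDl mul1r (mulrC x) e -rmorphD.
Qed.

Lemma nagata_max_map c : m c -> nagata_max (phi c).
Proof.
move=> mc; exists 1, c%:MP; split; first exact: nagata_den1.
  by apply: submod_genS; exists c.
by rewrite rmorph1 mul1r.
Qed.

(* Clear denominators and read the relation coefficient by coefficient. *)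
Lemma nagata_flat N q (M : 'M[R]_(N, q)) (v : 'rV[S]_N) (Q : 'rV[S]_N -> Prop) :
  row_submod Q -> (forall l : 'rV_N, l *m M = 0 -> Q (map_mx phi l)) ->
  v *m map_mx phi M = 0 -> Q v.
Proof.
move=> [Q0 QD] hQ vM.
have QZ a x : Q x -> Q (a *: x) by move=> Qx; rewrite -[_ *: _]addr0; apply: QD.
have [s [p [ds hs]]] := nagata_frac_row v.
have [t dt ht] : exists2 t, nagata_den t & t *: (p *m map_mx (@mpolyC (r * n) R) M) = 0.
  apply: nagata_ker_row; rewrite map_mxM -hs -map_mx_comp -scalemxAl.
  by rewrite -[map_mx (_ \o _) M]/(map_mx phi M) vM scaler0.
pose p' := t *: p.
have [y hy] := nagata_den_unit (nagata_denM dt ds).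
suff : Q (map_mx L p').
  move=> /(QZ y); rewrite /p' map_mxZ -hs !scalerA -mulrA -rmorphM (mulrC y) hy.
  by rewrite scale1r.
pose d := \max_(i < N) msize (p' 0%R i).
have -> : map_mx L p' = \sum_(k : 'X_{1..(r * n) < d})
    L 'X_[k] *: map_mx phi (\row_i (p' 0 i)@_k).
  apply/rowP=> i; rewrite [LHS]mxE summxE.
  have le : (msize (p' 0%R i) <= d)%N.
    exact: (leq_bigmax (F := fun i : 'I_N => msize (p' 0%R i))).
  rewrite {1}(mpolywE le) rmorph_sum; apply: eq_bigr => k _.
  by rewrite !mxE -mul_mpolyC rmorphM mulrC.
elim/big_rec: _ => // k x _ Qx; apply: QD => //; apply: hQ; apply/rowP=> j.
have := congr1 (fun w : 'rV[T]_q => (w 0 j)@_k) ht.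
rewrite scalemxAl !mxE mcoeff0 raddf_sum => e; rewrite -[RHS]e.
by apply: eq_bigr => i _; rewrite !mxE [RHS]/= mulrC [X in _ = X@_ _]mulrC mcoeffCM.
Qed.

End Nagata.

(** * Base change and rank *)

Section Tensor.
Variables (R S : comPzRingType) (f : {rmorphism R -> S}) (E : lmodType R).

Lemma tensor1D x y : tensor1 f (x + y) = tensor1 f x + tensor1 f y :> tensor f E.
Proof.
rewrite -[RHS]/(tensor_add _ _) tensor_addE; apply/tensor_pi_eq; exact: teq_addr.
Qed.

Lemma tensor1Z a x : tensor1 f (a *: x) = f a *: tensor1 f x :> tensor f E.
Proof.
rewrite -[RHS]/(tensor_scale _ _) tensor_scaleE; apply/tensor_pi_eq.
by rewrite /= mulr1 -[f a]mul1r; apply: teq_bal.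
Qed.

Lemma tensor1_0 : tensor1 f 0 = 0 :> tensor f E.
Proof. by rewrite -(scale0r (0 : E)) tensor1Z rmorph0 scale0r. Qed.

Lemma tensor1_sum N (c : 'I_N -> R) (x : 'I_N -> E) :
  tensor1 f (\sum_i c i *: x i) = \sum_i f (c i) *: tensor1 f (x i).
Proof.
elim/big_rec2: _ => [|i u v _ <-]; first exact: tensor1_0.
by rewrite tensor1D tensor1Z.
Qed.

Lemma tensor_piE u : tensor_pi f u = \sum_(p <- u) p.1 *: tensor1 f p.2 :> tensor f E.
Proof.
elim: u => [|[c x] u IH]; first by rewrite big_nil.
rewrite big_cons -IH -[RHS]/(tensor_add (tensor_scale _ _) _) tensor_scaleE.
by rewrite tensor_addE /= mulr1.
Qed.

Lemma tensor_lift (V : lmodType S) (g : E -> V) :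
  (forall x y, g (x + y) = g x + g y) -> (forall a x, g (a *: x) = f a *: g x) ->
  exists h : {linear tensor f E -> V}, forall x, h (tensor1 f x) = g x.
Proof.
move=> gD gZ; pose G (u : tsum S E) := \sum_(p <- u) p.1 *: g p.2.
have Geq u v : tensor_eq f u v -> G u = G v.
  rewrite /G; elim=> {u v} [//|//|u v w _ -> _ -> //|u u' v v' _ IH _ IH'|u v|x|c d x|c x y|c a x].
  - by rewrite !big_cat IH IH'.
  - by rewrite !big_cat /= addrC.
  - by rewrite big_seq1 big_nil scale0r.
  - by rewrite big_seq1 big_cons big_seq1 scalerDl.
  - by rewrite big_seq1 big_cons big_seq1 gD scalerDr.
  - by rewrite !big_seq1 gZ scalerA.
have GE u : G (repr (tensor_pi f u)) = G u by apply/Geq/tensor_repr.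
have [|h hh] := @linear_ex S (tensor f E) V (fun t => G (repr t)).
  move=> c s t; have [u ->] := tensor_surj s; have [v ->] := tensor_surj t.
  rewrite -[_ + _]/(tensor_add (tensor_scale _ _) _) tensor_scaleE tensor_addE !GE.
  rewrite /G big_cat /= big_map scaler_sumr; congr (_ + _).
  by apply: eq_bigr => p _; rewrite scalerA.
by exists h => x; rewrite hh GE /G big_seq1 scale1r.
Qed.

Lemma tensor_row N (j : {linear E -> 'rV[R]_N}) :
  exists J : {linear tensor f E -> 'rV[S]_N}, forall x, J (tensor1 f x) = map_mx f (j x).
Proof.
apply: tensor_lift => [x y|a x]; first by rewrite linearD map_mxD.
by rewrite linearZ map_mxZ.
Qed.

End Tensor.

(** If e < k, padding with zeros to square matrices writes the identity as a product with a zero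
    column in one factor. *)
Lemma inverse_mx_leq (S : comPzRingType) k e (A : 'M[S]_(k, e)) B :
  (1 : S) <> 0 -> A *m B = 1%:M -> (k <= e)%N.
Proof.
move=> S1 AB; rewrite leqNgt; apply/negP => lt.
have [d hd] : exists d, k = (e + d.+1)%N by exists (k - e.+1)%N; rewrite -addSnnS subnKC.
subst k; apply: S1; rewrite -(det1 S (e + d.+1)) -AB.
have -> : A *m B = row_mx A (0 : 'M_(_, d.+1)) *m col_mx B 0.
  by rewrite mul_row_col mul0mx addr0.
rewrite det_mulmx (expand_det_col _ (rshift e ord0)) big1 ?mul0r // => i _.
by rewrite row_mxEr mxE mul0r.
Qed.

Lemma total_frac_unit (R : comPzRingType) (c : R) :
  nonzerodivisor c -> exists y, total_frac_map R c * y = 1.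
Proof.
move=> nz; exists (loc_frac 1 (mul_closureS nz)).
rewrite -[_ * _]/(loc_mul _ _) loc_mulE -[RHS]/(loc_frac 1 (mul_closure1 _)).
by apply: loc_eq_frac; ring.
Qed.

Lemma total_frac_nonzero (R : comNzRingType) : (1 : total_frac R) <> 0.
Proof.
move=> /loc_frac_eq[u hu e].
have nzu : nonzerodivisor u.
  elim: hu => [|s t hs _ ht]; last exact: nzdM.
  by move=> x; rewrite mul1r.
have u0 : u = 0 by have := e; rewrite mul0r mulr0 !mulr1.
by have /eqP := oner_neq0 R; apply; apply: nzu; rewrite u0 mul0r.
Qed.

(** Over the total ring of fractions [c] is a unit, so [j] becomes an isomorphism with inverse [K];
    invariance of rank concludes. *)
Lemma has_rank_ambient (R : comNzRingType) (E : lmodType R) e k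
    (j : {linear E -> 'rV[R]_k}) (c : R) :
  has_rank E e -> injective j -> nonzerodivisor c ->
  (forall v, exists x, j x = c *: v) -> k = e.
Proof.
move=> [F bijF] injj nzc hc.
pose Q := total_frac R; pose f : {rmorphism R -> Q} := total_frac_map R.
have [y hy] := total_frac_unit nzc.
have [J hJ] := tensor_row f j.
have /choice[x hx] : forall i : 'I_k, exists x, j x = c *: delta_mx 0 i by move=> i; apply: hc.
have [K hK] := @row_linear_ex Q (tensor f E) k (fun i => y *: tensor1 f (x i)).
have JK v : J (K v) = v.
  rewrite hK linear_sum [RHS]row_sum_delta; apply: eq_bigr => i _.
  rewrite !linearZ /= hJ hx map_mxZ map_delta_mx !scalerA; congr (_ *: _).
  by rewrite -mulrA (mulrC y) hy mulr1.
have KJ t : K (J t) = t.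
  have [u ->] := tensor_surj t; rewrite tensor_piE !linear_sum.
  apply: eq_bigr => -[s z] _ /=; rewrite !linearZ /= hJ hK; congr (_ *: _).
  rewrite (eq_bigr (fun i => y *: (f (j z 0 i) *: tensor1 f (x i)))); last first.
    by move=> i _; rewrite mxE !scalerA mulrC.
  rewrite -scaler_sumr -tensor1_sum.
  rewrite (_ : \sum_i _ = c *: z); first by rewrite tensor1Z scalerA mulrC hy scale1r.
  apply: injj; transitivity (c *: j z); last by rewrite linearZ.
  rewrite linear_sum [in RHS](row_sum_delta (j z)) scaler_sumr.
  by apply: eq_bigr => i _; rewrite linearZ /= hx !scalerA mulrC.
have [G FG GF] := bijF.
have linG : linear G by exact: can2_linear FG GF.
have [G' hG'] := linear_ex linG.
have S1 := @total_frac_nonzero R.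
pose A := lin1_mx (F \o K); pose B := lin1_mx (J \o G').
have hA v : v *m A = F (K v) by rewrite mul_rV_lin1.
have hB v : v *m B = J (G' v) by rewrite mul_rV_lin1.
apply/eqP; rewrite eqn_leq; apply/andP; split.
  apply: (@inverse_mx_leq Q _ _ A B S1); apply/row_matrixP=> i.
  by rewrite !rowE mulmxA hA hB hG' FG JK mulmx1.
apply: (@inverse_mx_leq Q _ _ B A S1); apply/row_matrixP=> i.
by rewrite !rowE mulmxA hB hA KJ hG' GF mulmx1.
Qed.

Section NagataModule.
Variables (R : comNzRingType) (noethR : noetherian R) (m : R -> Prop).
Hypothesis localR : local_ring m.
Variables (n r : nat) (E : lmodType R).
Local Notation S := (nagata m n.+1 r).
Local Notation phi := (@nagata_map R m n.+1 r).
Local Notation E' := (nagata_module m E n.+1 r).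
Variables (d N : nat) (j : {linear E -> 'rV[R]_d}) (M : 'M[R]_(N, d)) (x : 'I_N -> E).
Hypotheses (injj : injective j) (jx : forall l, j (x l) = row l M).
Hypothesis genM : forall y, exists c, j y = c *m M.

(** Injectivity of [J] is flatness: a kernel element is [t v] with [v] a relation among the extended
    rows, and [t] kills the relations coming from R. *)
Lemma nagata_module_embed : exists (J : {linear E' -> 'rV[S]_d}) (t : {linear 'rV[S]_N -> E'}),
  [/\ forall y, J (tensor1 phi y) = map_mx phi (j y), injective J,
      surjective t & forall v, J (t v) = v *m map_mx phi M].
Proof.
have [J hJ] := tensor_row phi j.
have [t ht] := @row_linear_ex S (tensor phi E) N (fun l => tensor1 phi (x l)).
have Jt v : J (t v) = v *m map_mx phi M.
  rewrite ht linear_sum mulmx_sum_row; apply: eq_bigr => l _.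
  by rewrite linearZ /= hJ jx map_row.
have tphi (l : 'rV_N) : t (map_mx phi l) = tensor1 phi (\sum_i l 0 i *: x i).
  by rewrite ht tensor1_sum; apply: eq_bigr => i _; rewrite mxE.
have jsum (l : 'rV_N) : j (\sum_i l 0 i *: x i) = l *m M.
  by rewrite linear_sum mulmx_sum_row; apply: eq_bigr => i _; rewrite linearZ /= jx.
have surt : surjective t.
  have h1 y : exists v, t v = tensor1 phi y.
    have [c hc] := genM y; exists (map_mx phi c); rewrite tphi; congr tensor1.
    by apply: injj; rewrite jsum.
  move=> s; have [u ->] := tensor_surj s; rewrite tensor_piE.
  elim/big_ind: _ => [|_ _ [v <-] [w <-]|[s' y] _].
  - by exists 0; rewrite linear0.
  - by exists (v + w); rewrite linearD.
  - by have [v hv] := h1 y; exists (s' *: v); rewrite linearZ /= hv.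
exists J, t; split=> // s s' e; apply/subr0_eq.
have [v hv] := surt (s - s'); rewrite -hv.
apply: (nagata_flat noethR localR (M := M) (Q := fun v => t v = 0)).
- by split=> [|a u w tu tw]; rewrite ?linear0 // linearP tu tw scaler0 addr0.
- move=> l lM; rewrite tphi (_ : \sum_i _ = 0) ?tensor1_0 //.
  by apply: injj; rewrite jsum lM linear0.
- by rewrite -Jt hv linearB e subrr.
Qed.

End NagataModule.

(** * Generic Bourbaki ideals in coordinates *)

Lemma quotm_lift (R : comPzRingType) (V M : lmodType R) (A : V -> Prop)
    (g : {linear V -> M}) : (forall x, A x -> g x = 0) ->
  exists h : {linear quotm A -> M}, forall x, h (quotm_pi A x) = g x.
Proof.
move=> killA.
have kill x : submod_gen A x -> g x = 0.
  elim=> [|a y z Ay _ IH]; first exact: linear0.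
  by rewrite linearP (killA y Ay) IH scaler0 addr0.
have gE x : g (repr (quotm_pi A x : quotm A)) = g x.
  apply/subr0_eq; rewrite -linearB; apply: kill; apply/quotm_eq.
  by rewrite /quotm_pi reprK.
have [|h hh] := @linear_ex R (quotm A) M (fun q => g (repr q)).
  move=> a p q; have [x ->] := quotm_surj p; have [y ->] := quotm_surj q.
  by rewrite -linearP !gE linearP.
by exists h => x; rewrite hh gE.
Qed.

Lemma quotm_pi0 (R : comPzRingType) (V : lmodType R) (A : V -> Prop) x :
  quotm_pi A x = 0 <-> submod_gen A x.
Proof. by rewrite -(linear0 (quotm_pi A)) quotm_eq subr0. Qed.

Lemma submod_gen_id (R : comPzRingType) (V : lmodType R) (A : V -> Prop) x :
  A 0 -> (forall a x y, A x -> A y -> A (a *: x + y)) -> submod_gen A x <-> A x.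
Proof.
move=> A0 AD; split; last exact: submod_genS.
by elim=> // a y z Ay _; apply: AD.
Qed.

(** Submodules are mere predicates, so the row space is realized as a quotient of the free
    module. *)
Lemma row_image (R : comPzRingType) k N (G : 'M[R]_(k, N)) :
  exists (K : lmodType R) (i : {linear K -> 'rV[R]_N}) (p : {linear 'rV[R]_k -> K}),
    [/\ injective i, surjective p & forall v, i (p v) = v *m G].
Proof.
pose A (v : 'rV[R]_k) := v *m G = 0.
have idA x : submod_gen A x <-> A x.
  apply: submod_gen_id; rewrite /A ?mul0mx // => a u v uG vG.
  by rewrite mulmxDl -scalemxAl uG vG scaler0 addr0.
have [i hi] := @quotm_lift R _ _ A (mulmxr G) (fun x h => h).
exists (quotm A), i, (quotm_pi A); split=> // [x y|q]; last first.
  by have [x ->] := quotm_surj q; exists x.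
have [u ->] := quotm_surj x; have [v ->] := quotm_surj y.
by rewrite !hi /= => e; apply/quotm_eq/idA; rewrite /A mulmxBl e subrr.
Qed.

Section FreePresentation.
Variables (R : comNzRingType) (E : lmodType R) (d N : nat).
Variables (j : {linear E -> 'rV[R]_d}) (M : 'M[R]_(N, d)) (x : 'I_N -> E).
Hypotheses (injj : injective j) (jx : forall l, j (x l) = row l M).
Hypothesis genM : forall y, exists c, j y = c *m M.

Lemma presentation : exists p : {linear 'rV[R]_N -> E},
  surjective p /\ forall v, j (p v) = v *m M.
Proof.
have [p hp] := row_linear_ex x.
have jp v : j (p v) = v *m M.
  rewrite hp linear_sum mulmx_sum_row; apply: eq_bigr => l _.
  by rewrite linearZ /= jx.
exists p; split=> // y; have [c hc] := genM y.
by exists c; apply: injj; rewrite jp.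
Qed.

Lemma independent_projective :
  (forall v : 'rV_N, v *m M = 0 -> v = 0) -> projective E.
Proof.
move=> indM; have [p [surp jp]] := presentation.
apply: (projective_iso (f := p)) => //; last exact: projective_row.
move=> u v e; apply/subr0_eq/indM.
by rewrite -jp linearB e subrr linear0.
Qed.

End FreePresentation.

Section GenericBourbaki.
Variables (R : comNzRingType) (noethR : noetherian R) (m : R -> Prop).
Hypothesis localR : local_ring m.
Variables (n r : nat) (E : lmodType R) (a : 'I_r -> E).
Local Notation S := (nagata m n.+1 r).
Local Notation T := (mpoly (r * n) R).
Local Notation L := (@nagata_loc R m n.+1 r).
Local Notation phi := (@nagata_map R m n.+1 r).
Local Notation E' := (nagata_module m E n.+1 r).
Local Notation x_ := (@generic_elt R m E n.+1 r a).
Local Notation W := (quotm (fun y : E' => exists k, y = x_ k)).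
Local Notation piW := (quotm_pi (fun y : E' => exists k, y = x_ k)).

Section Coordinates.
Variables (j : {linear E -> 'rV[R]_n.+1}) (N : nat) (M : 'M[R]_(N, n.+1)) (x : 'I_N -> E).
Hypotheses (injj : injective j) (jx : forall l, j (x l) = row l M).
Hypothesis genM : forall y, exists c, j y = c *m M.
Variables (J : {linear E' -> 'rV[S]_n.+1}) (t : {linear 'rV[S]_N -> E'}).
Hypotheses (Jphi : forall y, J (tensor1 phi y) = map_mx phi (j y)).
Hypotheses (injJ : injective J) (surt : surjective t).
Hypothesis Jt : forall v, J (t v) = v *m map_mx phi M.

Let A : 'M[R]_(r, n.+1) := \matrix_i j (a i).
Let X : 'M[S]_(n, n.+1) := map_mx L (generic_rows A).
Local Notation Mp := (map_mx phi M).

Lemma coord_generic_elt k : J (x_ k) = row k X.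
Proof.
rewrite linear_sum; apply/rowP=> l; rewrite summxE !mxE rmorph_sum.
apply: eq_bigr => i _; rewrite linearZ /= Jphi !mxE rmorphM /=.
by congr (_ * _).
Qed.

Lemma coord_submod s :
  submod_gen (fun y : E' => exists k, y = x_ k) s <-> exists b, J s = b *m X.
Proof.
split=> [|[b e]].
  elim=> [|c y z [k ->] _ [b e]]; first by exists 0; rewrite linear0 mul0mx.
  exists (c *: delta_mx 0 k + b).
  by rewrite linearP e coord_generic_elt mulmxDl -scalemxAl -rowE.
have -> : s = \sum_k b 0 k *: x_ k.
  apply: injJ; rewrite e linear_sum mulmx_sum_row; apply: eq_bigr => k _.
  by rewrite linearZ /= coord_generic_elt.
elim/big_rec: _ => [|k z _ h]; first exact: submod_gen0.
by apply: submod_genP => //; exists k.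
Qed.

Lemma bourbaki_presentation : exists p : {linear 'rV[S]_N -> W},
  surjective p /\ forall v, p v = 0 <-> exists b, v *m Mp = b *m X.
Proof.
exists (piW \o t); split=> [w|v]; last by rewrite /= quotm_pi0 coord_submod Jt.
have [s ->] := quotm_surj w; have [v <-] := surt s; by exists v.
Qed.

Lemma coord_lift : exists Y : 'M[S]_(n, N), Y *m Mp = X.
Proof.
have /choice[v hv] := fun k => surt (x_ k).
exists (\matrix_k v k); apply/row_matrixP=> k.
by rewrite row_mul rowK -Jt hv coord_generic_elt.
Qed.

(* [f w] times the extended module lies in F + S s0, so the determinant of s0   *)
(* on top of [X] divides a power of [f w * phi c].                             *)
Lemma coord_independent (c : R) (f : {linear W -> S^o}) w :
  nonzerodivisor c -> (forall v, exists y, j y = c *: v) ->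
  injective f -> nonzerodivisor (f w) -> forall b : 'rV_n, b *m X = 0 -> b = 0.
Proof.
move=> nzc hc injf nzw b bX; have [s0 e0] := quotm_surj w.
pose g : {linear E' -> S^o} := f \o piW.
have gw : f w = g s0 by rewrite e0.
have rowB i : exists ub : S * 'rV[S]_n,
    (f w * phi c) *: delta_mx 0 i = ub.1 *: J s0 + ub.2 *m X.
  have [y hy] := hc (delta_mx 0 i); pose s : E' := tensor1 phi y.
  have Js : J s = phi c *: delta_mx 0 i by rewrite Jphi hy map_mxZ map_delta_mx.
  have /quotm_pi0/coord_submod[b' hb'] : piW (f w *: s - g s *: s0) = 0.
    apply: injf; rewrite (linear0 f) -[LHS]/(g _) (linearB g) !(linearZZ g) -gw.
    by apply/eqP; rewrite subr_eq0; apply/eqP; apply: mulrC.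
  exists (g s, b') => /=; rewrite -hb' (linearB J) !(linearZZ J) addrC subrK.
  by rewrite Js scalerA.
have [ub hub] := choice rowB.
pose B : 'M[S]_(1 + n) := \matrix_i row_mx (ub i).1%:M (ub i).2.
pose Y : 'M[S]_(1 + n) := col_mx (J s0) X.
have BY : B *m Y = (f w * phi c)%:M.
  apply/row_matrixP=> i; rewrite row_mul rowK mul_row_col mul_scalar_mx -hub.
  by rewrite rowE mul_mx_scalar.
have nzY : nonzerodivisor (\det Y).
  apply: (@nzdMr _ (\det B)); rewrite -det_mulmx BY det_scalar.
  apply/nzdX/nzdM => //; exact: (nzd_nagata_map noethR localR).
have := nzd_det_free nzY (v := row_mx 0 b) _.
rewrite mul_row_col mul0mx add0r => /(_ bX)/(congr1 rsubmx).
by rewrite row_mxKr linear0.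
Qed.

Section Syzygies.
Variables (k : nat) (G : 'M[R]_(k, N)).
Hypothesis genG : forall l : 'rV_N, l *m M = 0 <-> exists c, l = c *m G.
Local Notation Gp := (map_mx phi G).

Lemma syzygies_mul : Gp *m Mp = 0.
Proof.
rewrite -map_mxM (_ : G *m M = 0) ?map_mx0 //; apply/row_matrixP=> i.
by rewrite row_mul row0; apply/genG; exists (delta_mx 0 i); rewrite rowE.
Qed.

Lemma syzygies_nagata (v : 'rV[S]_N) : v *m Mp = 0 -> exists d, v = d *m Gp.
Proof.
apply: (nagata_flat noethR localR (Q := fun v => exists d, v = d *m Gp)).
  split=> [|s _ _ [c ->] [d ->]]; first by exists 0; rewrite mul0mx.
  by exists (s *: c + d); rewrite mulmxDl scalemxAl.
by move=> l /genG[c ->]; exists (map_mx phi c); rewrite map_mxM.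
Qed.

(** From v M = b X = b Y M, the difference v - b Y is a syzygy, hence generated by the rows of
    [G]. *)
Lemma bourbaki_kernel (Y : 'M[S]_(n, N)) (v : 'rV_N) : Y *m Mp = X ->
  (exists b : 'rV_n, v *m Mp = b *m X) <-> exists u, v = u *m col_mx Y Gp.
Proof.
move=> YM; split=> [[b e]|[u ->]].
  have [d hd] : exists d, v - b *m Y = d *m Gp.
    by apply: syzygies_nagata; rewrite mulmxBl -mulmxA YM e subrr.
  by exists (row_mx b d); rewrite mul_row_col -hd addrC subrK.
exists (lsubmx u); rewrite -[u in LHS]hsubmxK mul_row_col mulmxDl -!mulmxA YM.
by rewrite syzygies_mul mulmx0 addr0.
Qed.

End Syzygies.
End Coordinates.
End GenericBourbaki.

(** * Existence of a good generic Bourbaki ideal *)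

Section BourbakiEmbedding.
Variables (R : comNzRingType) (noethR : noetherian R) (m : R -> Prop).
Hypothesis localR : local_ring m.
Variables (n r : nat) (E : lmodType R) (a : 'I_r -> E).
Local Notation S := (nagata m n.+1 r).
Local Notation L := (@nagata_loc R m n.+1 r).
Local Notation phi := (@nagata_map R m n.+1 r).
Local Notation E' := (nagata_module m E n.+1 r).
Local Notation x_ := (@generic_elt R m E n.+1 r a).
Local Notation W := (quotm (fun y : E' => exists k, y = x_ k)).
Local Notation piW := (quotm_pi (fun y : E' => exists k, y = x_ k)).
Variables (j : {linear E -> 'rV[R]_n.+1}) (J : {linear E' -> 'rV[S]_n.+1}).
Hypotheses (Jphi : forall y, J (tensor1 phi y) = map_mx phi (j y)).
Hypothesis (injJ : injective J).

Let A : 'M[R]_(r, n.+1) := \matrix_i j (a i).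
Let X : 'M[S]_(n, n.+1) := map_mx L (generic_rows A).
Let delta (v : 'rV[S]_n.+1) : S := \det (col_mx v X : 'M[S]_(1 + n)).

Lemma bordered_cofactor (v : 'rV[S]_n.+1) (l : 'I_(1 + n)) :
  cofactor (col_mx v X : 'M[S]_(1 + n)) (lshift n ord0) l =
  (-1) ^+ l * L (generic_minor A l).
Proof.
rewrite /cofactor add0n /generic_minor -det_map_mx; congr (_ * \det _).
apply/matrixP=> i k; rewrite [LHS]mxE [LHS]mxE.
have -> : lift (lshift n ord0) i = rshift 1 i by apply: val_inj.
by rewrite col_mxEd !mxE.
Qed.

Lemma bordered_det v : delta v = \sum_l v 0 l * ((-1) ^+ l * L (generic_minor A l)).
Proof.
rewrite /delta (expand_det_row _ (lshift n ord0)); apply: eq_bigr => l _.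
by rewrite bordered_cofactor col_mxEu.
Qed.

Lemma bordered_det_row k : delta (row k X) = 0.
Proof.
apply: (determinant_alternate (i1 := lshift n ord0) (i2 := rshift 1 k)) => // l.
by rewrite col_mxEu col_mxEd mxE.
Qed.

(** The adjugate of the bordered matrix annihilates it; row [l] of this identity has the signed
    minor as coefficient of [v]. *)
Lemma bordered_det_ker v l : delta v = 0 ->
  exists b, L (generic_minor A l) *: v = b *m X.
Proof.
move=> d0; pose Y : 'M[S]_(1 + n) := col_mx v X.
have : row l (\adj Y) *m Y = 0.
  by rewrite -row_mul mul_adj_mx -/(delta v) d0 raddf0 row0.
rewrite -[row l _]hsubmxK mul_row_col => e.
have el : lsubmx (row l (\adj Y)) = ((-1) ^+ l * L (generic_minor A l))%:M.
  by rewrite [LHS]mx11_scalar !mxE bordered_cofactor.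
rewrite el mul_scalar_mx in e.
exists (- (-1) ^+ l *: rsubmx (row l (\adj Y))).
have := congr1 (fun u => (-1) ^+ l *: u) e; rewrite scaler0 scalerDr scalerA signrMK.
move=> /eqP; rewrite addr_eq0 => /eqP ->.
by rewrite -scalemxAl scaleNr.
Qed.

Variables c1 c2 : R.
Hypotheses (rad1 : minors_radical A c1) (rad2 : minors_radical A c2).
Hypotheses (reg12 : regular_pair c1 c2) (nz2 : nonzerodivisor c2).

Let regL := @regular_pair_nagata R noethR m localR n r.

(** Write p, q for the last and first minors, with p v = b X and q v = b' X. Independence of the
    rows gives q b = p b', so p divides [b] by regularity and cancels. *)
Lemma bordered_det_kernel v : delta v = 0 <-> exists b, v = b *m X.
Proof.
have [nzmax reg] := regL (generic_minors_regular rad1 rad2 reg12 nz2).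
split=> [d0|[b ->]]; last first.
  rewrite mulmx_sum_row; elim/big_rec: _ => [|k u _ IH].
    by rewrite bordered_det big1 // => l _; rewrite mxE mul0r.
  have dD s t c : delta (c *: s + t) = c * delta s + delta t.
    rewrite !bordered_det mulr_sumr -big_split; apply: eq_bigr => l _.
    by rewrite !mxE mulrDl mulrA.
  by rewrite dD IH bordered_det_row mulr0 addr0.
have [b hb] := bordered_det_ker ord_max d0; have [b' hb'] := bordered_det_ker ord0 d0.
have indX (u : 'rV_n) : u *m X = 0 -> u = 0.
  move=> uX; pose Xm : 'M[S]_n := col' ord_max X.
  have nzX : nonzerodivisor (\det Xm).
    have -> // : \det Xm = L (generic_minor A ord_max).
    rewrite /generic_minor -det_map_mx; congr (\det _).
    by apply/matrixP=> i k; rewrite !mxE.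
  apply: (nzd_det_free nzX); apply/rowP=> i.
  move/rowP/(_ (lift ord_max i)): uX; rewrite !mxE => uX; rewrite -[RHS]uX.
  by apply: eq_bigr => k _; rewrite !mxE.
set p := L (generic_minor A ord_max) in nzmax reg hb.
set q := L (generic_minor A ord0) in reg hb'.
have /rowP e : q *: b - p *: b' = 0.
  by apply: indX; rewrite mulmxBl -!scalemxAl -hb -hb' !scalerA mulrC subrr.
have /choice[u hu] : forall i, exists u, b 0 i = p * u.
  by move=> i; apply: (reg _ (b' 0 i)); apply/subr0_eq; have := e i; rewrite !mxE.
exists (\row_i u i); apply/rowP=> i; apply: (nzdI nzmax).
have -> : p * v 0 i = (p *: v) 0 i by rewrite mxE.
rewrite hb (_ : b = p *: \row_i u i) -?scalemxAl ?mxE //.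
by apply/rowP=> k; rewrite !mxE hu.
Qed.

Lemma bourbaki_embedding : exists f : {linear W -> S^o},
  [/\ injective f,
      forall c l, (forall v, exists y, j y = c *: v) ->
        exists w, f w = L (mpolyC (r * n) c * generic_minor A l) &
      regular_pair (L (mpolyC (r * n) c1 * generic_minor A ord_max))
        (L (mpolyC (r * n) c2 * generic_minor A ord0))].
Proof.
have [g hg] : exists g : {linear E' -> S^o}, forall s, g s = delta (J s).
  apply: linear_ex => c s t; rewrite !bordered_det linearP scaler_sumr -big_split.
  by apply: eq_bigr => l _; rewrite !mxE mulrDl -mulrA.
have [|f hf] := @quotm_lift _ _ _ (fun y : E' => exists k, y = x_ k) g.
  by move=> _ [k ->]; rewrite hg (coord_generic_elt a Jphi) bordered_det_row.
exists f; split.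
- move=> w w' e; apply/subr0_eq; have [s hs] := quotm_surj (w - w').
  rewrite hs; apply/quotm_pi0/(coord_submod a Jphi injJ)/bordered_det_kernel.
  by rewrite -hg -hf -hs linearB e subrr.
- move=> c l hc; have [y hy] := hc (delta_mx 0 l).
  (* The sign cancels that of the cofactor. *)
  exists (((-1) ^+ l : S) *: piW (tensor1 phi y)).
  rewrite linearZ /= hf hg Jphi hy map_mxZ map_delta_mx bordered_det (bigD1 l) //=.
  rewrite big1 ?addr0 => [|k /negbTE kl]; last by rewrite !mxE eqxx kl mulr0 mul0r.
  rewrite !mxE !eqxx mulr1 rmorphM -[LHS]/(_ * _) mulrCA signrMK.
  by [].
- exact/regL/scaled_generic_minors_regular.
Qed.

End BourbakiEmbedding.

(** * Projective dimension of the module and of the ideal *)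

Lemma minimal_presentation (R : comNzRingType) (m : R -> Prop) (E : lmodType R)
    d (j : {linear E -> 'rV[R]_d}) :
  noetherian R -> local_ring m -> exists N (M : 'M[R]_(N, d)) (x : 'I_N -> E),
  [/\ forall l, j (x l) = row l M, forall y, exists c, j y = c *m M &
      forall v : 'rV_N, v *m M = 0 -> forall i, m (v 0 i)].
Proof.
move=> noethR localR.
have [|N [M [hM minM]]] := minimal_row_generators noethR localR
    (P := fun v => exists x, j x = v).
  split=> [|a _ _ [x <-] [y <-]]; first by exists 0; rewrite linear0.
  by exists (a *: x + y); rewrite linearP.
have /choice[x hx] : forall l, exists x, j x = row l M.
  by move=> l; apply/hM; exists (delta_mx 0 l); rewrite rowE.
exists N, M, x; split=> // y; apply/hM; by exists y.
Qed.

Lemma minimal_syzygies (R : comNzRingType) (m : R -> Prop) N d (M : 'M[R]_(N, d)) :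
  noetherian R -> local_ring m -> exists k (G : 'M[R]_(k, N)),
  (forall l : 'rV_N, l *m M = 0 <-> exists c, l = c *m G) /\
  forall v : 'rV_k, v *m G = 0 -> forall i, m (v 0 i).
Proof.
move=> noethR localR.
apply: (minimal_row_generators noethR localR (P := fun l => l *m M = 0)).
split=> [|a u v uM vM]; first by rewrite mul0mx.
by rewrite mulmxDl -scalemxAl uM vM scaler0 addr0.
Qed.

(** By regularity the annihilator of [c2] equals [c1] times itself; it is finitely generated and c1
    lies in [m], so Nakayama's lemma makes it 0. *)
Lemma regular_seq_nzd2 (R : comNzRingType) (m : R -> Prop) (c1 c2 : R) :
  noetherian R -> local_ring m -> regular_seq [:: c1; c2] -> nonzerodivisor c2.
Proof.
move=> noethR localR reg; have [nz1 reg12] := regular_seq_pair reg.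
have idm := local_ideal localR.
have mc1 : m c1.
  apply: contrapT => /(local_unit noethR localR)[y hy].
  have [_] := reg; apply; rewrite -hy mulrC.
  by apply: (@submod_genZ R R^o); apply: submod_genS; rewrite mem_head.
have idK : ideal (fun x => c2 * x = 0).
  split=> [|x y hx hy|a x hx]; first by rewrite mulr0.
    by rewrite mulrDr hx hy addr0.
  by rewrite mulrCA hx mulr0.
have [s hs] := noethR _ idK.
have /choice[u hu] : forall i : 'I_(size s), exists u : 'I_(size s) -> R,
    s`_i = c1 * \sum_l u l * s`_l.
  move=> i; have ci : c2 * s`_i = 0 by apply/hs/submod_genS/mem_nth.
  have [|w hw] := reg12 s`_i 0; first by rewrite ci mulr0.
  have /hs/ideal_gen_seqP[u e] : c2 * w = 0.
    by apply: nz1; rewrite mulrCA -hw.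
  by exists u; rewrite hw e.
pose v : 'rV[R]_(size s) := \row_i s`_i.
pose T : 'M[R]_(size s) := \matrix_(l, i) (c1 * u i l).
have v0 : v = 0.
  apply: (nakayama_row idm (local_near1 noethR localR) (T := T)).
    by move=> l i; rewrite mxE; apply: (idealMr idm).
  apply/rowP=> i; rewrite !mxE hu mulr_sumr; apply: eq_bigr => l _.
  by rewrite !mxE; ring.
move=> x /hs/ideal_gen_seqP[c ->]; apply: big1 => i _.
by have /rowP/(_ i) := v0; rewrite !mxE => ->; rewrite mulr0.
Qed.

Lemma ideal_module_embedding (R : comNzRingType) (m : R -> Prop) (E : lmodType R) :
  noetherian R -> local_ring m -> ideal_module E ->
  exists k (j : {linear E -> 'rV[R]_k}) c1 c2,
  [/\ injective j, forall v, exists x, j x = c1 *: v,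
      forall v, exists x, j x = c2 *: v, regular_pair c1 c2 & nonzerodivisor c2].
Proof.
move=> noethR localR [_ _ [k [j [injj gr]]]].
have ann c : annihilator (quotm (fun y => exists x, y = j x)) c ->
    forall v, exists x, j x = c *: v.
  move=> annc v; have := annc (quotm_pi _ v); rewrite -linearZ => /quotm_pi0.
  move=> h; have idA := @submod_gen_id R _ (fun y => exists x, y = j x) (c *: v).
  have [||y hy] := (idA _ _).1 h; last by exists y.
    by exists 0; rewrite linear0.
  by move=> b _ _ [x ->] [y ->]; exists (b *: x + y); rewrite linearP.
case: gr => [/ann h1|[[|c1 [|c2 [|? ?]]] [] // _ ans reg]].
  have nz1 : nonzerodivisor (1 : R) by move=> x; rewrite mul1r.
  (* Here E is all of G; the improper pair 1, 1 serves. *)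
  exists k, j, 1, 1; split=> //.
  by split=> // w v; rewrite !mul1r => ->; exists v; rewrite mul1r.
exists k, j, c1, c2; split=> //.
- by apply/ann/ans; rewrite mem_head.
- by apply/ann/ans; rewrite !inE eqxx orbT.
- exact: (regular_seq_pair reg).
- exact: (regular_seq_nzd2 noethR localR reg).
Qed.

Section Equivalences.
Variables (R : comNzRingType) (noethR : noetherian R) (m : R -> Prop).
Hypothesis localR : local_ring m.
Variables (n r : nat) (E : lmodType R) (a : 'I_r -> E).
Local Notation S := (nagata m n.+1 r).
Local Notation L := (@nagata_loc R m n.+1 r).
Local Notation phi := (@nagata_map R m n.+1 r).
Local Notation E' := (nagata_module m E n.+1 r).
Local Notation W := (quotm (fun y : E' => exists k, y = @generic_elt R m E n.+1 r a k)).

Let idm : ideal m := local_ideal localR.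
Let near1 := local_near1 noethR localR.

Lemma nagata_relations_max N q (M : 'M[R]_(N, q)) :
  (forall v : 'rV_N, v *m M = 0 -> forall i, m (v 0 i)) ->
  forall v : 'rV[S]_N, v *m map_mx phi M = 0 -> forall i, nagata_max (v 0 i).
Proof.
move=> minM v; have idS := nagata_max_ideal noethR localR n r.
apply: (nagata_flat noethR localR (Q := fun v => forall i, nagata_max (v 0 i))).
  split=> [i|s x y hx hy i]; rewrite !mxE; first exact: ideal0.
  by apply: (idealD idS) => //; apply: (idealMl idS).
by move=> l lM i; rewrite mxE; apply: (nagata_max_map noethR localR); apply: minM.
Qed.

Lemma nagata_independent N q (M : 'M[R]_(N, q)) :
  (forall v : 'rV_N, v *m M = 0 -> v = 0) ->
  forall v : 'rV[S]_N, v *m map_mx phi M = 0 -> v = 0.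
Proof.
move=> indM v; apply: (nagata_flat noethR localR (Q := fun v => v = 0)).
  by split=> [|s x y -> ->] //; rewrite scaler0 addr0.
by move=> l /indM ->; rewrite map_mx0.
Qed.

Lemma nagata_independent_inv N q (M : 'M[R]_(N, q)) :
  (forall v : 'rV[S]_N, v *m map_mx phi M = 0 -> v = 0) ->
  forall v : 'rV_N, v *m M = 0 -> v = 0.
Proof.
move=> indM v vM; have := indM (map_mx phi v); rewrite -map_mxM vM map_mx0.
move=> /(_ erefl)/rowP v0; apply/rowP=> i; have := v0 i; rewrite !mxE => e.
apply: (nagata_map_inj noethR localR (n := n) (r := r)).
exact: etrans e (esym (rmorph0 _)).
Qed.

Lemma projective_independent d N (j : {linear E -> 'rV[R]_d}) (M : 'M[R]_(N, d)) x :
  injective j -> (forall l, j (x l) = row l M) ->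
  (forall y, exists c, j y = c *m M) ->
  (forall v : 'rV_N, v *m M = 0 -> forall i, m (v 0 i)) ->
  projective E -> forall v : 'rV_N, v *m M = 0 -> v = 0.
Proof.
move=> injj jx genM minM proE; have [p [surp jp]] := presentation injj jx genM.
have [T [pT kerT]] := projective_split_row proE surp.
apply: (split_relations_free idm near1 (T := T)) => //.
  by apply/row_matrixP=> i; rewrite !rowE mulmxA -jp pT jp.
by move=> v vM; apply: kerT; apply: injj; rewrite jp vM linear0.
Qed.

Section Presented.
Variables (j : {linear E -> 'rV[R]_n.+1}) (N : nat) (M : 'M[R]_(N, n.+1)) (x : 'I_N -> E).
Hypotheses (injj : injective j) (jx : forall l, j (x l) = row l M).
Hypothesis genM : forall y, exists c, j y = c *m M.
Hypothesis minM : forall v : 'rV_N, v *m M = 0 -> forall i, m (v 0 i).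
Variables (k : nat) (G : 'M[R]_(k, N)).
Hypothesis genG : forall l : 'rV_N, l *m M = 0 <-> exists c, l = c *m G.
Hypothesis minG : forall v : 'rV_k, v *m G = 0 -> forall i, m (v 0 i).

Lemma proj_dim1_syzygies_independent :
  proj_dim_le E 1 -> forall v : 'rV_k, v *m G = 0 -> v = 0.
Proof.
move=> pdE; have [p [surp jp]] := presentation injj jx genM.
have [K [i [q [inji surq iq]]]] := row_image G.
have ex : exact_at i p.
  move=> v; split=> [pv|[z <-]].
    have /genG[c ->] : v *m M = 0 by rewrite -jp pv linear0.
    by exists (q c); rewrite iq.
  have [c <-] := surq z; apply: injj; rewrite jp linear0 iq.
  by apply/genG; exists c.
have proK := proj_dim_le1_kernel pdE inji surp ex (@projective_row R N).
have [T [qT kerT]] := projective_split_row proK surq.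
apply: (split_relations_free idm near1 (T := T)) => //.
  by apply/row_matrixP=> l; rewrite !rowE mulmxA -iq qT iq.
by move=> v vG; apply: kerT; apply: inji; rewrite iq vG linear0.
Qed.

Lemma syzygies_independent_proj_dim1 :
  (forall v : 'rV_k, v *m G = 0 -> v = 0) -> proj_dim_le E 1.
Proof.
move=> indG; have [p [surp jp]] := presentation injj jx genM.
have pro i := @projective_row R i.
apply: (@resolution_proj_dim_le R 'rV[R]_0 'rV[R]_k 'rV[R]_N E \0 (mulmxr G) p) => //.
- by move=> u v _; rewrite [u]thinmx0 [RHS]thinmx0.
- move=> v; split=> [/= /indG ->|[y <-]]; first by exists 0.
  by rewrite /= mul0mx.
- move=> v; split=> [pv|[c <-]].
    have /genG[c ->] : v *m M = 0 by rewrite -jp pv linear0.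
    by exists c.
  by apply: injj; rewrite jp linear0; apply/genG; exists c.
- by right; split=> // v; rewrite [v]thinmx0 [RHS]thinmx0.
Qed.

Variables (c : R) (nzc : nonzerodivisor c).
Hypothesis annc : forall v, exists y, j y = c *: v.
Variables (I : S -> Prop) (f : {linear W -> S^o}) (injf : injective f).
Hypothesis imf : forall s, I s <-> exists w, f w = s.

Let data : exists (J : {linear E' -> 'rV[S]_n.+1}) (t : {linear 'rV[S]_N -> E'}),
  [/\ forall y, J (tensor1 phi y) = map_mx phi (j y), injective J,
      surjective t & forall v, J (t v) = v *m map_mx phi M].
Proof. exact: nagata_module_embed. Qed.

Local Notation X := (map_mx L (generic_rows (\matrix_i j (a i)))).
Local Notation Mp := (map_mx phi M).
Local Notation Gp := (map_mx phi G).

(* The mapping cone of the presentations of F and of the extended module. *)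
Lemma bourbaki_resolution : (exists2 s, I s & nonzerodivisor s) ->
  exists (p : {linear 'rV[S]_N -> W}) (Y : 'M[S]_(n, N)),
  [/\ surjective p, forall v, p v = 0 <-> exists u, v = u *m col_mx Y Gp,
      forall b : 'rV_n, b *m X = 0 -> b = 0, Y *m Mp = X &
      forall v, p v = 0 <-> exists b, v *m Mp = b *m X].
Proof.
move=> [s /imf[w <-] nzw]; have [J [t [Jphi injJ surt Jt]]] := data.
have [p [surp kerp]] := bourbaki_presentation a Jphi injJ surt Jt.
have [Y YM] := coord_lift a Jphi surt Jt.
exists p, Y; split=> //.
  by move=> v; rewrite kerp; apply: (bourbaki_kernel noethR localR genG).
exact: (coord_independent noethR localR Jphi injJ nzc annc injf nzw).
Qed.

(** Now [W] is projective, so E'' splits as F plus a copy of [W]. The splitting lifts to a matrix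
    fixing the generators and killing their relations; by minimality there are no relations over S,
    hence none over R. *)
Lemma unit_ideal_projective : I 1 -> projective E.
Proof.
move=> I1; have [w1 hw1] : exists w, f w = 1 by apply/imf.
have nz1 : exists2 s, I s & nonzerodivisor s by exists 1 => // z; rewrite mul1r.
have [p [Y [surp _ indX YM kerp]]] := bourbaki_resolution nz1.
have proW := unit_image_projective injf hw1.
have [T [pT kerT]] := projective_split_row proW surp.
have /choice[b hb] : forall i, exists b, row i (1%:M - T) *m Mp = b *m X.
  by move=> i; apply/kerp/split_row_kernel.
have eB : (1%:M - T) *m Mp = (\matrix_i b i) *m X.
  by apply/row_matrixP=> i; rewrite !row_mul rowK hb.
set B := \matrix_i b i in eB.
apply: (independent_projective injj jx genM); apply: nagata_independent_inv.
have idS := nagata_max_ideal noethR localR n r.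
have near1S := @nagata_max_near1 R m n r.
(* [T] handles the summand [W], and [B *m Y] restores the component (1 - T) M = B X lying in F. *)
apply: (split_relations_free idS near1S (T := T + B *m Y)).
- by rewrite mulmxDl -mulmxA YM -eB mulmxBl mul1mx addrC subrK.
- move=> v vM; have vT : v *m T = 0 by apply/kerT/kerp; exists 0; rewrite vM mul0mx.
  have : v *m B *m X = 0 by rewrite -mulmxA -eB mulmxA mulmxBr mulmx1 vT subr0.
  by move/indX => vB; rewrite mulmxDr vT mulmxA vB mul0mx addr0.
- exact: nagata_relations_max.
Qed.

Lemma good_bourbaki_perfect : proj_dim E 1 -> grade_ge I 2 -> perfect_of_grade I 2.
Proof.
move=> [pd1 npd0] gr2.
have npro : ~ projective E by move=> /projective_proj_dim_le0; apply: npd0.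
have I1 : ~ I 1 by move=> /unit_ideal_projective.
have [p [Y [surp ker indX YM kerp]]] := bourbaki_resolution (grade_ge2_nzd gr2).
have indG := nagata_independent (proj_dim1_syzygies_independent pd1).
pose C : {linear 'rV[S]_(n + k) -> 'rV[S]_N} := mulmxr (col_mx Y Gp).
have injC : injective C.
  move=> u v uv; apply/subr0_eq.
  have : (u - v) *m col_mx Y Gp = 0 by rewrite mulmxBl; apply/eqP; rewrite subr_eq0; apply/eqP.
  rewrite -[u - v]hsubmxK mul_row_col => e.
  have b0 : lsubmx (u - v) = 0.
    apply: indX; have := congr1 (mulmx^~ Mp) e.
    by rewrite mulmxDl -!mulmxA YM (syzygies_mul m r genG) mulmx0 addr0 mul0mx.
  by move: e; rewrite b0 mul0mx add0r => /indG ->; rewrite row_mx0.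
have exC : exact_at C p.
  by move=> v; rewrite ker; split=> -[u hu]; exists u.
exact: (perfect_of_free_presentation injf imf injC exC surp gr2 I1).
Qed.

Lemma perfect_bourbaki_not_projective : perfect_of_grade I 2 -> ~ projective W.
Proof.
move=> [[gr2 ngr3] _]; have I1 : ~ I 1 by move=> I1; apply: ngr3; left.
have [p [Y [surp _ _ _ _]]] := bourbaki_resolution (grade_ge2_nzd gr2).
exact: (grade2_not_projective injf imf surp gr2 I1).
Qed.

(** The kernel of the presentation of [W] is projective, but minimality is known only for its
    generators in [G]. So only the lower right block of the splitting matrix [T] is used. *)
Lemma perfect_bourbaki_proj_dim_le1 : perfect_of_grade I 2 -> proj_dim_le E 1.
Proof.
move=> [[gr2 ngr3] [pd2 _]].
have I1 : ~ I 1 by move=> I1; apply: ngr3; left.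
have [p [Y [surp ker indX YM kerp]]] := bourbaki_resolution (grade_ge2_nzd gr2).
have [K [i [q [inji surq iq]]]] := row_image (col_mx Y Gp).
have ex : exact_at i p.
  move=> v; rewrite ker; split=> [[u ->]|[z <-]]; first by exists (q u).
  by have [u <-] := surq z; exists u.
have proK := proj_dim_le2_kernel pd2 injf imf inji surp ex (projective_row (n := N)).
have [T [qT kerT]] := projective_split_row proK surq.
apply/syzygies_independent_proj_dim1/nagata_independent_inv.
have GM := syzygies_mul m r genG.
have rowT (v : 'rV[S]_k) : row_mx 0 v *m T =
    row_mx (v *m dlsubmx T) (v *m drsubmx T).
  by rewrite -{1}[T]submxK mul_row_block !mul0mx !add0r.
have idS := nagata_max_ideal noethR localR n r.
have near1S := @nagata_max_near1 R m n r.
apply: (split_relations_free idS near1S (T := drsubmx T)).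
- apply/row_matrixP=> l; rewrite !rowE mulmxA.
  pose v : 'rV[S]_k := delta_mx 0 l; rewrite -/v.
  have := congr1 i (qT (row_mx 0 v)).
  rewrite !iq rowT !mul_row_col mul0mx add0r => e.
  (* Multiplying by [Mp] kills the rows of [Gp] and turns [Y] into [X], whose rows are
     independent. *)
  have d0 : v *m dlsubmx T = 0.
    apply: indX; have := congr1 (mulmx^~ Mp) e.
    by rewrite mulmxDl -!mulmxA GM !mulmx0 addr0 YM.
  by move: e; rewrite d0 mul0mx add0r.
- move=> v vG; have : row_mx 0 v *m T = 0.
    by apply: kerT; apply: inji; rewrite iq mul_row_col mul0mx add0r vG linear0.
  by rewrite rowT => /(congr1 rsubmx); rewrite row_mxKr linear0.
- exact: nagata_relations_max.
Qed.

End Presented.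

(** A projective E is free, so its own coordinates serve as the embedding, with c1 = c2 = 1. A
    generic maximal minor is then a unit of S, and the determinant functional identifies [W] with
    S. *)
Lemma projective_bourbaki_projective d (j : {linear E -> 'rV[R]_d}) (U : E -> Prop) :
  injective j -> has_rank E n.+1 -> reduction U ->
  (forall x, U x <-> submod_gen (fun y => exists i, y = a i) x) ->
  projective E -> projective W.
Proof.
move=> injj rankE redU genU proE.
have [N [M [x [jx genM minM]]]] := minimal_presentation j noethR localR.
have indM := projective_independent injj jx genM minM proE.
have [p [surp jp]] := presentation injj jx genM.
have injp : injective p.
  by move=> u v e; apply/subr0_eq/indM; rewrite -jp linearB e subrr linear0.
have [q pq] := linear_lift (g := idfun) injp surp.
have injq : injective q by move=> y z /(congr1 p); rewrite !pq.
have nz1 : nonzerodivisor (1 : R) by move=> z; rewrite mul1r.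
have q1 v : exists y, q y = 1 *: v.
  by exists (p v); apply: injp; rewrite pq scale1r.
have eN := has_rank_ambient rankE injq nz1 q1.
subst N.
have [|y|J [_ [Jphi injJ _ _]]] := nagata_module_embed noethR localR n r
  (M := 1%:M) (x := fun l => p (delta_mx 0 l)) injq.
- by move=> l; apply: injp; rewrite pq row1.
- by exists (q y); rewrite mulmx1.
have rad1 : minors_radical (\matrix_i q (a i)) 1.
  by move=> H idH radH; apply: (reduction_minors redU genU idH radH q1).
have reg1 : regular_pair (1 : R) 1.
  by split=> // w v; rewrite !mul1r => ->; exists v; rewrite mul1r.
have [f [injf imf _]] := bourbaki_embedding noethR localR Jphi injJ rad1 rad1 reg1 nz1.
have [w hw] := imf 1 ord_max q1.
(* If all coefficients of the minor were in [m], then [generic_minor_ideal] with w = 1 and c = 1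
   would put 1 in [m]. *)
have den : nagata_den m (mpolyC (r * n) 1 * generic_minor (\matrix_i q (a i)) ord_max).
  rewrite mpolyC1 mul1r => /(extended_idealP localR) ext.
  have [||K hK] := generic_minor_ideal (w := 1) rad1 idm (k := ord_max).
  - by right.
  - by move=> l; rewrite mulr1; apply: ext.
  apply: (local_proper localR); have := hK 0%MM.
  by rewrite mpolyC1 expr1n mulr1 mcoeff1 eqxx.
have [y hy] := nagata_den_unit den.
by apply: (unit_image_projective injf (w1 := y *: w)); rewrite linearZ /= hw [LHS]mulrC.
Qed.

End Equivalences.

Theorem proposition5p5
  (R : comNzRingType) (m : R -> Prop)
  (noethR : noetherian R) (localR : local_ring m)
  (E : lmodType R) (e : nat) (e_ge2 : (2 <= e)%N)
  (idealE : ideal_module E) (rankE : has_rank E e)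
  (U : E -> Prop) (redU : reduction U)
  (r : nat) (a : 'I_r -> E)
  (genU : forall x, U x <-> submod_gen (fun y => exists i, y = a i) x) :
  let A := proj_dim E 1 in
  let B := forall I : nagata m e r -> Prop,
    generic_Bourbaki_ideal a I -> good I -> perfect_of_grade I 2 in
  let C := exists I : nagata m e r -> Prop,
    generic_Bourbaki_ideal a I /\ perfect_of_grade I 2 in
  (A <-> B) /\ (B <-> C).
Proof.
move=> A B C; have [d [j [c1 [c2 [injj ann1 ann2 reg12 nz2]]]]] :=
  ideal_module_embedding noethR localR idealE.
(* E contains c1 G, so the ambient free module has rank e, as the square bordered determinants
   require. *)
have nz1 := reg12.1; have ed := has_rank_ambient rankE injj nz1 ann1; subst d.
case: e e_ge2 @A @B @C rankE j injj ann1 ann2 => [//|n] _ A B C rankE j injj ann1 ann2.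
have [N [M [x [jx genM minM]]]] := minimal_presentation j noethR localR.
have [k [G [genG minG]]] := minimal_syzygies M noethR localR.
have AB : A -> B.
  move=> pd1 I [f [injf imf]] gr2.
  exact: (good_bourbaki_perfect noethR localR injj jx genM minM genG minG nz1 ann1
    injf imf pd1 gr2).
have CA : C -> A.
  move=> [I [[f [injf imf]] perf]]; split; last first.
    move=> [|//] _ /proj_dim_le0 proE.
    apply: (perfect_bourbaki_not_projective noethR localR injj jx genM genG nz1 ann1
      injf imf perf).
    exact: (projective_bourbaki_projective noethR localR (m := m) injj rankE redU genU).
  exact: (perfect_bourbaki_proj_dim_le1 noethR localR injj jx genM genG minG nz1 ann1
    injf imf perf).
have BC : B -> C.
  move=> hB; have [J [_ [Jphi injJ _ _]]] := nagata_module_embed noethR localR n r injj jx genM.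
  have rad c : (forall v, exists y, j y = c *: v) -> minors_radical (\matrix_i j (a i)) c.
    by move=> annc H idH radH; apply: (reduction_minors redU genU idH radH annc).
  have [f [injf imf reg]] :=
    bourbaki_embedding noethR localR Jphi injJ (rad _ ann1) (rad _ ann2) reg12 nz2.
  pose I s := exists w, f w = s.
  have bI : generic_Bourbaki_ideal a I by exists f; split.
  exists I; split=> //; apply: hB => //.
  exact: (regular_pair_grade (image_ideal f) (imf c1 ord_max ann1) (imf c2 ord0 ann2) reg).
by split; split; auto.
Qed.
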